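(* Let $1\le r<n$, $\mu>0$, and let $A\in\mathbb{R}^{n\times n}$, $C\in\mathbb{R}^{p\times n}$ and $H$ (with $p$ rows) be constant matrices with $A$ and $HH'$ invertible, $A=A'$, and the eigenvalues of $A$ distinct. Let $U_r\in\mathrm{St}(r,n)$ be a matrix whose columns form an orthonormal basis of the dominant subspace of $A$, i.e. the sum of the eigenspaces associated with the $r$ largest eigenvalues, and suppose that the pair $(U_r'AU_r,\,CU_r)$ is observable. Consider the cascaded system on $\mathrm{St}(r,n)\times P_+(r)$ $$\frac{d}{dt}U=(I-UU')AU,\qquad \frac{d}{dt}R=A_UR+RA_U'+\mu^2I-RC_U'(HH')^{-1}C_UR,$$ where $A_U=U'AU$ and $C_U=CU$. Then for almost every initial condition $U(0)\in\mathrm{St}(r,n)$ and every $R(0)\in P_+(r)$, the solution $(U(t),R(t))$ exists for all $t\ge0$ and converges as $t\to\infty$ to fixed values $(U_\infty,R_\infty)\in\mathrm{St}(r,n)\times P_+(r)$, where the columns of $U_\infty$ span the dominant subspace of $A$.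
   Context: $M'$ denotes the transpose of $M$. $P_+(r)$ is the cone of symmetric positive definite $r\times r$ real matrices; $\mathrm{St}(r,n)$ is the Stiefel manifold of $n\times r$ real matrices $U$ with $U'U=I_r$. A pair $(F,K)$ with $F\in\mathbb{R}^{r\times r}$, $K\in\mathbb{R}^{p\times r}$ is observable if the matrix obtained by stacking $K,KF,\dots,KF^{r-1}$ has rank $r$; observability of $(U'AU,CU)$ does not depend on the choice of orthonormal basis $U$ of a given subspace. ''Almost every'' refers to the natural Riemannian volume measure on $\mathrm{St}(r,n)$. *)

(* Defs.v *)
From HB Require Import structures.
From mathcomp Require Import all_boot all_order all_algebra.
From mathcomp Require Import all_classical all_reals all_analysis.

Set Implicit Arguments.
Unset Strict Implicit.
Unset Printing Implicit Defensive.

Import Order.TTheory GRing.Theory Num.Theory.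
Import numFieldNormedType.Exports.

Local Open Scope classical_set_scope.
Local Open Scope ring_scope.

Definition stiefel (R : realType) (n r : nat) : set 'M[R]_(n, r) :=
  [set U | U^T *m U = 1%:M].

Definition posdef (R : realType) (r : nat) : set 'M[R]_r :=
  [set S | S^T = S /\
           forall x : 'cV[R]_r, x != 0 -> 0 < (x^T *m S *m x) 0 0].

Definition observable (R : realType) (r p : nat)
    (F : 'M[R]_r) (K : 'M[R]_(p, r)) : Prop :=
  \rank (\mxcol_(i < r) (K *m F ^+ i)) = r.

(** All eigenvalues have algebraic multiplicity one. Only real eigenvalues are
    looked at, so this is meant for symmetric [A]. *)
Definition distinct_eigenvalues (R : realType) (n : nat) (A : 'M[R]_n) : Prop :=
  forall a : R, eigenvalue A a -> mup a (char_poly A) = 1%N.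

(** [s] lists the [r] largest eigenvalues of [A], when the eigenvalues of [A]
    are real and distinct. *)
Definition largest_eigenvalues (R : realType) (n : nat) (A : 'M[R]_n)
    (r : nat) (s : seq R) : Prop :=
  [/\ uniq s, size s = r, {in s, forall a, eigenvalue A a} &
      forall a b, a \in s -> eigenvalue A b -> b \notin s -> b < a].

(** The columns of [U] span the sum of the eigenspaces of [A] associated with
    its [r] largest eigenvalues, [r] being the number of columns of [U].
    Subspaces are row spaces in MathComp and [eigenspace] consists of left
    eigenvectors, hence the transpositions. *)
Definition spans_dominant_subspace (R : realType) (n r : nat) (A : 'M[R]_n)
    (U : 'M[R]_(n, r)) : Prop :=
  exists2 s : seq R, largest_eigenvalues A r s &
    (U^T :=: \sum_(a <- s) eigenspace A^T a)%MS.

Definition oja_field (R : realType) (n r : nat) (A : 'M[R]_n)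
    (U : 'M[R]_(n, r)) : 'M[R]_(n, r) :=
  (1%:M - U *m U^T) *m A *m U.

Definition riccati_field (R : realType) (n r p q : nat) (A : 'M[R]_n)
    (C : 'M[R]_(p, n)) (H : 'M[R]_(p, q)) (mu : R)
    (U : 'M[R]_(n, r)) (S : 'M[R]_r) : 'M[R]_r :=
  let AU := U^T *m A *m U in
  let CU := C *m U in
  AU *m S + S *m AU^T + (mu ^+ 2)%:M
    - S *m CU^T *m invmx (H *m H^T) *m CU *m S.

(** [(U, S)] solves the cascaded system in St(r, n) x P_+(r) on the time
    interval [0, T[. Functions are total on [R]; their values at negative times
    only serve to make the derivative at 0 two-sided and are otherwise
    irrelevant: a solution with a right derivative at 0 becomes one in this
    sense after extending it linearly to negative times. *)
Definition cascade_solution (R : realType) (n r p q : nat) (A : 'M[R]_n)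
    (C : 'M[R]_(p, n)) (H : 'M[R]_(p, q)) (mu : R) (T : \bar R)
    (U : R -> 'M[R]_(n, r)) (S : R -> 'M[R]_r) : Prop :=
  forall t : R, 0 <= t -> (t%:E < T)%E ->
    [/\ stiefel (U t), posdef (S t),
        is_derive t 1 U (oja_field A (U t)) &
        is_derive t 1 S (riccati_field A C H mu (U t) (S t))].

(** [(U, S)] is the solution through [(U0, S0)] and exists for all [t >= 0]:
    every other solution, on whatever interval [0, T[, is a restriction of it. *)
Definition is_global_solution (R : realType) (n r p q : nat) (A : 'M[R]_n)
    (C : 'M[R]_(p, n)) (H : 'M[R]_(p, q)) (mu : R)
    (U0 : 'M[R]_(n, r)) (S0 : 'M[R]_r)
    (U : R -> 'M[R]_(n, r)) (S : R -> 'M[R]_r) : Prop :=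
  [/\ cascade_solution A C H mu +oo%E U S, U 0 = U0, S 0 = S0 &
      forall (T : \bar R) (V : R -> 'M[R]_(n, r)) (Q : R -> 'M[R]_r),
        cascade_solution A C H mu T V Q -> V 0 = U0 -> Q 0 = S0 ->
        forall t : R, 0 <= t -> (t%:E < T)%E -> V t = U t /\ Q t = S t].

(** Euclidean (Frobenius) distance; the norm that MathComp-Analysis puts on
    matrices is the max norm, which is not the Riemannian one. *)
Definition frobenius_dist (R : realType) (n r : nat) (X Y : 'M[R]_(n, r)) : R :=
  Num.sqrt (\tr ((X - Y)^T *m (X - Y))).

(** The maximum with 0 makes the diameter of the empty set 0. *)
Definition diam (R : realType) (n r : nat) (E : set 'M[R]_(n, r)) : \bar R :=
  maxe 0%E
    (ereal_sup [set (frobenius_dist X Y)%:E | X in E & Y in E]).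

(** Hausdorff (outer) measure of dimension [d], without normalising factor. *)
Definition hausdorff_premeasure (R : realType) (n r d : nat) (delta : R)
    (E : set 'M[R]_(n, r)) : \bar R :=
  ereal_inf [set (\sum_(0 <= k <oo) diam (F k) ^+ d)%E
            | F in [set F : nat -> set 'M[R]_(n, r) |
                     E `<=` \bigcup_k F k /\
                     forall k, (diam (F k) <= delta%:E)%E]].

Definition hausdorff_measure (R : realType) (n r d : nat)
    (E : set 'M[R]_(n, r)) : \bar R :=
  ereal_sup [set hausdorff_premeasure d delta E
            | delta in [set delta : R | 0 < delta]].

Definition stiefel_dim (n r : nat) : nat := (n * r - (r * r.+1)./2)%N.

(** For an embedded submanifold of dimension [d] of a Euclidean space, the
    Riemannian volume of the induced metric is the [d]-dimensional Hausdorff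
    measure up to a positive normalising constant, which is immaterial for
    null sets. *)
Definition almost_every_stiefel (R : realType) (n r : nat)
    (P : 'M[R]_(n, r) -> Prop) : Prop :=
  hausdorff_measure (stiefel_dim n r) [set U | stiefel U /\ ~ P U] = 0%E.

(* Main.v *)
Require Import Defs.
From HB Require Import structures.
From mathcomp Require Import all_boot all_order all_algebra.
From mathcomp Require Import all_classical all_reals all_analysis.
From mathcomp Require Import ring lra zify.
Import Order.TTheory GRing.Theory Num.Theory.
Import numFieldNormedType.Exports.
Local Open Scope classical_set_scope.
Local Open Scope ring_scope.

Set Implicit Arguments.
Unset Strict Implicit.
Unset Printing Implicit Defensive.

(** The Oja flow is linear in homogeneous coordinates: U = W G with W' = A W and
    G' = - (W'W)^-1 W'AW G. If Ur'U(0) is invertible, the component of W orthogonal to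
    the dominant subspace, divided by Ur'W, decays like exp(-g t), where g is the
    spectral gap (Rayleigh quotients). Hence dU/dt decays exponentially and U
    converges to an orthonormal basis of the dominant subspace.

    The Riccati equation is solved as R = Y X^-1, with (X, Y) a solution of the
    Hamiltonian linear system. Observability in the limit provides a
    supersolution, so R stays bounded; then D = dR/dt solves a Lyapunov equation
    whose source decays exponentially, and comparing D and -D with
    k exp(-kappa t) R, which is a supersolution thanks to mu^2 I > 0, shows that
    D decays exponentially. So R converges, and since dR/dt >= - k exp(-kappa t) R,
    the limit is positive definite.

    The bad set, where Ur'U(0) is singular, is covered by countably many Lipschitz
    images of bounded subsets of a Euclidean space of dimension one less than that
    of the Stiefel manifold: after singling out one column of U, this column is
    determined up to sign by the others and by a point of the projective space of
    ker Ur', which has dimension n - r - 1 instead of n - r. *)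

(** * Matrix-valued functions of a real variable *)

(** Both nonlinear equations are lifted to linear ones because these have solutions on the whole
    line. Global existence then amounts to the denominators [W^T W] and [X] staying invertible, and
    this is read off from a conserved matrix in the first case and from a monotone one in the
    second. Invertibility of [Ur^T U(0)] enters in the same way: the inverse of [Ur^T W] is itself a
    solution of a linear equation. The inequalities between solutions of Lyapunov equations are
    proved on quadratic forms, evaluated at a vector that moves along the adjoint equation: a norm
    of a matrix is not differentiable, such a form is. The sup norm serves for crude bounds of
    products, and qualitative limits come from a primitive of an exponential bound. For the null set
    an upper estimate of the Hausdorff measure is enough, so that an overlapping, countable cover
    does; its pieces have to be cut according to how close a vector about to be normalised comes to
    0. *)

Lemma mx_normP (R : realType) m n (M : 'M[R]_(m, n)) (e : R) : 0 <= e ->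
  (`|M| <= e) <-> (forall i j, `|M i j| <= e).
Proof.
move=> e0; rewrite [leLHS]/Num.Def.normr/= mx_normrE; split.
  by move=> /bigmax_leP[_ +] i j => /(_ (i, j)); exact.
by move=> H; apply/bigmax_leP; split => // -[i j] _; exact: H.
Qed.

Lemma le_mx_norm (R : realType) m n (M : 'M[R]_(m, n)) i j : `|M i j| <= `|M|.
Proof. by apply: (mx_normP M (normr_ge0 _)).1. Qed.

Lemma mx_norm_mul (R : realType) m n p (M : 'M[R]_(m, n)) (N : 'M[R]_(n, p)) :
  `|M *m N| <= n%:R * `|M| * `|N|.
Proof.
apply/mx_normP => [|i j]; first by rewrite !mulr_ge0.
rewrite mxE (le_trans (ler_norm_sum _ _ _))//.
rewrite -mulrA mulr_natl -[n in _ *+ n]card_ord -sumr_const ler_sum// => k _.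
by rewrite normrM ler_pM// le_mx_norm.
Qed.

Lemma mx_norm_tr (R : realType) m n (M : 'M[R]_(m, n)) : `|M^T| = `|M|.
Proof.
apply/eqP; rewrite eq_le; apply/andP; split; apply/mx_normP => // i j.
  by rewrite mxE le_mx_norm.
by have := le_mx_norm M^T j i; rewrite mxE.
Qed.

Section calculus.
Context {R : realType}.

Lemma is_derive_mxP m n (M : R -> 'M[R]_(m, n)) (t : R) (dM : 'M[R]_(m, n)) :
  is_derive t 1 M dM <-> forall i j, is_derive t 1 (fun s => M s i j) (dM i j).
Proof.
split.
  move=> [dM1 <-] i j; have := dM1 => /derivable_mxP/(_ i j) h.
  by rewrite derive_mx// mxE; apply: DeriveDef.
move=> H.
have h : derivable M t 1 by apply/derivable_mxP => i j; case: (H i j).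
split=> //; rewrite derive_mx//; apply/matrixP => i j; rewrite mxE.
by case: (H i j).
Qed.

Lemma is_derive_fsum (I : Type) (s : seq I) (f : I -> R -> R) (t : R) (df : I -> R) :
  (forall i, is_derive t 1 (f i) (df i)) ->
  is_derive t 1 (fun x => \sum_(i <- s) f i x) (\sum_(i <- s) df i).
Proof.
move=> H; elim: s => [|a s IH].
  have -> : (fun x => \sum_(i <- [::]) f i x) = cst 0.
    by apply/funext => x; rewrite big_nil.
  by rewrite big_nil; exact: is_derive_cst.
have -> : (fun x => \sum_(i <- a :: s) f i x) = f a + (fun x => \sum_(i <- s) f i x).
  by apply/funext => x; rewrite big_cons.
by rewrite big_cons; exact: is_deriveD.
Qed.

Lemma is_derive_mul (f g : R -> R) (t df dg : R) :
  is_derive t 1 f df -> is_derive t 1 g dg ->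
  is_derive t 1 (fun s => f s * g s) (df * g t + f t * dg).
Proof.
move=> hf hg; rewrite addrC [df * _]mulrC; exact: (is_deriveM hf hg).
Qed.

Lemma is_derive_mulmx m n p (M : R -> 'M[R]_(m, n)) (N : R -> 'M[R]_(n, p))
    (t : R) dM dN :
  is_derive t 1 M dM -> is_derive t 1 N dN ->
  is_derive t 1 (fun s => M s *m N s) (dM *m N t + M t *m dN).
Proof.
move=> /is_derive_mxP hM /is_derive_mxP hN; apply/is_derive_mxP => i j.
have -> : (fun s => (M s *m N s) i j) = fun s => \sum_k M s i k * N s k j.
  by apply/funext => s; rewrite mxE.
rewrite !mxE -big_split/=.
by apply: is_derive_fsum => k; exact: is_derive_mul.
Qed.

Lemma is_derive_trmx m n (M : R -> 'M[R]_(m, n)) (t : R) dM :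
  is_derive t 1 M dM -> is_derive t 1 (fun s => (M s)^T) dM^T.
Proof.
move=> /is_derive_mxP hM; apply/is_derive_mxP => i j.
by rewrite mxE; under eq_fun do rewrite mxE; exact: hM.
Qed.

Lemma is_derive_scale m n (f : R -> R) (M : R -> 'M[R]_(m, n)) (t df : R) dM :
  is_derive t 1 f df -> is_derive t 1 M dM ->
  is_derive t 1 (fun s => f s *: M s) (df *: M t + f t *: dM).
Proof.
move=> hf /is_derive_mxP hM; apply/is_derive_mxP => i j.
under eq_fun do rewrite mxE.
by rewrite !mxE; exact: is_derive_mul.
Qed.

Lemma is_derive_continuous (V : normedModType R) (f : R -> V) (t : R) df :
  is_derive t 1 f df -> {for t, continuous f}.
Proof. by move=> [h _]; exact/differentiable_continuous/derivable1_diffP. Qed.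

Lemma cvg_mxP (T : Type) (F : set_system T) {FF : Filter F} m n
    (M : T -> 'M[R]_(m, n)) (L : 'M[R]_(m, n)) :
  M x @[x --> F] --> L <-> forall i j, M x i j @[x --> F] --> L i j.
Proof.
split=> [h i j|h].
  exact: (cvg_comp _ _ h (@coord_continuous R m n i j L)).
apply/cvgrPdist_le => /= e e0; near=> x.
apply/mx_normP => [|i j]; first exact: ltW.
rewrite !mxE.
move: (i) (j); near: x.
apply: filter_forall => {}i; apply: filter_forall => {}j.
by move/cvgrPdist_le : (h i j) => /(_ _ e0).
Unshelve. all: by end_near. Qed.

Lemma cvg_fsum (T : Type) (F : set_system T) {FF : Filter F} (I : Type) (s : seq I)
    (f : I -> T -> R) (l : I -> R) :
  (forall i, f i x @[x --> F] --> l i) ->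
  (\sum_(i <- s) f i x) @[x --> F] --> \sum_(i <- s) l i.
Proof.
move=> H; elim: s => [|a s IH].
  rewrite big_nil; under eq_fun do rewrite big_nil; exact: cvg_cst.
by rewrite big_cons; under eq_fun do rewrite big_cons; exact: cvgD.
Qed.

Lemma cvg_fprod (T : Type) (F : set_system T) {FF : Filter F} (I : Type) (s : seq I)
    (f : I -> T -> R) (l : I -> R) :
  (forall i, f i x @[x --> F] --> l i) ->
  (\prod_(i <- s) f i x) @[x --> F] --> \prod_(i <- s) l i.
Proof.
move=> H; elim: s => [|a s IH].
  rewrite big_nil; under eq_fun do rewrite big_nil; exact: cvg_cst.
by rewrite big_cons; under eq_fun do rewrite big_cons; exact: cvgM.
Qed.

Lemma cvg_mulmx (T : Type) (F : set_system T) {FF : Filter F} m n p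
    (M : T -> 'M[R]_(m, n)) (N : T -> 'M[R]_(n, p)) (K : 'M[R]_(m, n)) (L : 'M[R]_(n, p)) :
  M x @[x --> F] --> K -> N x @[x --> F] --> L ->
  (M x *m N x) @[x --> F] --> K *m L.
Proof.
move=> /cvg_mxP hM /cvg_mxP hN; apply/cvg_mxP => i j.
rewrite mxE; under eq_fun do rewrite mxE.
by apply: cvg_fsum => k; exact: cvgM.
Qed.

Lemma cvg_trmx (T : Type) (F : set_system T) {FF : Filter F} m n
    (M : T -> 'M[R]_(m, n)) (K : 'M[R]_(m, n)) :
  M x @[x --> F] --> K -> (M x)^T @[x --> F] --> K^T.
Proof.
move=> /cvg_mxP hM; apply/cvg_mxP => i j.
by rewrite mxE; under eq_fun do rewrite mxE; exact: hM.
Qed.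

Lemma cvg_det (T : Type) (F : set_system T) {FF : Filter F} m
    (M : T -> 'M[R]_m) (K : 'M[R]_m) :
  M x @[x --> F] --> K -> \det (M x) @[x --> F] --> \det K.
Proof.
move=> /cvg_mxP hM; apply: cvg_fsum => s.
by apply: cvgM; [exact: cvg_cst|exact: cvg_fprod].
Qed.

Lemma near_unitmx (T : Type) (F : set_system T) {FF : Filter F} m
    (M : T -> 'M[R]_m) (K : 'M[R]_m) : K \in unitmx ->
  M x @[x --> F] --> K -> \forall x \near F, M x \in unitmx.
Proof.
rewrite unitmxE unitfE => uK /cvg_det hM.
have : \forall x \near F, \det (M x) != 0 by exact: (cvgr_neq0 _ hM uK).
by apply: filterS => x; rewrite unitmxE unitfE.
Qed.

Lemma cvg_invmx (T : Type) (F : set_system T) {FF : Filter F} m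
    (M : T -> 'M[R]_m) (K : 'M[R]_m) : K \in unitmx ->
  M x @[x --> F] --> K -> invmx (M x) @[x --> F] --> invmx K.
Proof.
move=> uK hM.
have d0 : \det K != 0 by move: uK; rewrite unitmxE unitfE.
have : ((\det (M x))^-1 *: \adj (M x)) @[x --> F] --> invmx K.
  rewrite /invmx uK; apply/cvg_mxP => i j; rewrite !mxE.
  under eq_fun do rewrite !mxE.
  apply: cvgM; first by apply: cvgV => //; exact: cvg_det.
  apply: cvgM; first exact: cvg_cst.
  apply: cvg_det; apply/cvg_mxP => k l; rewrite !mxE.
  by under eq_fun do rewrite !mxE; move/cvg_mxP : hM; exact.
apply: cvg_trans; apply: near_eq_cvg; near do rewrite /invmx.
have := @near_unitmx _ _ FF _ _ _ uK hM.
by apply: filterS => x ux; rewrite ux.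
Unshelve. all: by end_near. Qed.

Lemma is_derive_cvg (V : normedModType R) (f : R -> V) (t : R) df :
  is_derive t 1 f df <-> h^-1 *: (f (h + t) - f t) @[h --> 0^'] --> df.
Proof.
have E : (fun h : R => h^-1 *: (f (h *: 1 + t) - f t)) = (fun h => h^-1 *: (f (h + t) - f t)).
  by apply/funext => h; rewrite scaler1.
split=> [[h <-]|h].
  by move/cvg_ex : (h) => [l hl]; rewrite /derive -E; move: hl; rewrite /= => /cvgP.
have d : derivable f t 1 by rewrite /derivable/= E; apply/cvg_ex; exists df.
by apply: DeriveDef => //; rewrite /derive/= E; apply/cvg_lim.
Qed.

(** The identity [M(s)^-1 - M(t)^-1 = - M(s)^-1 (M(s) - M(t)) M(t)^-1] turns the difference quotient
    of the inverse into a product of three convergent factors. *)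
Lemma is_derive_invmx m (M : R -> 'M[R]_m) (t : R) dM :
  M t \in unitmx -> is_derive t 1 M dM ->
  is_derive t 1 (fun s => invmx (M s)) (- (invmx (M t) *m dM *m invmx (M t))).
Proof.
move=> ut hM.
have hc := is_derive_continuous hM.
have ct : M (h + t) @[h --> 0^'] --> M t.
  have /continuous_withinNshiftx := hc; exact.
have nr : \forall h \near 0^', M (h + t) \in unitmx by exact: near_unitmx ct.
have hi : invmx (M (h + t)) @[h --> 0^'] --> invmx (M t) by exact: cvg_invmx.
move/is_derive_cvg : hM => hM; apply/is_derive_cvg.
have : - (invmx (M (h + t)) *m (h^-1 *: (M (h + t) - M t)) *m invmx (M t)) @[h --> 0^'] --> - (invmx (M t) *m dM *m invmx (M t)).
  apply: cvgN; apply: cvg_mulmx; last exact: cvg_cst.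
  exact: cvg_mulmx.
apply: cvg_trans; apply: near_eq_cvg.
apply: filterS nr => h uh.
rewrite -scalemxAr -scalemxAl -scalerN mulmxBr mulmxBl mulVmx// mul1mx.
by rewrite -!mulmxA mulmxV// mulmx1 opprB.
Qed.

Lemma derive_ge0_le (f df : R -> R) (a b : R) : a <= b ->
  (forall t, a <= t <= b -> is_derive t 1 f (df t)) ->
  (forall t, a <= t <= b -> 0 <= df t) -> f a <= f b.
Proof.
move=> ab hf h0.
have [||c cab E] := @MVT_segment R f df a b ab.
- by move=> x; rewrite in_itv/= => /andP[/ltW ax /ltW xb]; apply: hf; rewrite ax.
- apply: continuous_in_subspaceT => x; rewrite inE/= in_itv/= => xab.
  exact: is_derive_continuous (hf _ xab).
- rewrite -subr_ge0 E mulr_ge0 ?subr_ge0//; apply: h0; by move: cab; rewrite in_itv.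
Qed.

(** Both [f + g] and [g - f] are nondecreasing. A primitive [g] of the bound takes the place of an
    integral in all later estimates. *)
Lemma derive_norm_le (f g df dg : R -> R) (a b : R) : a <= b ->
  (forall t, a <= t <= b -> is_derive t 1 f (df t)) ->
  (forall t, a <= t <= b -> is_derive t 1 g (dg t)) ->
  (forall t, a <= t <= b -> `|df t| <= dg t) -> `|f b - f a| <= g b - g a.
Proof.
move=> ab hf hg h; rewrite ler_norml opprB; apply/andP; split.
  have := @derive_ge0_le (f + g) (fun t => df t + dg t) a b ab.
  rewrite /= => H; suff : f a + g a <= f b + g b by lra.
  apply: H => t tab; first by apply: is_deriveD; [exact: hf|exact: hg].
  by have := h _ tab; rewrite ler_norml => /andP[]; lra.
suff : g a - f a <= g b - f b by lra.
apply: (@derive_ge0_le (g - f) (fun t => dg t - df t)) => // t tab.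
  by apply: is_deriveB; [exact: hg|exact: hf].
by have := h _ tab; rewrite ler_norml => /andP[]; lra.
Qed.

Lemma derive_mx_norm_le m n (f df : R -> 'M[R]_(m, n)) (g dg : R -> R) (a b : R) : a <= b ->
  (forall t, a <= t <= b -> is_derive t 1 f (df t)) ->
  (forall t, a <= t <= b -> is_derive t 1 g (dg t)) ->
  (forall t, a <= t <= b -> `|df t| <= dg t) -> `|f b - f a| <= g b - g a.
Proof.
move=> ab hf hg h.
have h0 t : a <= t <= b -> 0 <= dg t by move=> /h; apply: le_trans.
apply/mx_normP => [|i j].
  by rewrite subr_ge0; exact: (derive_ge0_le ab hg h0).
rewrite !mxE; apply: (@derive_norm_le (fun s => f s i j) g (fun s => df s i j) dg) => // t tab.
  by have /is_derive_mxP := hf _ tab; exact.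
exact: le_trans (le_mx_norm _ _ _) (h _ tab).
Qed.

Lemma is_derive_affine (a b t : R) : is_derive t 1 (fun s : R => a * s + b) a.
Proof.
have := is_deriveD (is_deriveZ a (is_derive_id t (1 : R))) (is_derive_cst b t (1 : R)).
by rewrite addr0 scaler1.
Qed.

Lemma is_derive_comp_affine m n (f : R -> 'M[R]_(m, n)) (a b t : R) df :
  is_derive (a * t + b) 1 f df -> is_derive t 1 (fun s => f (a * s + b)) (a *: df).
Proof.
move=> /is_derive_mxP hf; apply/is_derive_mxP => i j; rewrite mxE mulrC.
exact: (@is_derive1_comp _ (fun s => f s i j) (fun s => a * s + b) _ _ _ (hf i j) (is_derive_affine a b t)).
Qed.

Lemma is_derive_expZ (c t : R) : is_derive t 1 (fun s => expR (c * s)) (c * expR (c * t)).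
Proof.
rewrite mulrC.
have := @is_derive1_comp R expR (fun s => c * s + 0) t _ _ (is_derive_expR _) (is_derive_affine c 0 t).
by rewrite addr0 /comp; under eq_fun do rewrite addr0.
Qed.

Lemma continuous_segment_bounded (V : normedModType R) (f : R -> V) (a b : R) :
  a <= b -> (forall t, a <= t <= b -> {for t, continuous f}) ->
  exists2 K, 0 <= K & forall t, a <= t <= b -> `|f t| <= K.
Proof.
move=> ab hf.
have [||c cab hc] := @EVT_max R (fun t => `|f t|) a b.
- exact: ab.
- apply: continuous_in_subspaceT => x; rewrite inE/= in_itv/= => xab.
  by apply: cvg_norm; exact: hf.
by exists `|f c| => // t tab; apply: hc; rewrite in_itv.
Qed.

Lemma gronwall_zero m n (D dD : R -> 'M[R]_(m, n)) (T K : R) : 0 <= T ->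
  (forall t, 0 <= t <= T -> is_derive t 1 D (dD t)) ->
  (forall t, 0 <= t <= T -> `|dD t| <= K * `|D t|) ->
  D 0 = 0 -> D T = 0.
Proof.
move=> T0 hD hK D0.
(* The sup norm is not differentiable: Gronwall's argument is run on the sum
   [N] of the squared entries. *)
pose N t := \sum_(ij : 'I_m * 'I_n) D t ij.1 ij.2 ^+ 2.
pose dN t := \sum_(ij : 'I_m * 'I_n) 2 * D t ij.1 ij.2 * dD t ij.1 ij.2.
(* Each of the [m * n] terms of [dN] is at most [2 |K| N], because [|D|^2 <= N] for the sup norm. *)
pose L := 2 * `|K| * (m * n)%:R.
have hN t : 0 <= t <= T -> is_derive t 1 N (dN t).
  move=> tT; apply: is_derive_fsum => -[i j] /=.
  have /is_derive_mxP/(_ i j) hij := hD t tT.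
  have := is_derive_mul hij hij.
  under eq_fun do rewrite -expr2.
  have -> : 2 * D t i j * dD t i j = dD t i j * D t i j + D t i j * dD t i j by ring.
  by [].
have N0 t : 0 <= N t by apply: sumr_ge0 => ij _; exact: sqr_ge0.
have DN t i j : `|D t i j| ^+ 2 <= N t.
  by rewrite real_normK ?num_real// /N (bigD1 (i, j))//= lerDl sumr_ge0// => ij _; exact: sqr_ge0.
have nDN t : `|D t| ^+ 2 <= N t.
  have [->|nz] := eqVneq `|D t| 0; first by rewrite expr0n/=.
  have [[i j] E] : exists i, `|D t| = `|D t i.1 i.2| by exact: mx_norm_neq0.
  by rewrite E; exact: DN.
have hdN t : 0 <= t <= T -> dN t <= L * N t.
  move=> tT; rewrite /dN /L.
  have -> : 2 * `|K| * (m * n)%:R * N t = \sum_(ij : 'I_m * 'I_n) 2 * `|K| * N t.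
    by rewrite sumr_const card_prod !card_ord -mulr_natl; ring.
  apply: ler_sum => -[i j] _ /=.
  rewrite -!mulrA ler_pM2l//; apply: le_trans (ler_norm _) _.
  rewrite normrM; apply: (@le_trans _ _ (`|D t| * (`|K| * `|D t|))).
    apply: ler_pM => //; first exact: le_mx_norm.
    apply: le_trans (le_mx_norm _ _ _) _; apply: le_trans (hK _ tT) _.
    by rewrite ler_wpM2r// ler_norm.
  by rewrite mulrCA -expr2 ler_wpM2l.
have : N T * expR (- L * T) <= N 0 * expR (- L * 0).
  rewrite -lerN2.
  apply: (@derive_ge0_le (fun t => - (N t * expR (- L * t)))
    (fun t => - (dN t * expR (- L * t) + N t * (- L * expR (- L * t)))) 0 T) => // t tT.
    by apply: is_deriveN; apply: is_derive_mul; [exact: hN|exact: is_derive_expZ].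
  have -> : - (dN t * expR (- L * t) + N t * (- L * expR (- L * t))) =
    (L * N t - dN t) * expR (- L * t) by ring.
  by rewrite mulr_ge0 ?expR_ge0// subr_ge0; exact: hdN.
have -> : N 0 = 0 by rewrite /N big1// => -[i j] _; rewrite D0 mxE expr0n.
rewrite mul0r pmulr_lle0 ?expR_gt0// => NT.
have {}NT : N T = 0 by apply/eqP; rewrite eq_le NT N0.
apply/matrixP => i j; rewrite mxE; apply/eqP; rewrite -normr_eq0 -sqrf_eq0 eq_le.
by rewrite sqr_ge0 andbT -NT DN.
Qed.

Lemma antiderivative_right (f : R -> R) (a : R) : continuous f ->
  exists F : R -> R, forall t, a < t -> is_derive t 1 F (f t).
Proof.
move=> cf; exists (fun y => (\int[lebesgue_measure]_(t in `[a, y]) f t)%R) => t at_.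
have t1 : t < t + 1 by rewrite ltrDl.
have fi : lebesgue_measure.-integrable `[a, t + 1] (EFin \o f).
  apply: continuous_compact_integrable; first exact: segment_compact.
  exact: continuous_subspaceT.
have [d e] := @continuous_FTC1_closed R f a t (t + 1) t1 fi at_ (cf t).
by apply: DeriveDef; [exact: d|rewrite -e derive1E].
Qed.

Lemma derive_eq0_cst (f : R -> R) (a b : R) : a <= b ->
  (forall t, a <= t <= b -> is_derive t 1 f 0) -> f a = f b.
Proof.
move=> ab h; apply/eqP; rewrite eq_le; apply/andP; split.
  exact: (@derive_ge0_le f (cst 0)).
rewrite -lerN2; apply: (@derive_ge0_le (- f) (cst 0)) => // t tab.
by have := is_deriveN (h t tab); rewrite oppr0.
Qed.

(** The integral from a base point is a primitive only to the right of that point. Primitives based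
    at [-(n+1)] and normalised at 0 agree wherever two of them are valid, so the one of index
    [truncn |t|] can be used at [t]. *)
Lemma antiderivative (f : R -> R) : continuous f ->
  exists2 F : R -> R, F 0 = 0 & forall t : R, is_derive t 1 F (f t).
Proof.
move=> cf.
have /choice[G hG] : forall n : nat, exists F : R -> R, F 0 = 0 /\ forall t : R, - n.+1%:R < t -> is_derive t 1 F (f t).
  move=> n; have [F hF] := antiderivative_right (- n.+1%:R) cf.
  exists (F - cst (F 0)); split; first exact: subrr.
  move=> t /hF h; have := is_deriveB h (is_derive_cst (F 0) t (1 : R)).
  by rewrite subr0.
have GE n m t : - n.+1%:R < t -> - m.+1%:R < t -> G n t = G m t.
  move=> tn tm; have [[Gn0 hn] [Gm0 hm]] := (hG n, hG m).
  have H a b : a <= b -> - n.+1%:R < a -> - m.+1%:R < a -> (G n - G m) a = (G n - G m) b.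
    move=> ab na ma; apply: derive_eq0_cst => // s /andP[as_ _].
    rewrite -(subrr (f s)); apply: is_deriveB; [apply: hn|apply: hm];
      exact: lt_le_trans as_.
  have E : G n t - G m t = G n 0 - G m 0.
    have [t0|/ltW t0] := leP t 0; first exact: H.
    by apply/esym/H => //; rewrite oppr_lt0.
  by apply/eqP; rewrite -subr_eq0; rewrite E Gn0 Gm0 subrr.
exists (fun t => G (Num.truncn `|t|) t) => [|t]; first by have [] := hG (Num.truncn `|0 : R|).
pose n := Num.truncn (`|t| + 1).
have hn : `|t| + 1 < n.+1%:R by exact: truncnS_gt.
have ht : - n.+1%:R < t.
  by rewrite ltrNl (le_lt_trans _ hn)// (le_trans (ler_norm _))// normrN lerDl.
have [_ /(_ _ ht)] := hG n.
apply: near_eq_is_derive.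
near=> s.
apply: GE.
  rewrite ltrNl; apply: le_lt_trans hn.
  apply: (le_trans (ler_norm _)); rewrite normrN.
  rewrite -[s](subrK t) (le_trans (ler_normD _ _))// addrC lerD2l distrC.
  by near: s; apply: cvgr_dist_le => //; exact: cvg_id.
rewrite ltrNl (le_lt_trans _ (truncnS_gt _))//.
by rewrite (le_trans (ler_norm _))// normrN.
Unshelve. all: by end_near. Qed.

Lemma antiderivative_mx m n (f : R -> 'M[R]_(m, n)) : continuous f ->
  exists2 F : R -> 'M[R]_(m, n), F 0 = 0 & forall t : R, is_derive t 1 F (f t).
Proof.
move=> cf.
have /choice[G hG] : forall ij : 'I_m * 'I_n, exists F : R -> R,
    F 0 = 0 /\ forall t : R, is_derive t 1 F (f t ij.1 ij.2).
  move=> [i j]; have [|F F0 hF] := @antiderivative (fun t => f t i j); last by exists F.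
  move=> t; have /cvg_mxP := cf t; exact.
exists (fun t => \matrix_(i, j) G (i, j) t).
  by apply/matrixP => i j; rewrite !mxE; have [] := hG (i, j).
move=> t; apply/is_derive_mxP => i j; under eq_fun do rewrite mxE.
by have [_] := hG (i, j); exact.
Qed.

End calculus.

(** * Linear differential equations with continuous coefficients *)

Section linear_ode.
Context {R : realType}.

(** [u k - 2 c 2^-k] increases and [u k + 2 c 2^-k] decreases, so the supremum of the former is the
    limit, and the two enclose it with an explicit error. *)
Lemma geometric_lim (u : nat -> R) (c : R) :
  (forall k, `|u k.+1 - u k| <= c * 2^-1 ^+ k) ->
  forall k, `|limn u - u k| <= 2 * c * 2^-1 ^+ k.
Proof.
move=> h.
have c0 : 0 <= c by have := h 0; rewrite expr0 mulr1; apply: le_trans.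
pose a k := u k - 2 * c * 2^-1 ^+ k.
pose b k := u k + 2 * c * 2^-1 ^+ k.
have E k : 2 * c * 2^-1 ^+ k.+1 = c * 2^-1 ^+ k by rewrite exprS; field.
have sa k : a k <= a k.+1.
  have := h k; rewrite ler_norml => /andP[h1 _]; rewrite /a E; lra.
have sb k : b k.+1 <= b k.
  have := h k; rewrite ler_norml => /andP[_ h1]; rewrite /b E; lra.
have p0 k : 0 <= 2 * c * 2^-1 ^+ k by rewrite !mulr_ge0// exprn_ge0.
have ab k : a k <= b k by rewrite /a /b; have := p0 k; lra.
have aM : {homo a : n m / (n <= m)%N >-> n <= m} by apply: homo_leq => // x y z; exact: le_trans.
have bM : {homo b : n m / (n <= m)%N >-> m <= n}.
  apply: (@homo_leq _ _ (fun x y => y <= x)) => // x y z /[swap]; exact: le_trans.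
have abj k j : a k <= b j.
  by rewrite (le_trans (aM _ _ (leq_maxl k j)))// (le_trans (ab _))// bM// leq_maxr.
pose l := sup (range a).
have hs : has_sup (range a).
  by split; [exists (a 0), 0|exists (b 0) => _ [k _ <-]].
have hl k : `|l - u k| <= 2 * c * 2^-1 ^+ k.
  have h1 : a k <= l by apply: sup_upper_bound => //; exists k.
  have h2 : l <= b k by apply: ge_sup; [exists (a 0), 0|move=> _ [j _ <-]].
  by rewrite ler_norml; move: h1 h2; rewrite /a /b; lra.
suff -> : limn u = l by [].
apply/cvg_lim => //; apply/cvgrPdist_le => e e0.
have : (2 * c * 2^-1 ^+ k) @[k --> \oo] --> 0.
  rewrite -(mulr0 (2 * c)); apply: cvgM; first exact: cvg_cst.
  by apply: cvg_expr; rewrite ger0_norm ?invf_lt1 ?ltr1n.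
move=> /cvgrPdist_le/(_ e e0); apply: filterS => k.
by rewrite sub0r normrN ger0_norm//; apply: le_trans (hl k).
Qed.

(** Integrating against the weight [exp(lam |t|)] gains a factor [1 / lam]. With [lam] twice the
    Lipschitz constant, Picard iteration halves the weighted error on an interval of any length. *)
Lemma exp_norm_bound m n (f df : R -> 'M[R]_(m, n)) (a lam T : R) : 0 <= a -> 0 < lam ->
  (forall t : R, is_derive t 1 f (df t)) -> f 0 = 0 ->
  (forall t, `|t| <= T -> `|df t| <= a * expR (lam * `|t|)) ->
  forall t, `|t| <= T -> `|f t| <= a / lam * expR (lam * `|t|).
Proof.
move=> a0 l0 hf f0 h t tT.
have al : 0 <= a / lam by rewrite divr_ge0// ltW.
have [t0|/ltW t0] := leP 0 t.
  have := @derive_mx_norm_le R m n f df (fun s => a / lam * expR (lam * s)) (fun s => a * expR (lam * s)) 0 t t0.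
  rewrite f0 subr0 (ger0_norm t0) mulr0 expR0 => H.
  have : `|f t| <= a / lam * expR (lam * t) - a / lam * 1.
    apply: H => s /andP[s0 st].
    - have := is_derive_mul (is_derive_cst (a / lam) s (1 : R)) (is_derive_expZ lam s).
      rewrite mul0r add0r mulrA divfK//; exact: lt0r_neq0.
    - have := h s; rewrite (ger0_norm s0); apply.
      by rewrite (le_trans st)// -(ger0_norm t0).
  lra.
have := @derive_mx_norm_le R m n f df (fun s => - (a / lam * expR (- lam * s))) (fun s => a * expR (- lam * s)) t 0 t0.
rewrite f0 sub0r normrN (ler0_norm t0) mulr0 expR0 => H.
have : `|f t| <= - (a / lam * 1) - - (a / lam * expR (- lam * t)).
  apply: H => s /andP[ts s0].
  - have := is_deriveN (is_derive_mul (is_derive_cst (a / lam) s (1 : R)) (is_derive_expZ (- lam) s)).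
    rewrite mul0r add0r mulrA mulrN divfK; last exact: lt0r_neq0.
    by rewrite mulNr opprK.
  - have := h s; rewrite (ler0_norm s0) mulrN mulNr; apply.
    by rewrite (le_trans _ tT)// (ler0_norm t0) lerN2.
by rewrite mulrN mulNr; lra.
Qed.

Lemma geometric_small (c e : R) : 0 < e -> exists k, c * 2^-1 ^+ k <= e.
Proof.
move=> e0.
have : (c * 2^-1 ^+ k) @[k --> \oo] --> 0.
  rewrite -(mulr0 c); apply: cvgM; first exact: cvg_cst.
  by apply: cvg_expr; rewrite ger0_norm ?invf_lt1 ?ltr1n.
move=> /cvgrPdist_le/(_ e e0)/filter_ex[k]; rewrite sub0r normrN => h.
by exists k; apply: le_trans (ler_norm _) h.
Qed.

Lemma le_geometric_eq0 (x c : R) : (forall k, x <= c * 2^-1 ^+ k) -> x <= 0.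
Proof.
move=> h; rewrite leNgt; apply/negP => x0.
have [|k hk] := @geometric_small c (x / 2); first by rewrite divr_gt0.
by have := h k; lra.
Qed.

Lemma linear_ode m n (B : R -> 'M[R]_m) (X0 : 'M[R]_(m, n)) : continuous B ->
  exists2 X : R -> 'M[R]_(m, n), X 0 = X0 & forall t : R, is_derive t 1 X (B t *m X t).
Proof.
move=> cB.
(* The operator [anti] is total; its property is claimed on continuous functions, and every Picard
   iterate is one. *)
have /choice[anti hanti] : forall f : R -> 'M[R]_(m, n), exists F : R -> 'M[R]_(m, n),
    continuous f -> F 0 = 0 /\ forall t : R, is_derive t 1 F (f t).
  move=> f; have [cf|ncf] := pselect (continuous f); last by exists 0.
  by have [F F0 hF] := antiderivative_mx cf; exists F.
pose step (X : R -> 'M[R]_(m, n)) := fun t => X0 + anti (fun s => B s *m X s) t.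
have stepP X : continuous X -> step X 0 = X0 /\ forall t : R, is_derive t 1 (step X) (B t *m X t).
  move=> cX; have [|a0 ha] := hanti (fun s => B s *m X s).
    by move=> t; apply: cvg_mulmx; [exact: cB|exact: cX].
  split; first by rewrite /step a0 addr0.
  by move=> t; have := is_deriveD (is_derive_cst X0 t (1 : R)) (ha t); rewrite add0r.
have step_c X : continuous X -> continuous (step X).
  by move=> /stepP[_ h] t; exact: is_derive_continuous (h t).
pose X_ k := iter k step (cst X0).
have X_c k : continuous (X_ k) by elim: k => [|k IH]; [exact: cst_continuous|exact: step_c].
have X_d k (t : R) : is_derive t 1 (X_ k.+1) (B t *m X_ k t) by have [] := stepP _ (X_c k).
have X_0 k : X_ k 0 = X0 by case: k => // k; have [] := stepP _ (X_c k).
pose c := `|X0|.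
have c0 : 0 <= c by exact: normr_ge0.
have bound (T : R) : 0 <= T -> exists2 K : R, 0 < K & forall t : R, `|t| <= T -> forall p (M : 'M[R]_(m, p)), `|B t *m M| <= K * `|M|.
  move=> T0; have [||K K0 hK] := @continuous_segment_bounded R _ B (- T) T.
  - by rewrite (le_trans _ T0)// oppr_le0.
  - by move=> t _; exact: cB.
  exists (m%:R * K + 1) => [|t tT p M]; first by rewrite ltr_wpDl// mulr_ge0.
  apply: le_trans (mx_norm_mul _ _) _; apply: ler_wpM2r => //.
  rewrite (@le_trans _ _ (m%:R * K))// ?lerDl// ler_wpM2l//.
  by apply: hK; rewrite -ler_norml.
have Dk (T K : R) : 0 <= T -> 0 < K ->
    (forall t, `|t| <= T -> forall p (M : 'M[R]_(m, p)), `|B t *m M| <= K * `|M|) ->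
    forall k t, `|t| <= T -> `|X_ k.+1 t - X_ k t| <= c * 2^-1 ^+ k * expR (2 * K * `|t|).
  move=> T0 K0 hK; elim=> [|k IH] t tT.
    rewrite expr0 mulr1.
    have dX (s : R) : is_derive s 1 (fun t => X_ 1%N t - X0) (B s *m X0).
      by have := is_deriveB (X_d 0%N s) (is_derive_cst X0 s (1 : R)); rewrite subr0.
    have Kc : 0 <= K * c by rewrite mulr_ge0// ltW.
    have K2 : 0 < 2 * K by rewrite mulr_gt0.
    have dX0 : X_ 1%N 0 - X0 = 0 by rewrite X_0 subrr.
    apply: le_trans (exp_norm_bound Kc K2 dX dX0 _ tT) _.
      move=> s sT; apply: le_trans (hK _ sT _ _) _.
      by rewrite -/c ler_peMr// -[leLHS]expR0 ler_expR mulr_ge0// ltW.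
    rewrite ler_wpM2r ?expR_ge0//.
    have -> : K * c / (2 * K) = c / 2 by field; rewrite gt_eqF.
    by rewrite ler_pdivrMr// ler_peMr// ler1n.
  have -> : c * 2^-1 ^+ k.+1 = (K * c * 2^-1 ^+ k) / (2 * K).
    by rewrite exprS; field; rewrite gt_eqF.
  have dX (s : R) : is_derive s 1 (fun t => X_ k.+2 t - X_ k.+1 t) (B s *m (X_ k.+1 s - X_ k s)).
    by rewrite mulmxBr; exact: is_deriveB.
  have dX0 : X_ k.+2 0 - X_ k.+1 0 = 0 by rewrite !X_0 subrr.
  have Kc : 0 <= K * c * 2^-1 ^+ k by rewrite !mulr_ge0// ?exprn_ge0// ltW.
  have K2 : 0 < 2 * K by rewrite mulr_gt0.
  apply: (exp_norm_bound Kc K2 dX dX0 _ tT) => s sT; apply: le_trans (hK _ sT _ _) _.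
  by have := IH s sT; rewrite -(ler_pM2l K0) !mulrA.
pose X t := \matrix_(i, j) limn (fun k => X_ k t i j).
have XX (T : R) : 0 <= T -> exists C : R, forall t k, `|t| <= T -> `|X t - X_ k t| <= C * 2^-1 ^+ k.
  move=> T0; have [K K0 hK] := bound T T0.
  exists (2 * (c * expR (2 * K * T))) => t k tT.
  apply/mx_normP => [|i j]; first by rewrite !mulr_ge0 ?exprn_ge0 ?expR_ge0.
  rewrite !mxE; apply: geometric_lim => {}k.
  apply: le_trans (_ : `|X_ k.+1 t - X_ k t| <= _).
    by have := le_mx_norm (X_ k.+1 t - X_ k t) i j; rewrite !mxE.
  apply: le_trans (Dk T K T0 K0 hK k t tT) _.
  rewrite mulrAC ler_wpM2r ?exprn_ge0// ler_wpM2l// ler_expR.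
  by rewrite ler_wpM2l// mulr_ge0// ltW.
have cX : continuous X.
  move=> t; apply/cvgrPdist_le => e e0.
  have t10 : 0 <= `|t| + 1 by rewrite addr_ge0.
  have [C hC] := XX _ t10.
  have C0 : 0 <= C by have := hC t 0%N; rewrite expr0 mulr1 => H; apply: le_trans (H _); rewrite ?lerDl.
  have [k hk] : exists k, C * 2^-1 ^+ k <= e / 3 by apply: geometric_small; rewrite divr_gt0.
  near=> s.
  have sT : `|s| <= `|t| + 1.
    rewrite -[s](subrK t) (le_trans (ler_normD _ _))// addrC lerD2l distrC.
    by near: s; apply: cvgr_dist_le => //; exact: cvg_id.
  have -> : X t - X s = (X t - X_ k t) + (X_ k t - X_ k s) - (X s - X_ k s) by rewrite opprB !addrA !subrK.
  apply: le_trans (ler_normB _ _) _.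
  apply: le_trans (lerD (ler_normD _ _) (lexx _)) _.
  have -> : e = e / 3 + e / 3 + e / 3 by field.
  apply: lerD; last exact: le_trans (hC _ _ _) hk.
  apply: lerD; first by apply: le_trans (hC _ _ _) hk; rewrite lerDl.
  near: s; move/cvgrPdist_le : (X_c k t) => /(_ (e / 3)); apply; by rewrite divr_gt0.
have [Y0 Yd] := stepP X cX.
(* [X] and [step X] are both within a multiple of [2^-k] of the iterate [k+1], hence equal; as a
   value of [step], the limit is differentiable. *)
suff E : X = step X by exists X => [|t]; [rewrite E|rewrite {1}E].
apply/funext => t; apply/eqP; rewrite -subr_eq0 -normr_eq0 eq_le normr_ge0 andbT.
have [K K0 hK] := bound `|t| (normr_ge0 _).
have [C hC] := XX `|t| (normr_ge0 _).
have C0 : 0 <= C by have := hC t 0%N; rewrite expr0 mulr1 => H; apply: le_trans (H _).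
apply: (@le_geometric_eq0 _ (C + K * C * expR (1 * `|t|))) => k.
have -> : X t - step X t = (X t - X_ k.+1 t) - (step X t - X_ k.+1 t) by rewrite opprB addrA subrK.
apply: le_trans (ler_normB _ _) _; rewrite mulrDl; apply: lerD.
  apply: le_trans (hC _ _ _) _ => //.
  by rewrite exprS ler_wpM2l// ler_piMl ?exprn_ge0// invf_le1// ler1n.
rewrite [X in _ <= X]mulrAC -[K * C * _](divr1).
have dX (s : R) : is_derive s 1 (fun t => step X t - X_ k.+1 t) (B s *m (X s - X_ k s)).
  by rewrite mulmxBr; exact: is_deriveB.
have dX0 : step X 0 - X_ k.+1 0 = 0 by rewrite Y0 X_0 subrr.
have Kc : 0 <= K * C * 2^-1 ^+ k by rewrite !mulr_ge0// ?exprn_ge0// ltW.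
apply: (exp_norm_bound Kc ltr01 dX dX0 _ (lexx _)) => s sT; apply: le_trans (hK _ sT _ _) _.
rewrite mul1r -mulrA -mulrA ler_pM2l//.
apply: le_trans (hC _ _ sT) _; rewrite mulrA ler_peMr ?mulr_ge0 ?exprn_ge0//.
by rewrite -[leLHS]expR0 ler_expR.
Unshelve. all: by end_near. Qed.

End linear_ode.

(** * Matrix identities, quadratic forms and Lyapunov comparison *)

Section matrix_algebra.
Context {R : realType}.

Lemma mxDE m n (A B : 'M[R]_(m, n)) i j : (A + B) i j = A i j + B i j.
Proof. by rewrite mxE. Qed.
Lemma mxNE m n (A : 'M[R]_(m, n)) i j : (- A) i j = - A i j.
Proof. by rewrite mxE. Qed.
Lemma mxZE m n a (A : 'M[R]_(m, n)) i j : (a *: A) i j = a * A i j.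
Proof. by rewrite mxE. Qed.
Lemma mx0E m n i j : (0 : 'M[R]_(m, n)) i j = 0.
Proof. by rewrite mxE. Qed.
Lemma trmxD m n (A B : 'M[R]_(m, n)) : (A + B)^T = A^T + B^T.
Proof. exact: linearD. Qed.
Lemma trmxN m n (A : 'M[R]_(m, n)) : (- A)^T = - A^T.
Proof. exact: linearN. Qed.
Lemma trmxZ m n a (A : 'M[R]_(m, n)) : (a *: A)^T = a *: A^T.
Proof. exact: linearZ. Qed.

End matrix_algebra.

(** Products are expanded into left-associated monomials; after passing to entries, each monomial is
    an atom for the commutative [ring]. *)
Ltac mxnorm := rewrite ?(trmxD, trmxN, trmxZ, trmx_mul, trmxK, trmx1,
   mulmxDl, mulmxDr, mulmxN, mulNmx, mul1mx, mulmx1, mul0mx, mulmx0,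
   mul_scalar_mx, mul_mx_scalar, tr_scalar_mx) -?(scalemxAl, scalemxAr) ?mulmxA.
Ltac mxring := repeat progress mxnorm;
  apply/matrixP => ? ?; rewrite ?(mxDE, mxNE, mxZE, mx0E); ring.

Section quadratic_forms.
Context {R : realType}.

Definition qform n (S : 'M[R]_n) (x : 'cV[R]_n) : R := (x^T *m S *m x) 0 0.

Definition psd n (S : 'M[R]_n) := forall x, 0 <= qform S x.

Lemma qformD n (S T : 'M[R]_n) x : qform (S + T) x = qform S x + qform T x.
Proof. by rewrite /qform mulmxDr mulmxDl mxDE. Qed.
Lemma qformN n (S : 'M[R]_n) x : qform (- S) x = - qform S x.
Proof. by rewrite /qform mulmxN mulNmx mxNE. Qed.
Lemma qformB n (S T : 'M[R]_n) x : qform (S - T) x = qform S x - qform T x.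
Proof. by rewrite qformD qformN. Qed.
Lemma qformZ n a (S : 'M[R]_n) x : qform (a *: S) x = a * qform S x.
Proof. by rewrite /qform -scalemxAr -scalemxAl mxZE. Qed.
Lemma qform_tr n (S : 'M[R]_n) x : qform S^T x = qform S x.
Proof.
by rewrite /qform -[RHS](mxE trmx_key (fun i j => (x^T *m S *m x) j i)) -/(trmx _) !trmx_mul trmxK mulmxA.
Qed.
Lemma qform_congr n m (S : 'M[R]_n) (L : 'M[R]_(m, n)) x :
  qform (L *m S *m L^T) x = qform S (L^T *m x).
Proof. by rewrite /qform trmx_mul trmxK !mulmxA. Qed.

Lemma qform1 n (x : 'cV[R]_n) : qform 1%:M x = \sum_i x i 0 ^+ 2.
Proof. by rewrite /qform mulmx1 mxE; apply: eq_bigr => i _; rewrite mxE expr2. Qed.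

Lemma qform1_ge0 n (x : 'cV[R]_n) : 0 <= qform 1%:M x.
Proof. by rewrite qform1 sumr_ge0// => i _; exact: sqr_ge0. Qed.

Lemma qform1_eq0 n (x : 'cV[R]_n) : qform 1%:M x = 0 -> x = 0.
Proof.
rewrite qform1 => /eqP; rewrite psumr_eq0 => [/allP h|i _]; last exact: sqr_ge0.
apply/colP => i; rewrite mxE; apply/eqP.
by have := h i (mem_index_enum _); rewrite sqrf_eq0.
Qed.

Lemma qform1_gt0 n (x : 'cV[R]_n) : x != 0 -> 0 < qform 1%:M x.
Proof.
move=> x0; rewrite lt_def qform1_ge0 andbT; apply: contra x0 => /eqP/qform1_eq0 ->.
by rewrite eqxx.
Qed.

Lemma norm_sqr_le_qform1 n (x : 'cV[R]_n) : `|x| ^+ 2 <= qform 1%:M x.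
Proof.
have [->|nz] := eqVneq `|x| 0; first by rewrite expr0n/= qform1_ge0.
have [[i j] ->] : exists i, `|x| = `|x i.1 i.2| by exact: mx_norm_neq0.
rewrite /= real_normK ?num_real// qform1 (bigD1 i)//= (ord1 j) lerDl sumr_ge0// => k _.
exact: sqr_ge0.
Qed.

(** This compares the sup norm of matrices with the Euclidean length of vectors; each of the two
    products contributes a factor [n]. *)
Lemma qform_norm_le n (S : 'M[R]_n) x : `|qform S x| <= (n%:R ^+ 2 * `|S|) * qform 1%:M x.
Proof.
apply: le_trans (le_mx_norm _ _ _) _; apply: le_trans (mx_norm_mul _ _) _.
apply: (@le_trans _ _ (n%:R * (n%:R * `|x^T| * `|S|) * `|x|)).
  by rewrite ler_wpM2r// ler_wpM2l// mx_norm_mul.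
rewrite mx_norm_tr.
have -> : n%:R * (n%:R * `|x| * `|S|) * `|x| = (n%:R ^+ 2 * `|S|) * (`|x| ^+ 2) by ring.
by rewrite ler_wpM2l ?norm_sqr_le_qform1// mulr_ge0// exprn_ge0.
Qed.

Lemma is_derive_qform n (S : R -> 'M[R]_n) (x : R -> 'cV[R]_n) (t : R) dS dx :
  is_derive t 1 S dS -> is_derive t 1 x dx ->
  is_derive t 1 (fun s => qform (S s) (x s))
   ((dx^T *m S t *m x t + (x t)^T *m dS *m x t + (x t)^T *m S t *m dx) 0 0).
Proof.
move=> hS hx.
have /is_derive_mxP/(_ 0 0) := is_derive_mulmx (is_derive_mulmx (is_derive_trmx hx) hS) hx.
by rewrite mulmxDl.
Qed.

Lemma is_derive_qform_cst n (S : R -> 'M[R]_n) (x : 'cV[R]_n) (t : R) dS :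
  is_derive t 1 S dS -> is_derive t 1 (fun s => qform (S s) x) (qform dS x).
Proof.
move=> hS; have := is_derive_qform hS (is_derive_cst x t (1 : R)).
by rewrite trmx0 !mul0mx mulmx0 addr0 add0r.
Qed.

(* [v] solves the adjoint equation [v' = - M^T v] backwards from [v b = w], so
   that [(v^T E v)' = v^T Psi v]. *)
Lemma lyapunov_psd n (E M Psi : R -> 'M[R]_n) (a b : R) : a <= b ->
  (forall t, a <= t <= b ->
     is_derive t 1 E (M t *m E t + E t *m (M t)^T + Psi t)) ->
  (forall t, a <= t <= b -> {for t, continuous M}) ->
  (forall t, a <= t <= b -> psd (Psi t)) ->
  psd (E a) -> psd (E b).
Proof.
move=> ab hE cM hPsi hEa w.
(* Time is clamped to [[a, b]]: the coefficient of the linear equation has to be continuous on the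
   whole line, while [M] is continuous on the segment only. *)
pose cl (u : R) := Num.max a (Num.min b u).
have clP u : a <= cl u <= b by rewrite /cl le_max lexx/= ge_max ab/= ge_min lexx.
have cl_id u : a <= u <= b -> cl u = u.
  by move=> /andP[au ub]; rewrite /cl min_r// max_r.
have ccl : continuous cl.
  move=> u; apply: (@continuous_max _ _ (cst a) (fun u => Num.min b u)); first exact: cst_continuous.
  by apply: (@continuous_min _ _ (cst b) id); [exact: cst_continuous|exact: id].
have [|v v0 hv] := @linear_ode R n 1 (fun s => (M (cl (b - s)))^T) w.
  move=> s; apply: cvg_trmx.
  have c1 : {for s, continuous (fun s => cl (b - s))}.
    apply: (@continuous_comp _ _ _ (fun s => b - s) cl); last exact: ccl.
    by apply: cvgB; [exact: cvg_cst|exact: cvg_id].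
  exact: (@continuous_comp _ _ _ (fun s => cl (b - s)) M s c1 (cM _ (clP _))).
pose z t := v (-1 * t + b).
have hz (t : R) : a <= t <= b -> is_derive t 1 z (- ((M t)^T *m z t)).
  move=> tab; have := is_derive_comp_affine (hv (-1 * t + b)).
  rewrite scaleN1r; congr (is_derive _ _ _ (- (trmx (M _) *m _))).
  have -> : b - (-1 * t + b) = t by ring.
  exact: cl_id.
have : qform (E a) (z a) <= qform (E b) (z b).
  apply: (@derive_ge0_le R (fun t => qform (E t) (z t)) (fun t => qform (Psi t) (z t)) a b ab) => t tab; last exact: hPsi.
  apply: is_derive_eq; first exact: is_derive_qform (hE _ tab) (hz _ tab).
  rewrite /qform; congr (fun_of_matrix _ 0 0).
  mxring.
have -> : z b = w by rewrite /z mulN1r addNr.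
exact: le_trans (hEa _).
Qed.

End quadratic_forms.

(** * Existence and uniqueness of solutions *)

Section existence_uniqueness.
Context {R : realType}.

Lemma derive_mx_eq0_cst m n (f : R -> 'M[R]_(m, n)) (a b : R) : a <= b ->
  (forall t, a <= t <= b -> is_derive t 1 f 0) -> f a = f b.
Proof.
move=> ab h; apply/matrixP => i j.
apply: (@derive_eq0_cst _ (fun s => f s i j)) => // t tab.
by have /is_derive_mxP/(_ i j) := h t tab; rewrite mxE.
Qed.

Lemma derive_mx_eq0_cstT m n (f : R -> 'M[R]_(m, n)) (t : R) :
  (forall s : R, is_derive s 1 f 0) -> f t = f 0.
Proof.
move=> h; have [t0|/ltW t0] := leP t 0; first exact: derive_mx_eq0_cst.
by apply/esym; exact: derive_mx_eq0_cst.
Qed.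

Lemma unitmx_inj m (M : 'M[R]_m) :
  (forall x : 'cV[R]_m, M *m x = 0 -> x = 0) -> M \in unitmx.
Proof.
move=> h; rewrite -unitmx_tr -row_free_unit -kermx_eq0; apply/eqP/row_matrixP => i.
rewrite row0; apply: trmx_inj; rewrite trmx0; apply: h; apply: trmx_inj.
by rewrite trmx_mul trmxK trmx0 -row_mul mulmx_ker row0.
Qed.

Lemma gram_unitmx m n (W : 'M[R]_(m, n)) :
  (forall x : 'cV[R]_n, W *m x = 0 -> x = 0) -> W^T *m W \in unitmx.
Proof.
move=> h; apply: unitmx_inj => x Mx; apply: h; apply: qform1_eq0.
by rewrite /qform mulmx1 trmx_mul -mulmxA [_ *m (W *m x)]mulmxA Mx mulmx0 mxE.
Qed.

(** With [V' = - A V] and [V 0 = 1], the product [V^T W] is conserved and equal to [U0]. So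
    [W t x = 0] forces [x = 0], the Gram matrix [M = W^T W] stays invertible, and the linear
    equation for [G] makes sense. Conservation of [G^T M G = 1] puts [W G] on the Stiefel
    manifold. *)
Lemma oja_solution n r (A : 'M[R]_n) (U0 : 'M[R]_(n, r)) : A^T = A -> stiefel U0 ->
  exists (W : R -> 'M[R]_(n, r)) (G : R -> 'M[R]_r),
  [/\ W 0 = U0, G 0 = 1%:M, forall t : R, is_derive t 1 W (A *m W t) &
   forall t : R, [/\ G t \in unitmx, stiefel (W t *m G t) &
     is_derive t 1 (fun s => W s *m G s) (oja_field A (W t *m G t))]].
Proof.
rewrite /stiefel/= => sA sU0.
have [|W W0 hW] := @linear_ode R n r (cst A) U0; first exact: cst_continuous.
have [|V V0 hV] := @linear_ode R n n (cst (- A)) 1%:M; first exact: cst_continuous.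
have VW t : (V t)^T *m W t = U0.
  rewrite -(_ : (V 0)^T *m W 0 = U0); last by rewrite V0 W0 trmx1 mul1mx.
  apply: (@derive_mx_eq0_cstT _ _ (fun t => (V t)^T *m W t)) => s.
  apply: is_derive_eq; first exact: is_derive_mulmx (is_derive_trmx (hV s)) (hW s).
  by rewrite /cst trmx_mul trmxN sA mulmxN mulNmx mulmxA addNr.
have uM t : (W t)^T *m W t \in unitmx.
  apply: gram_unitmx => x Wx.
  by rewrite -[x]mul1mx -sU0 -mulmxA -(VW t) -[_ *m W t *m x]mulmxA Wx !mulmx0.
pose M t := (W t)^T *m W t.
have cW : continuous W by move=> t; exact: is_derive_continuous (hW t).
have cM : continuous M by move=> t; apply: cvg_mulmx; [apply: cvg_trmx|]; exact: cW.
pose B t := - (invmx (M t) *m ((W t)^T *m A *m W t)).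
have [|G G0 hG] := @linear_ode R r r B 1%:M.
  move=> t; apply: cvgN; apply: cvg_mulmx; first by apply: cvg_invmx; [exact: uM|exact: cM].
  apply: cvg_mulmx; last exact: cW.
  by apply: cvg_mulmx; [apply: cvg_trmx; exact: cW|exact: cvg_cst].
have MV t : M t *m invmx (M t) = 1%:M by exact: mulmxV (uM t).
have VM t : invmx (M t) *m M t = 1%:M by exact: mulVmx (uM t).
have sM t : (M t)^T = M t by rewrite /M trmx_mul trmxK.
have sMV t : (invmx (M t))^T = invmx (M t) by rewrite trmx_inv sM.
have GMG t : (G t)^T *m M t *m G t = 1%:M.
  rewrite -(_ : (G 0)^T *m M 0 *m G 0 = 1%:M); last first.
    by rewrite G0 trmx1 mulmx1 mul1mx /M W0.
  apply: (@derive_mx_eq0_cstT _ _ (fun t => (G t)^T *m M t *m G t)) => s.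
  apply: is_derive_eq.
    apply: is_derive_mulmx (is_derive_mulmx (is_derive_trmx (hG s)) _) (hG s).
    exact: is_derive_mulmx (is_derive_trmx (hW s)) (hW s).
  rewrite /cst /B !(trmx_mul, trmxN, sMV, trmxK, sA).
  have e1 : (G s)^T *m - ((W s)^T *m (A *m W s) *m invmx (M s)) *m M s = - ((G s)^T *m ((W s)^T *m (A *m W s))).
    by rewrite mulmxN mulNmx -!mulmxA VM mulmx1.
  have e2 : M s *m (- (invmx (M s) *m ((W s)^T *m A *m W s)) *m G s) = - (((W s)^T *m A *m W s) *m G s).
    by rewrite mulNmx mulmxN !mulmxA MV mul1mx.
  rewrite e1 -[_ *m M s *m _]mulmxA e2.
  mxring.
(* Inverses of square matrices are two-sided; the resulting [G G^T = (W^T W)^-1] turns the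
   derivative of [W G] into the Oja field. *)
have GGM t : G t *m ((G t)^T *m M t) = 1%:M by apply: mulmx1C; exact: GMG.
have GG t : G t *m (G t)^T = invmx (M t).
  have : G t *m ((G t)^T *m M t) *m invmx (M t) = invmx (M t) by rewrite GGM mul1mx.
  by rewrite -mulmxA -mulmxA MV mulmx1.
exists W, G; split => // t; split.
- by case: (mulmx1_unit (GGM t)).
- by rewrite /= trmx_mul -mulmxA (mulmxA (W t)^T) mulmxA GMG.
- apply: is_derive_eq; first exact: is_derive_mulmx (hW t) (hG t).
  have -> : oja_field A (W t *m G t) = A *m (W t *m G t) - W t *m (G t *m (G t)^T) *m (W t)^T *m A *m (W t *m G t).
    by rewrite /oja_field trmx_mul; mxring.
  by rewrite GG /B; mxring.
Qed.

(** Radon's linearisation. The derivative [q X^T X + Y^T S Y] of [X^T Y] is positive semidefinite,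
    so [X^T Y >= P0 > 0] for [t >= 0]. This forbids kernel vectors of [X], hence blow-up, and
    [Y X^-1] is positive definite as a congruence of [X^T Y]. *)
Lemma riccati_solution r (a S : R -> 'M[R]_r) (q : R) (P0 : 'M[R]_r) :
  continuous a -> continuous S -> (forall t, (S t)^T = S t) ->
  (forall t, psd (S t)) -> 0 <= q -> posdef P0 ->
  exists2 P : R -> 'M[R]_r, P 0 = P0 & forall t : R, 0 <= t ->
    posdef (P t) /\
    is_derive t 1 P (a t *m P t + P t *m (a t)^T + q%:M - P t *m S t *m P t).
Proof.
move=> ca cS sS pS q0 [sP0 pP0].
pose B t := block_mx (- (a t)^T) (S t) q%:M (a t).
have [|Z Z0 hZ] := @linear_ode R (r + r) r B (col_mx 1%:M P0).
  move=> t; apply/cvg_mxP => i j; rewrite /B.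
  have hl (F : R -> 'M[R]_r) k l : {for t, continuous F} -> F x k l @[x --> t] --> F t k l.
    by move=> /cvg_mxP; exact.
  rewrite !mxE; under eq_fun do rewrite !mxE.
  case: (fintype.split i) => k; rewrite !mxE; under eq_fun do rewrite !mxE; case: (fintype.split j) => l.
  - under eq_fun do rewrite !mxE.
    have -> : (- (a t)^T) k l = - a t l k by rewrite !mxE.
    exact: (cvgN (hl a l k (ca t))).
  - exact: (hl S k l (cS t)).
  - exact: cvg_cst.
  - exact: (hl a k l (ca t)).
pose X t := usubmx (Z t); pose Y t := dsubmx (Z t).
have ZE t : Z t = col_mx (X t) (Y t) by rewrite vsubmxK.
have hX (t : R) : is_derive t 1 X (- (a t)^T *m X t + S t *m Y t).
  apply/is_derive_mxP => i j.
  have /is_derive_mxP/(_ (lshift r i) j) := hZ t.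
  by rewrite ZE /B mul_block_col col_mxEu /X; under [in X in _ -> X]eq_fun do rewrite mxE.
have hY (t : R) : is_derive t 1 Y (q *: X t + a t *m Y t).
  apply/is_derive_mxP => i j.
  have /is_derive_mxP/(_ (rshift r i) j) := hZ t.
  by rewrite ZE /B mul_block_col col_mxEd mul_scalar_mx /Y; under [in X in _ -> X]eq_fun do rewrite mxE.
have X0 : X 0 = 1%:M by rewrite /X Z0 col_mxKu.
have Y0 : Y 0 = P0 by rewrite /Y Z0 col_mxKd.
have hN (t : R) : is_derive t 1 (fun s => (X s)^T *m Y s)
    (q *: ((X t)^T *m X t) + (Y t)^T *m S t *m Y t).
  apply: is_derive_eq; first exact: is_derive_mulmx (is_derive_trmx (hX t)) (hY t).
  by rewrite trmxD !trmx_mul sS; mxring.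
have N0 : (X 0)^T *m Y 0 = P0 by rewrite X0 Y0 trmx1 mul1mx.
have Nge t x : 0 <= t -> qform P0 x <= qform ((X t)^T *m Y t) x.
  move=> t0; rewrite -N0.
  apply: (@derive_ge0_le R (fun s => qform ((X s)^T *m Y s) x)
     (fun s => qform (q *: ((X s)^T *m X s) + (Y s)^T *m S s *m Y s) x)) => // s _.
    exact: is_derive_qform_cst.
  rewrite qformD qformZ addr_ge0//.
    rewrite mulr_ge0// -[X in X *m _]trmxK.
    have := qform_congr 1%:M (X s)^T x; rewrite mulmx1 trmxK => ->; exact: qform1_ge0.
  by have := qform_congr (S s) (Y s)^T x; rewrite trmxK => ->; exact: pS.
have Nsym t : ((X t)^T *m Y t)^T = (X t)^T *m Y t.
  apply/eqP; rewrite -subr_eq0; apply/eqP.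
  rewrite -(_ : ((X 0)^T *m Y 0)^T - (X 0)^T *m Y 0 = 0); last by rewrite N0 sP0 subrr.
  apply: (@derive_mx_eq0_cstT _ _ (fun s => ((X s)^T *m Y s)^T - (X s)^T *m Y s)) => s.
  apply: is_derive_eq; first exact: is_deriveB (is_derive_trmx (hN s)) (hN s).
  by rewrite trmxD trmxZ !trmx_mul !trmxK sS; mxring.
have uX t : 0 <= t -> X t \in unitmx.
  move=> t0; apply: unitmx_inj => x Xx; apply/eqP/negPn/negP => /pP0.
  rewrite -/(qform P0 x) ltNge => /negP; apply.
  by rewrite (le_trans (Nge t x t0))// /qform mulmxA -trmx_mul Xx trmx0 !mul0mx mxE.
exists (fun t => Y t *m invmx (X t)); first by rewrite X0 Y0 invmx1 mulmx1.
move=> t t0; have u := uX t t0; split; first split.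
- have := Nsym t; rewrite trmx_mul trmxK => e.
  rewrite trmx_mul trmx_inv -[Y t in RHS]mul1mx -(mulVmx (_ : (X t)^T \in unitmx)) ?unitmx_tr//.
  by rewrite -(mulmxA _ (X t)^T) -e -mulmxA -(mulmxA (Y t)^T) mulmxV// mulmx1.
- move=> x x0; rewrite -/(qform _ x).
  have -> : qform (Y t *m invmx (X t)) x = qform ((X t)^T *m Y t) (invmx (X t) *m x).
    by rewrite /qform trmx_mul -!mulmxA (mulmxA _ (X t)^T) -trmx_mul mulmxV// trmx1 mul1mx.
  apply: lt_le_trans (Nge t _ t0); apply: pP0.
  by apply: contra x0 => /eqP e; rewrite -[x](mulKVmx u) e mulmx0.
- apply: is_derive_eq; first exact: is_derive_mulmx (hY t) (is_derive_invmx u (hX t)).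
  have e1 : (q *: X t + a t *m Y t) *m invmx (X t) = q%:M + a t *m (Y t *m invmx (X t)).
    by rewrite mulmxDl -scalemxAl mulmxV// scalemx1 mulmxA.
  have e2 : invmx (X t) *m (- (a t)^T *m X t + S t *m Y t) *m invmx (X t)
     = - (invmx (X t) *m (a t)^T) + invmx (X t) *m S t *m (Y t *m invmx (X t)).
    by rewrite mulmxDr mulmxDl !mulNmx !mulmxN mulNmx -!mulmxA mulmxV// mulmx1.
  by rewrite e1 e2; mxring.
Qed.

Lemma mx_norm_mul_le m n p (M : 'M[R]_(m, n)) (N : 'M[R]_(n, p)) (a b : R) :
  `|M| <= a -> `|N| <= b -> `|M *m N| <= n%:R * a * b.
Proof.
move=> Ma Nb; apply: le_trans (mx_norm_mul _ _) _.
by rewrite !ler_pM// ?mulr_ge0// ler_wpM2l.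
Qed.

Lemma stiefel_norm_le1 n r (U : 'M[R]_(n, r)) : stiefel U -> `|U| <= 1.
Proof.
move=> sU; apply/mx_normP => // i j.
rewrite -(@ler_pXn2r _ 2)// ?nnegrE// expr1n real_normK ?num_real//.
have /matrixP/(_ j j) := sU; rewrite !mxE eqxx => H; rewrite -[leRHS]/(true%:R : R) -H.
rewrite (bigD1 i)//= !mxE -expr2 lerDl sumr_ge0// => k _.
by rewrite !mxE -expr2 sqr_ge0.
Qed.

(** The cubic field is telescoped into four terms with one factor [V - U] each, whose bounds add up
    to the constant. The unit ball of the sup norm contains the Stiefel manifold. *)
Lemma oja_field_lipschitz n r (A : 'M[R]_n) : exists K : R,
  forall U V : 'M[R]_(n, r), `|U| <= 1 -> `|V| <= 1 ->
  `|oja_field A V - oja_field A U| <= K * `|V - U|.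
Proof.
exists (n%:R * `|A| + (r%:R * (n%:R * (n%:R * 1 * `|A|) * 1) + (r%:R * (n%:R * (n%:R * `|A| * 1)) + r%:R * (n%:R * (n%:R * `|A|))))).
move=> U V U1 V1; set D := V - U.
have V1' : `|V^T| <= 1 by rewrite mx_norm_tr.
have U1' : `|U^T| <= 1 by rewrite mx_norm_tr.
have D' : `|D^T| <= `|D| by rewrite mx_norm_tr.
have -> : oja_field A V - oja_field A U = A *m D - (D *m (V^T *m A *m V) + (U *m (D^T *m (A *m V)) + U *m (U^T *m (A *m D)))).
  by rewrite /D /oja_field; mxring.
apply: le_trans (ler_normB _ _) _; rewrite mulrDl; apply: lerD; first exact: mx_norm_mul.
apply: le_trans (ler_normD _ _) _; rewrite mulrDl; apply: lerD.
  rewrite mulrAC; apply: mx_norm_mul_le => //; apply: mx_norm_mul_le => //.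
  exact: mx_norm_mul_le.
apply: le_trans (ler_normD _ _) _; rewrite mulrDl; apply: lerD.
  apply: (@le_trans _ _ (r%:R * 1 * (n%:R * `|D| * (n%:R * `|A| * 1)))); last by rewrite le_eqVlt; apply/orP; left; apply/eqP; ring.
  by apply: mx_norm_mul_le => //; apply: mx_norm_mul_le => //; exact: mx_norm_mul_le.
apply: (@le_trans _ _ (r%:R * 1 * (n%:R * 1 * (n%:R * `|A| * `|D|)))); last by rewrite le_eqVlt; apply/orP; left; apply/eqP; ring.
by apply: mx_norm_mul_le => //; apply: mx_norm_mul_le => //; exact: mx_norm_mul_le.
Qed.

Lemma oja_unique n r (A : 'M[R]_n) (U V : R -> 'M[R]_(n, r)) (T : R) : 0 <= T ->
  (forall t, 0 <= t <= T -> stiefel (U t) /\ is_derive t 1 U (oja_field A (U t))) ->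
  (forall t, 0 <= t <= T -> stiefel (V t) /\ is_derive t 1 V (oja_field A (V t))) ->
  U 0 = V 0 -> V T = U T.
Proof.
move=> T0 hU hV UV0; have [K hK] := @oja_field_lipschitz n r A.
apply/eqP; rewrite -subr_eq0; apply/eqP.
apply: (@gronwall_zero R n r (fun t => V t - U t) (fun t => oja_field A (V t) - oja_field A (U t)) T K) => //.
- by move=> t tT; apply: is_deriveB; [case: (hV t tT)|case: (hU t tT)].
- by move=> t tT; apply: hK; apply: stiefel_norm_le1; [case: (hU t tT)|case: (hV t tT)].
- by rewrite UV0 subrr.
Qed.

(** [Q S Q - P S P = (Q - P) S Q + P S (Q - P)], so the difference solves a linear equation with
    coefficients bounded on the segment. *)
Lemma riccati_unique r (a S P Q : R -> 'M[R]_r) (q T : R) : 0 <= T ->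
  (forall t, 0 <= t <= T -> {for t, continuous a}) ->
  (forall t, 0 <= t <= T -> {for t, continuous S}) ->
  (forall t, 0 <= t <= T -> is_derive t 1 P (a t *m P t + P t *m (a t)^T + q%:M - P t *m S t *m P t)) ->
  (forall t, 0 <= t <= T -> is_derive t 1 Q (a t *m Q t + Q t *m (a t)^T + q%:M - Q t *m S t *m Q t)) ->
  P 0 = Q 0 -> Q T = P T.
Proof.
move=> T0 ca cS hP hQ PQ0.
have [Ka Ka0 hKa] := continuous_segment_bounded T0 ca.
have [|K1 K10 hK1] := @continuous_segment_bounded R _ (fun t => S t *m Q t) 0 T T0.
  move=> t tT; apply: cvg_mulmx; first exact: cS.
  exact: is_derive_continuous (hQ t tT).
have [|K2 K20 hK2] := @continuous_segment_bounded R _ (fun t => P t *m S t) 0 T T0.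
  move=> t tT; apply: cvg_mulmx; last exact: cS.
  exact: is_derive_continuous (hP t tT).
apply/eqP; rewrite -subr_eq0; apply/eqP.
pose D t := Q t - P t.
apply: (@gronwall_zero R r r D
  (fun t => a t *m D t + D t *m (a t)^T - (D t *m (S t *m Q t) + P t *m S t *m D t)) T
  (r%:R * Ka + r%:R * Ka + (r%:R * K1 + r%:R * K2))) => //.
- move=> t tT; apply: is_derive_eq; first exact: is_deriveB (hQ t tT) (hP t tT).
  by rewrite /D; mxring.
- move=> t tT; have Ka' : `|(a t)^T| <= Ka by rewrite mx_norm_tr hKa.
  apply: le_trans (ler_normB _ _) _; rewrite mulrDl; apply: lerD.
    apply: le_trans (ler_normD _ _) _; rewrite mulrDl; apply: lerD.
      by apply: mx_norm_mul_le => //; exact: hKa.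
    by rewrite mulrAC; apply: mx_norm_mul_le.
  apply: le_trans (ler_normD _ _) _; rewrite mulrDl; apply: lerD.
    by rewrite mulrAC; apply: mx_norm_mul_le => //; exact: hK1.
  by apply: mx_norm_mul_le => //; exact: hK2.
- by rewrite /D PQ0 subrr.
Qed.

End existence_uniqueness.

(** * Convergence of the Oja flow *)

Section spectral.
Context {R : realType}.

Lemma qformZx n (S : 'M[R]_n) (a : R) x : qform S (a *: x) = a ^+ 2 * qform S x.
Proof. by rewrite /qform trmxZ -!scalemxAl -scalemxAr scalerA mxZE expr2. Qed.

Lemma qformDx n (S : 'M[R]_n) (x y : 'cV[R]_n) : S^T = S ->
  qform S (x + y) = qform S x + 2 * (y^T *m S *m x) 0 0 + qform S y.
Proof.
move=> sS; rewrite /qform.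
have e : (x^T *m S *m y) 0 0 = (y^T *m S *m x) 0 0.
  rewrite -[RHS](mxE trmx_key (fun i j => (y^T *m S *m x) j i)) -/(trmx _).
  by rewrite !trmx_mul trmxK sS mulmxA.
rewrite trmxD !mulmxDl !mulmxDr !mxDE e; ring.
Qed.

Lemma cvg_qform n (S : 'M[R]_n) (T : Type) (F : set_system T) {FF : Filter F}
    (x : T -> 'cV[R]_n) (y : 'cV[R]_n) :
  x t @[t --> F] --> y -> qform S (x t) @[t --> F] --> qform S y.
Proof.
move=> xy; have : (x t)^T *m S *m x t @[t --> F] --> y^T *m S *m y.
  apply: cvg_mulmx => //; apply: cvg_mulmx; last exact: cvg_cst.
  exact: cvg_trmx.
by move=> /cvg_mxP; exact.
Qed.

(** At [s = - b / k] with [k = |c| + 1] the polynomial equals [(b^2 / k) (c / k - 2)], which is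
    negative unless [b = 0]. *)
Lemma psd_linear_zero (b c : R) : (forall s : R, 0 <= 2 * s * b + s ^+ 2 * c) -> b = 0.
Proof.
move=> h; apply/eqP/negPn/negP => b0.
pose k := `|c| + 1.
have k0 : 0 < k by rewrite /k ltr_wpDl.
have := h (- b / k).
have -> : 2 * (- b / k) * b + (- b / k) ^+ 2 * c = (b ^+ 2 / k) * (c / k - 2) by field; rewrite gt_eqF.
rewrite pmulr_rge0; last by rewrite divr_gt0// lt_def sqr_ge0 sqrf_eq0 b0.
rewrite subr_ge0 ler_pdivlMr// /k; have := ler_norm c; have := normr_ge0 c; lra.
Qed.

(** By compactness the form of [A] attains its minimum [l] on the unit sphere of the range of [P].
    On that range the form of [A - l] is nonnegative, and it vanishes at the minimiser [c]; so its
    first variation along [(A - l) c], a direction in the range since [A] and [P] commute, must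
    vanish. This variation is [2 |(A - l) c|^2]. *)
Lemma rayleigh_min n (A P : 'M[R]_n) : A^T = A -> P^T = P -> P *m P = P ->
  A *m P = P *m A -> P != 0 ->
  exists (l : R) (x : 'cV[R]_n), [/\ x != 0, P *m x = x, A *m x = l *: x &
    forall y, P *m y = y -> l * qform 1%:M y <= qform A y].
Proof.
move=> sA sP PP AP P0.
(* The unit sphere of the range of [P] as the zero set of one continuous function; rows are used
   because [EVT_min_rV] is about rows. *)
pose g (v : 'rV[R]_n) := `|(P - 1%:M) *m v^T| + `|qform 1%:M v^T - 1|.
pose K := [set v | g v = 0].
have KP v : K v <-> P *m v^T = v^T /\ qform 1%:M v^T = 1.
  rewrite /K/= /g mulmxBl mul1mx; split.
    move=> /eqP; rewrite paddr_eq0// !normr_eq0 !subr_eq0 => /andP[/eqP ? /eqP ?]; by [].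
  by move=> [-> ->]; rewrite !subrr !normr0 addr0.
have cgF (F : set_system 'rV[R]_n) (FF : Filter F) (v : 'rV[R]_n) :
    u @[u --> F] --> v -> g u @[u --> F] --> g v.
  move=> Fv; have Ft : u^T @[u --> F] --> v^T by exact: cvg_trmx.
  apply: cvgD; apply: cvg_norm.
    by apply: cvg_mulmx => //; exact: cvg_cst.
  by apply: cvgB; [exact: cvg_qform|exact: cvg_cst].
have cg : continuous g by move=> v; apply: (cgF _ (nbhs_filter v)) => ?; exact: id.
have Kclosed : closed K.
  rewrite (_ : K = g @^-1` [set 0])//; apply: preimage_closed => [v _|]; first exact: cg.
  exact: closed_eq.
have Kbnd : bounded_set K.
  exists 1; split; first exact: num_real.
  move=> M M1 v /KP[_ v1]; apply: le_trans (ltW M1).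
  rewrite -mx_norm_tr -(@ler_pXn2r _ 2)// ?nnegrE// expr1n -v1.
  exact: norm_sqr_le_qform1.
have scal (y : 'cV[R]_n) : y != 0 -> P *m y = y ->
    K ((Num.sqrt (qform 1%:M y))^-1 *: y)^T.
  move=> y0 Py; apply/KP; rewrite trmxK -scalemxAr Py; split=> //.
  rewrite qformZx exprVn sqr_sqrtr ?qform1_ge0// mulVf//.
  by rewrite gt_eqF// qform1_gt0.
have Kne : K !=set0.
  have [j /eqP Pj] : exists j, col j P != 0.
    apply: contrapT => /forallNP H; move/eqP : P0; apply; apply/matrixP => i j.
    have /negP := H j; rewrite negbK => /eqP/matrixP/(_ i 0).
    by rewrite !mxE.
  move/eqP in Pj; eexists; apply: (scal _ Pj).
  by rewrite colE mulmxA PP.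
have [|v /set_mem/KP[Pv v1] vmin] := @EVT_min_rV R n (fun v => qform A v^T) K Kne (bounded_closed_compact Kbnd Kclosed).
  apply: continuous_subspaceT.
  have cqF (F : set_system 'rV[R]_n) (FF : Filter F) (v : 'rV[R]_n) :
      u @[u --> F] --> v -> qform A u^T @[u --> F] --> qform A v^T.
    by move=> Fv; apply: cvg_qform; exact: cvg_trmx.
  by move=> v; apply: (cqF _ (nbhs_filter v)) => ?; exact: id.
pose c := v^T; pose l := qform A c.
have c0 : c != 0.
  apply/eqP => c0; move: v1; rewrite -/c c0 /qform mulmx0 mxE => /esym/eqP.
  by rewrite oner_eq0.
have hl y : P *m y = y -> l * qform 1%:M y <= qform A y.
  move=> Py; have [->|y0] := eqVneq y 0; first by rewrite /qform !mulmx0 mxE mulr0.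
  have := vmin _ (mem_set (scal y y0 Py)).
  rewrite trmxK qformZx exprVn sqr_sqrtr ?qform1_ge0//.
  by rewrite mulrC ler_pdivlMr// qform1_gt0.
exists l, c; split => //.
pose B := A - l *: 1%:M.
have sB : B^T = B by rewrite /B trmxD trmxN trmxZ trmx1 sA.
have qB y : qform B y = qform A y - l * qform 1%:M y by rewrite qformB qformZ.
have Bc0 : qform B c = 0 by rewrite qB -/l v1 mulr1 subrr.
have PBc : P *m (B *m c) = B *m c.
  rewrite /B !mulmxBl -!scalemxAl !mul1mx mulmxBr -scalemxAr Pv.
  by rewrite mulmxA -AP -mulmxA Pv.
have : qform 1%:M (B *m c) = 0.
  have -> : qform 1%:M (B *m c) = ((B *m c)^T *m B *m c) 0 0.
    by rewrite /qform mulmx1 mulmxA.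
  apply: (@psd_linear_zero _ (qform B (B *m c))) => s.
  have := hl (c + s *: (B *m c)); rewrite -subr_ge0 -qB qformDx// Bc0 add0r qformZx.
  rewrite trmxZ -!scalemxAl mxZE mulrA; apply.
  by rewrite mulmxDr Pv -scalemxAr PBc.
move=> /qform1_eq0; rewrite /B mulmxBl -scalemxAl mul1mx => /eqP.
by rewrite subr_eq0 => /eqP.
Qed.

Lemma sumsmx_seq_sub n m (s : seq R) (E : R -> 'M[R]_n) (K : 'M[R]_(m, n)) :
  {in s, forall a, (E a <= K)%MS} -> (\sum_(a <- s) E a <= K)%MS.
Proof.
elim: s => [|a s IH] h; first by rewrite big_nil sub0mx.
rewrite big_cons addsmx_sub h ?mem_head//=; apply: IH => b bs.
by apply: h; rewrite in_cons bs orbT.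
Qed.

Lemma sub_sumsmx_seq n (s : seq R) (E : R -> 'M[R]_n) a :
  a \in s -> (E a <= \sum_(a <- s) E a)%MS.
Proof.
elim: s => // b s IH; rewrite in_cons big_cons => /orP[/eqP ->|/IH h].
  exact: addsmxSl.
exact: submx_trans h (addsmxSr _ _).
Qed.

Lemma sumsmx_seq_stable n (s : seq R) (E : R -> 'M[R]_n) (A : 'M[R]_n) :
  {in s, forall a, (E a *m A <= E a)%MS} ->
  ((\sum_(a <- s) E a)%MS *m A <= \sum_(a <- s) E a)%MS.
Proof.
elim: s => [|a s IH] h; first by rewrite big_nil mul0mx sub0mx.
rewrite big_cons (addsmxMr _ _ _); apply: addsmxS; first exact: h (mem_head _ _).
by apply: IH => b bs; apply: h; rewrite in_cons bs orbT.
Qed.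

(** The extreme Rayleigh quotients on the dominant subspace and on its orthogonal complement are
    attained at eigenvectors, so both are eigenvalues. The first lies in [s] and the second does
    not, whence the strict inequality. *)
Lemma dominant_gap n r (A : 'M[R]_n) (Ur : 'M[R]_(n, r)) : A^T = A ->
  (1 <= r)%N -> (r < n)%N -> stiefel Ur -> spans_dominant_subspace A Ur ->
  let F := Ur^T *m A *m Ur in
  A *m Ur = Ur *m F /\
  exists al be : R, [/\ be < al,
    forall y : 'cV[R]_r, al * qform 1%:M y <= qform F y &
    forall y : 'cV[R]_n, Ur^T *m y = 0 -> qform A y <= be * qform 1%:M y].
Proof.
move=> sA r1 rn sUr [s [us szs hs hlt] hU] F.
have {}sUr : Ur^T *m Ur = 1%:M by [].
pose E a := eigenspace A^T a.
have EA a : E a *m A = a *: E a.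
  by rewrite -{1}sA; apply/eigenspaceP; exact: submx_refl.
have stab : (Ur^T *m A <= Ur^T)%MS.
  rewrite (eqmxMr A hU) hU; apply: sumsmx_seq_stable => a _.
  by rewrite EA; exact: scalemx_sub.
have /submxP[D hD] := stab.
have AU : A *m Ur = Ur *m D^T.
  by apply: trmx_inj; rewrite !trmx_mul sA trmxK.
have FD : F = D^T by rewrite /F -mulmxA AU mulmxA sUr mul1mx.
have sF : F^T = F by rewrite /F !trmx_mul trmxK sA mulmxA.
have AUF : A *m Ur = Ur *m F by rewrite FD.
split=> //.
pose P := Ur *m Ur^T.
have sP : P^T = P by rewrite /P trmx_mul trmxK.
have PU : P *m Ur = Ur by rewrite /P -mulmxA sUr mulmx1.
have UP : Ur^T *m P = Ur^T by rewrite /P mulmxA sUr mul1mx.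
have PP : P *m P = P by rewrite {2}/P mulmxA PU.
have AP : A *m P = P *m A.
  have DF : D = F by rewrite -[D]trmxK -FD sF.
  by rewrite /P mulmxA AUF -[RHS]mulmxA hD DF -[LHS]mulmxA.
have P0 : P != 0.
  apply/eqP => P0; move: sUr; rewrite -{1}UP P0 mulmx0 mul0mx.
  move=> /matrixP/(_ (Ordinal r1) (Ordinal r1)); rewrite !mxE eqxx => /esym/eqP.
  by rewrite oner_eq0.
have Q0 : 1%:M - P != 0.
  rewrite subr_eq0; apply/eqP => /esym/mulmx1_min.
  by rewrite leqNgt rn.
have [al [x [x0 Px Ax hal]]] := rayleigh_min sA sP PP AP P0.
(* The minimum for [- A] on the complementary projector: [- l'] is the greatest Rayleigh quotient on
   the orthogonal complement. *)
have [||||l' [z [z0 Pz Az hbe]]] := @rayleigh_min n (- A) (1%:M - P) _ _ _ _ Q0.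
- by rewrite trmxN sA.
- by rewrite trmxD trmxN trmx1 sP.
- by rewrite mulmxBr mulmx1 mulmxBl mul1mx PP subrr subr0.
- by rewrite mulmxBr mulmxBl mulmx1 mul1mx !mulNmx !mulmxN AP.
(* Eigenvectors of distinct eigenvalues are orthogonal: if [al] were outside [s], then [x] would be
   orthogonal to the dominant subspace in which it lies. *)
have als : al \in s.
  apply/negPn/negP => als; move/eqP: x0; apply.
  have : (Ur^T <= kermx x)%MS.
    rewrite hU; apply: sumsmx_seq_sub => a as_; apply/sub_kermxP.
    have : (a - al) *: (E a *m x) = 0.
      rewrite scalerBl scalemxAl -EA -mulmxA Ax -scalemxAr.
      by rewrite -scalerBl subrr scale0r.
    move/eqP; rewrite scaler_eq0 subr_eq0 => /orP[/eqP e|/eqP //].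
    by move: als; rewrite -e as_.
  by move=> /sub_kermxP Ux; rewrite -Px /P -mulmxA Ux mulmx0.
have Uz : Ur^T *m z = 0 by rewrite -Pz mulmxA mulmxBr mulmx1 UP subrr mul0mx.
have Az' : A *m z = (- l') *: z by rewrite scaleNr -Az mulNmx opprK.
have evz : eigenvalue A (- l').
  apply/eigenvalueP; exists z^T.
    by apply: trmx_inj; rewrite trmx_mul trmxZ !trmxK sA.
  by apply: contra z0 => /eqP e; rewrite -[z]trmxK e trmx0.
have ls : - l' \notin s.
  apply/negP => ls; move/eqP : z0; apply; apply: qform1_eq0.
  have : (z^T <= Ur^T)%MS.
    rewrite hU; apply: submx_trans (sub_sumsmx_seq _ ls).
    by apply/eigenspaceP; rewrite -trmx_mul Az' trmxZ.
  by move=> /submxP[d e]; rewrite /qform mulmx1 e -mulmxA Uz mulmx0 mxE.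
exists al, (- l'); split; first exact: hlt.
- move=> y; have := hal (Ur *m y).
  have e1 : qform 1%:M (Ur *m y) = qform 1%:M y.
    by rewrite /qform !mulmx1 trmx_mul -mulmxA (mulmxA Ur^T) sUr mul1mx.
  have e2 : qform A (Ur *m y) = qform F y.
    by rewrite /qform trmx_mul !mulmxA.
  by rewrite e1 e2; apply; rewrite mulmxA PU.
- move=> y Uy; rewrite mulNr lerNr -qformN; apply: hbe.
  by rewrite mulmxBl mul1mx /P -mulmxA Uy mulmx0 subr0.
Qed.

Lemma spans_dominant_rot n r (A : 'M[R]_n) (Ur : 'M[R]_(n, r)) (O : 'M[R]_r) :
  O \in unitmx -> spans_dominant_subspace A Ur -> spans_dominant_subspace A (Ur *m O).
Proof.
move=> uO [s hs hU]; exists s => //; apply: eqmx_trans hU.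
by rewrite trmx_mul; apply: eqmxMfull; rewrite row_full_unit unitmx_tr.
Qed.

End spectral.

Section exponential_convergence.
Context {R : realType}.

Lemma expR_decay_cvg0 (g : R) : 0 < g -> expR (- g * t) @[t --> +oo] --> 0.
Proof.
move=> g0; have gt : (g * t) @[t --> +oo] --> +oo.
  apply/cvgryPge => A; near=> t.
  rewrite mulrC -ler_pdivrMr//; near: t; exact: nbhs_pinfty_ge.
have := cvg_comp _ _ gt (@cvgr_expR R).
by rewrite /comp/=; under eq_fun do rewrite -mulNr.
Unshelve. all: by end_near. Qed.

(** With [e] the tail [c / g exp(- g t)] of the bound, [f - e] is nondecreasing and bounded above,
    and [e] tends to 0. The [max] with 0 keeps the monotone function within the times where [f] is
    controlled. *)
Lemma derive_decay_cvg (f df : R -> R) (c g : R) : 0 < g -> 0 <= c ->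
  (forall t : R, 0 <= t -> is_derive t 1 f (df t)) ->
  (forall t, 0 <= t -> `|df t| <= c * expR (- g * t)) ->
  exists l : R, f t @[t --> +oo] --> l.
Proof.
move=> g0 c0 hf hd.
pose e t := c / g * expR (- g * t).
have he (t : R) : is_derive t 1 (fun t => - e t) (c * expR (- g * t)).
  have := is_deriveN (is_derive_mul (is_derive_cst (c / g) t (1 : R)) (is_derive_expZ (- g) t)).
  rewrite mul0r add0r mulrA mulrN divfK ?gt_eqF//.
  by rewrite mulNr opprK.
have hbound a b : 0 <= a -> a <= b -> `|f b - f a| <= e a - e b.
  move=> a0 ab.
  have h0 t : a <= t <= b -> 0 <= t by move=> /andP[at_ _]; exact: le_trans at_.
  have -> : e a - e b = - e b - - e a by ring.
  exact: (derive_norm_le ab (fun t h => hf t (h0 t h)) (fun t _ => he t) (fun t h => hd t (h0 t h))).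
have e0 t : 0 <= e t by rewrite mulr_ge0 ?expR_ge0// divr_ge0// ltW.
pose h t := f (Num.max 0 t) - e (Num.max 0 t).
have hnd : {homo h : x y / x <= y}.
  move=> x y xy.
  have mxy : Num.max 0 x <= Num.max 0 y.
    by rewrite ge_max !le_max lexx xy/= orbT.
  have m0 : 0 <= Num.max 0 x by rewrite le_max lexx.
  have := hbound _ _ m0 mxy; rewrite ler_norml /h => /andP[]; lra.
have hub : has_ubound (range h).
  exists (f 0 + e 0) => _ [t _ <-].
  have m0 : 0 <= Num.max 0 t by rewrite le_max lexx.
  have := hbound _ _ (lexx 0) m0; rewrite ler_norml /h => /andP[_].
  have := e0 (Num.max 0 t); lra.
have hl := nondecreasing_cvgr hnd hub.
have el : e t @[t --> +oo] --> 0.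
  rewrite -(mulr0 (c / g)); apply: cvgM; first exact: cvg_cst.
  exact: expR_decay_cvg0.
have hfl : (h x + e x) @[x --> +oo] --> sup (range h) + 0 by exact: cvgD hl el.
rewrite addr0 in hfl.
exists (sup (range h)); apply: cvg_trans hfl; apply: near_eq_cvg; near=> t.
have t0 : 0 <= t by near: t; exact: nbhs_pinfty_ge.
by rewrite /h max_r//= subrK.
Unshelve. all: by end_near. Qed.

Lemma derive_mx_decay_cvg m n (f df : R -> 'M[R]_(m, n)) (c g : R) : 0 < g -> 0 <= c ->
  (forall t : R, 0 <= t -> is_derive t 1 f (df t)) ->
  (forall t, 0 <= t -> `|df t| <= c * expR (- g * t)) ->
  exists l : 'M[R]_(m, n), f t @[t --> +oo] --> l.
Proof.
move=> g0 c0 hf hd.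
have /choice[l hl] : forall ij : 'I_m * 'I_n, exists l : R, f t ij.1 ij.2 @[t --> +oo] --> l.
  move=> [i j]; apply: (@derive_decay_cvg _ (fun t => df t i j) c g) => // t t0.
    by have /is_derive_mxP := hf t t0; exact.
  exact: le_trans (le_mx_norm _ _ _) (hd t t0).
exists (\matrix_(i, j) l (i, j)); apply/cvg_mxP => i j; rewrite mxE; exact: (hl (i, j)).
Qed.

End exponential_convergence.

Section oja_convergence.
Context {R : realType}.

Lemma oja_converges n r (A : 'M[R]_n) (Ur U0 : 'M[R]_(n, r)) (W : R -> 'M[R]_(n, r)) (G : R -> 'M[R]_r) :
  A^T = A -> (1 <= r)%N -> (r < n)%N -> stiefel Ur -> spans_dominant_subspace A Ur ->
  Ur^T *m U0 \in unitmx ->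
  W 0 = U0 -> G 0 = 1%:M -> (forall t : R, is_derive t 1 W (A *m W t)) ->
  (forall t : R, G t \in unitmx /\ stiefel (W t *m G t)) ->
  let U t := W t *m G t in
  exists (c g : R), [/\ 0 < g, 0 <= c,
    forall t, 0 <= t -> `|oja_field A (U t)| <= c * expR (- g * t) &
    forall t, 0 <= t -> `|U t - Ur *m (Ur^T *m U t)| <= c * expR (- g * t)].
Proof.
move=> sA r1 rn sUr dom uU0 W0 G0 hW hG U.
have [AU [al [be [beal hal hbe]]]] := dominant_gap sA r1 rn sUr dom.
set F := Ur^T *m A *m Ur in AU hal.
have sF : F^T = F by rewrite /F !trmx_mul trmxK sA mulmxA.
clearbody F.
have UA : Ur^T *m A = F *m Ur^T by apply: trmx_inj; rewrite !trmx_mul sF sA trmxK.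
have {}sUr : Ur^T *m Ur = 1%:M by [].
pose w t := Ur^T *m W t.
have hw (t : R) : is_derive t 1 w (F *m w t).
  apply: is_derive_eq; first exact: is_derive_mulmx (is_derive_cst Ur^T t (1 : R)) (hW t).
  by rewrite mul0mx add0r mulmxA UA -mulmxA.
(* [v] will be the inverse of [w]: it solves the dual equation [v' = - v F], so invertibility at
   time 0 propagates as conservation of [v w = 1]. *)
have [|vT v0 hvT] := @linear_ode R r r (cst (- F)) (invmx (Ur^T *m U0))^T.
  exact: cst_continuous.
pose v t := (vT t)^T.
have hv (t : R) : is_derive t 1 v (- (v t *m F)).
  apply: is_derive_eq; first exact: is_derive_trmx (hvT t).
  by rewrite /cst trmx_mul trmxN sF mulmxN.
have vw t : v t *m w t = 1%:M.
  rewrite -(_ : v 0 *m w 0 = 1%:M); last by rewrite /v v0 trmxK /w W0 mulVmx.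
  apply: (@derive_mx_eq0_cstT _ _ _ (fun t => v t *m w t)) => s.
  apply: is_derive_eq; first exact: is_derive_mulmx (hv s) (hw s).
  by rewrite mulNmx mulmxA addNr.
have wv t : w t *m v t = 1%:M by exact: mulmx1C.
(* [Ur + Z] is the basis of the column space of [W] normalised by [Ur^T (Ur + Z) = 1]; [Z] measures
   the slope of that space over the dominant one. *)
pose Z t := W t *m v t - Ur.
have UZ t : Ur^T *m Z t = 0 by rewrite /Z mulmxBr mulmxA wv sUr subrr.
have ZU t : (Z t)^T *m Ur = 0 by apply: trmx_inj; rewrite trmx_mul trmxK UZ trmx0.
have hZ (t : R) : is_derive t 1 Z (A *m Z t - Z t *m F).
  apply: is_derive_eq.
    exact: is_deriveB (is_derive_mulmx (hW t) (hv t)) (is_derive_cst Ur t (1 : R)).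
  by rewrite /Z mulmxBr AU; mxring.
pose X t := w t *m G t.
have UE t : U t = (Ur + Z t) *m X t.
  by rewrite /Z addrC subrK /X mulmxA -(mulmxA (W t)) vw mulmx1.
have XE t : X t = Ur^T *m U t by rewrite /X /w /U mulmxA.
have sU t : (U t)^T *m U t = 1%:M by have [_] := hG t.
clearbody Z X U.
have UZ1 t : (Ur + Z t)^T *m (Ur + Z t) = 1%:M + (Z t)^T *m Z t.
  by rewrite trmxD mulmxDl !mulmxDr sUr UZ ZU addr0 add0r.
(* [N] is the inverse of [1 + Z^T Z], written so that its boundedness follows from that of [X]. *)
pose N t := X t *m (X t)^T.
have N1 t : N t + N t *m ((Z t)^T *m Z t) = 1%:M.
  have : (X t)^T *m ((1%:M + (Z t)^T *m Z t) *m X t) = 1%:M.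
    by rewrite -UZ1 -(sU t) UE trmx_mul !mulmxA.
  move=> /mulmx1C; rewrite -mulmxA -/(N t) => e.
  have sN : (N t)^T = N t by rewrite /N trmx_mul trmxK.
  by rewrite -[RHS]trmx1 -e trmx_mul sN trmxD trmx1 trmx_mul trmxK mulmxDr mulmx1.
pose g := al - be.
have g0 : 0 < g by rewrite subr_gt0.
(* Since [Z' = A Z - Z F], the gap [g] between the quadratic forms of [F] and of
   [A] on the range of [Z] keeps [k^2 exp(-2gt) - Z^T Z] positive semidefinite. *)
pose k := r%:R ^+ 2 * `|(Z 0)^T *m Z 0| + 1.
have k1 : 1 <= k by rewrite /k lerDr mulr_ge0// exprn_ge0.
have k0 : 0 <= k by exact: le_trans k1.
have ZZ t : 0 <= t -> forall x, qform ((Z t)^T *m Z t) x <= k ^+ 2 * expR (- (2 * g) * t) * qform 1%:M x.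
  move=> t0 x; rewrite -subr_ge0 -qformZ -qformB; move: x.
  pose p t := k ^+ 2 * expR (- (2 * g) * t).
  have hp (s : R) : is_derive s 1 p (- (2 * g) * p s).
    have := is_derive_mul (is_derive_cst (k ^+ 2) s (1 : R)) (is_derive_expZ (- (2 * g)) s).
    by rewrite mul0r add0r mulrCA.
  have p0 s : 0 <= p s by rewrite mulr_ge0 ?expR_ge0// exprn_ge0.
  (* The rate [2 g = 2 (al - be)] is shared out between the drift, shifted by [be], and the source.
     The first source term is nonnegative by the lower bound on [F], the second because the columns
     of [Z] are orthogonal to the dominant subspace. *)
  apply: (@lyapunov_psd R r (fun s => p s *: 1%:M - (Z s)^T *m Z s)
    (fun s => - (F - be *: 1%:M))
    (fun s => (2 * p s) *: (F - al *: 1%:M) + 2 *: ((Z s)^T *m (be *: 1%:M - A) *m Z s)) 0 t t0).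
  - move=> s _.
    apply: is_derive_eq.
      apply: is_deriveB (is_derive_scale (hp s) (is_derive_cst 1%:M s (1 : R))) (is_derive_mulmx (is_derive_trmx (hZ s)) (hZ s)).
    rewrite /g !(trmxN, trmxD, trmxZ, trmx_mul, sF, sA, trmx1); mxring.
  - by move=> s _; exact: cst_continuous.
  - move=> s _ x; rewrite qformD !qformZ addr_ge0//.
      rewrite !mulr_ge0//; rewrite qformB qformZ subr_ge0; exact: hal.
    rewrite mulr_ge0// -{1}[Z s]trmxK trmxK.
    have := qform_congr (be *: 1%:M - A) (Z s)^T x; rewrite trmxK => ->.
    rewrite qformB qformZ subr_ge0; apply: hbe.
    by rewrite mulmxA UZ mul0mx.
  (* The initial size is at most [k], and [k <= k^2] thanks to the summand 1 in [k]. *)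
  - move=> x; rewrite qformB qformZ subr_ge0 /p mulr0 expR0 mulr1.
    apply: le_trans (ler_norm _) _; apply: le_trans (qform_norm_le _ _) _.
    rewrite ler_wpM2r ?qform1_ge0// (@le_trans _ _ k)// /k ?lerDl//.
    by rewrite -/k expr2 ler_peMr.
have Zb t : 0 <= t -> `|Z t| <= k * expR (- g * t).
  move=> t0; apply/mx_normP => [|i j]; first by rewrite mulr_ge0// expR_ge0.
  rewrite -(@ler_pXn2r _ 2)// ?nnegrE// ?mulr_ge0 ?expR_ge0//.
  rewrite exprMn -expRM_natl -mulr_natl.
  have := ZZ t t0 (delta_mx j 0).
  have -> : qform 1%:M (delta_mx j 0 : 'cV[R]_r) = 1.
    by rewrite /qform mulmx1 trmx_delta mul_delta_mx mxE !eqxx.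
  rewrite mulr1 => h.
  apply: le_trans (_ : _ <= qform ((Z t)^T *m Z t) (delta_mx j 0)) _; last first.
    by move: h; rewrite mulr1 (_ : - (2 * g) * t = 2 * (- g * t))//; ring.
  have -> : qform ((Z t)^T *m Z t) (delta_mx j 0) = qform 1%:M (col j (Z t)).
    by rewrite colE /qform trmx_mul mulmx1 !mulmxA.
  apply: le_trans (norm_sqr_le_qform1 _).
  rewrite lerXn2r ?nnegrE//; have := le_mx_norm (col j (Z t)) i 0; by rewrite mxE.
have U1 t : `|U t| <= 1 by apply: stiefel_norm_le1; exact: sU.
have Ur1 : `|Ur| <= 1 by exact: stiefel_norm_le1.
have Xb t : `|X t| <= n%:R.
  rewrite XE -[leRHS]mulr1 -[X in X * 1]mulr1; apply: mx_norm_mul_le => //.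
  by rewrite mx_norm_tr.
have Nb t : `|N t| <= r%:R * n%:R * n%:R by apply: mx_norm_mul_le => //; rewrite mx_norm_tr.
have UUr t : (1%:M - U t *m (U t)^T) *m Ur = Ur *m N t *m (Z t)^T *m Z t - Z t *m N t.
  have -> : U t *m (U t)^T = (Ur + Z t) *m N t *m (Ur + Z t)^T.
    by rewrite UE trmx_mul !mulmxA.
  have e : (Ur + Z t) *m N t *m (Ur + Z t)^T *m Ur = (Ur + Z t) *m N t.
    have e0 : (Ur + Z t)^T *m Ur = 1%:M by rewrite trmxD mulmxDl sUr ZU addr0.
    by rewrite -mulmxA e0 mulmx1.
  rewrite mulmxBl mul1mx e -{1}[Ur]mulmx1 -(N1 t); mxring.
(* Every term carries a factor [Z]: [1 - U U^T] is small on [Ur] by [UUr], and the rest of [A U] is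
   [A Z X]. Hence the field is bounded by a multiple of [|Z|]. *)
have oE t : oja_field A (U t) =
   (Ur *m (N t *m ((Z t)^T *m Z t)) - Z t *m N t) *m (F *m X t) +
   (A *m (Z t *m X t) - U t *m ((U t)^T *m (A *m (Z t *m X t)))).
  have AUt : A *m U t = Ur *m (F *m X t) + A *m (Z t *m X t).
    by rewrite UE mulmxA mulmxDr AU mulmxDl !mulmxA.
  rewrite /oja_field -mulmxA AUt mulmxDr (mulmxA _ Ur) UUr; mxring.
have Zk t : 0 <= t -> `|Z t| <= k.
  move=> t0; apply: le_trans (Zb t t0) _; rewrite ler_piMr// -[leRHS]expR0 ler_expR.
  by rewrite mulNr oppr_le0 mulr_ge0// ltW.
pose nb : R := r%:R * n%:R * n%:R.
pose c1 : R := r%:R * (r%:R * 1 * (r%:R * nb * (n%:R * k * 1)) + r%:R * 1 * nb) * (r%:R * `|F| * n%:R)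
   + (n%:R * `|A| * (r%:R * 1 * n%:R) + r%:R * 1 * (n%:R * 1 * (n%:R * `|A| * (r%:R * 1 * n%:R)))).
have c10 : 0 <= c1 by rewrite /c1 /nb; rewrite ?(addr_ge0, mulr_ge0).
exists ((c1 + r%:R * n%:R) * k), g; split => //.
- by rewrite mulr_ge0// addr_ge0// mulr_ge0.
- move=> t t0.
  apply: (@le_trans _ _ (c1 * `|Z t|)); last first.
    rewrite -mulrA; apply: ler_pM => //; last exact: Zb.
    by rewrite lerDl mulr_ge0.
  rewrite oE.
  set z := `|Z t|.
  have zT : `|(Z t)^T| <= k by rewrite mx_norm_tr Zk.
  have b1 : `|Ur *m (N t *m ((Z t)^T *m Z t)) - Z t *m N t| <=
     (r%:R * 1 * (r%:R * nb * (n%:R * k * z)) + r%:R * z * nb).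
    apply: le_trans (ler_normB _ _) _; apply: lerD.
      by apply: mx_norm_mul_le => //; apply: mx_norm_mul_le => //; exact: mx_norm_mul_le.
    by apply: mx_norm_mul_le => //; exact: Nb.
  have b2 : `|F *m X t| <= r%:R * `|F| * n%:R by apply: mx_norm_mul_le.
  have b3 : `|A *m (Z t *m X t)| <= n%:R * `|A| * (r%:R * z * n%:R).
    by apply: mx_norm_mul_le => //; exact: mx_norm_mul_le.
  have b4 : `|U t *m ((U t)^T *m (A *m (Z t *m X t)))| <= r%:R * 1 * (n%:R * 1 * (n%:R * `|A| * (r%:R * z * n%:R))).
    by apply: mx_norm_mul_le => //; apply: mx_norm_mul_le => //; rewrite mx_norm_tr.
  apply: le_trans (ler_normD _ _) _.
  apply: le_trans (lerD (mx_norm_mul_le b1 b2) (le_trans (ler_normB _ _) (lerD b3 b4))) _.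
  by rewrite le_eqVlt /c1; apply/orP; left; apply/eqP; ring.
- move=> t t0; rewrite -XE {1}UE mulmxDl addrC addKr.
  apply: (@le_trans _ _ (r%:R * (k * expR (- g * t)) * n%:R)).
    by apply: mx_norm_mul_le => //; exact: Zb.
  have -> : r%:R * (k * expR (- g * t)) * n%:R = r%:R * n%:R * k * expR (- g * t) by ring.
  by rewrite ler_wpM2r ?expR_ge0// ler_wpM2r// lerDr.
Qed.

End oja_convergence.

(** * Convergence of the Riccati equation *)

Section observability.
Context {R : realType}.

Lemma posdef_lower n (S : 'M[R]_n) : posdef S ->
  exists2 e : R, 0 < e & forall x, e * qform 1%:M x <= qform S x.
Proof.
move=> [sS pS]; case: n => [|n] in S sS pS *.
  by exists 1 => // x; rewrite [x]flatmx0 /qform !mulmx0 mxE mulr0.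
have [||||l [x [x0 _ Sx hl]]] := @rayleigh_min R n.+1 S 1%:M sS.
- exact: trmx1.
- by rewrite mulmx1.
- by rewrite mulmx1 mul1mx.
- exact: oner_neq0.
exists l => [|y]; last by apply: hl; rewrite mul1mx.
have := pS _ x0; rewrite -mulmxA Sx -scalemxAr mxZE.
have -> : (x^T *m x) 0 0 = qform 1%:M x by rewrite /qform mulmx1.
by rewrite pmulr_lgt0// qform1_gt0.
Qed.

Lemma posdef_unitmx n (S : 'M[R]_n) : posdef S -> S \in unitmx.
Proof.
move=> [_ pS]; apply: unitmx_inj => x Sx; apply/eqP/negPn/negP => /pS.
by rewrite -mulmxA Sx mulmx0 mxE ltxx.
Qed.

Lemma posdef_psd n (S : 'M[R]_n) : posdef S -> psd S.
Proof.
move=> [_ pS] x; have [->|/pS/ltW //] := eqVneq x 0.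
by rewrite /qform mulmx0 mxE.
Qed.

Lemma posdef_inv n (S : 'M[R]_n) : posdef S -> posdef (invmx S).
Proof.
move=> pdS; have u := posdef_unitmx pdS; have [sS pS] := pdS.
have sI : (invmx S)^T = invmx S by rewrite trmx_inv sS.
split=> // x x0.
have -> : x^T *m invmx S *m x = (invmx S *m x)^T *m S *m (invmx S *m x).
  by rewrite trmx_mul sI -!mulmxA (mulmxA S) mulmxV// mul1mx.
apply: pS; apply: contra x0 => /eqP e.
by rewrite -[x](mulKVmx u) e mulmx0.
Qed.

Lemma qform_delta n (S : 'M[R]_n) i j : ((delta_mx i 0 : 'cV[R]_n)^T *m S *m (delta_mx j 0 : 'cV[R]_n)) 0 0 = S i j.
Proof. by rewrite trmx_delta -rowE -colE !mxE. Qed.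

(** Polarisation: [2 S i j] is the value at [ei + ej] minus the values at [ei] and [ej]. The squared
    length of [ei + ej] is at most 4, so the entry is at most [(4 + 1 + 1) / 2] times [d]. *)
Lemma qform_bound_norm n (S : 'M[R]_n) (d : R) : 0 <= d -> S^T = S ->
  (forall x, `|qform S x| <= d * qform 1%:M x) -> `|S| <= 3 * d.
Proof.
move=> d0 sS h; apply/mx_normP => [|i j]; first by rewrite mulr_ge0.
pose ei : 'cV[R]_n := delta_mx i 0; pose ej : 'cV[R]_n := delta_mx j 0.
have q1 k : qform 1%:M (delta_mx k 0 : 'cV[R]_n) = 1.
  by rewrite /qform qform_delta !mxE eqxx.
have hi := h ej; have hj := h ei; have hij := h (ej + ei).
rewrite (qformDx _ _ sS) (qformDx _ _ (trmx1 _ _)) !q1 /ei /ej !qform_delta in hij.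
rewrite q1 in hi; rewrite q1 in hj.
have d1 : (1%:M : 'M[R]_n) i j <= 1 by rewrite mxE; case: eqP => _; rewrite ?lexx ?ler01.
have : d * (1 + 2 * (1%:M : 'M[R]_n) i j + 1) <= d * 4.
  by rewrite ler_wpM2l//; lra.
move: hi hj hij; rewrite !ler_norml !mulr1 => /andP[h1 h2] /andP[h3 h4] /andP[h5 h6] h7.
by rewrite /ei/ej in h3 h4; lra.
Qed.

Lemma observable_ker r p (F : 'M[R]_r) (K : 'M[R]_(p, r)) (x : 'cV[R]_r) :
  observable F K -> (forall i : nat, K *m F ^+ i *m x = 0) -> x = 0.
Proof.
rewrite /observable; set O := \mxcol_(i < r) _ => rO hx.
have Ox : O *m x = 0.
  rewrite /O mxcol_mul -[RHS](mxcol0 (p_ := fun _ : 'I_r => p)).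
  by apply: eq_mxcol => i; rewrite hx.
have fO : row_free O^T by rewrite /row_free mxrank_tr rO.
apply: trmx_inj; rewrite trmx0; apply: (row_free_inj fO).
by rewrite mul0mx -trmx_mul Ox trmx0.
Qed.

(** The linear map [X |-> X f + f X] on a finite-dimensional space is injective: pairing it with [X]
    under the trace gives a sum of values of the positive form [f] on the columns of [X] and of
    [X^T]. Symmetry of the solution follows from uniqueness, as [X^T] is another one. *)
Lemma sylvester_solvable r (f Q : 'M[R]_r) : f^T = f ->
  (forall x, x != 0 -> 0 < qform f x) -> Q^T = Q ->
  exists2 X : 'M[R]_r, X^T = X & X *m f + f *m X = Q.
Proof.
move=> sf pf sQ.
have pf0 x : 0 <= qform f x.
  by have [->|/pf/ltW//] := eqVneq x 0; rewrite /qform mulmx0 mxE.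
have inj0 (X : 'M[R]_r) : X *m f + f *m X = 0 -> X = 0.
  move=> e.
  have tr2 (Y : 'M[R]_r) : \tr (Y^T *m f *m Y) = \sum_j qform f (col j Y).
    apply: eq_bigr => j _.
    by rewrite /qform tr_col -row_mul colE mulmxA -colE -[in RHS]row_mul !mxE; apply: eq_bigr => k _; rewrite !mxE.
  have h : \tr (X^T *m f *m X) + \tr (X *m f *m X^T) = 0.
    have : X^T *m (X *m f + f *m X) = 0 by rewrite e mulmx0.
    rewrite mulmxDr => /(congr1 mxtrace); rewrite mxtraceD mxtrace0 addrC => <-.
    by congr (_ + _); [rewrite mulmxA|rewrite mxtrace_mulC].
  have t1 : 0 <= \tr (X^T *m f *m X) by rewrite tr2 sumr_ge0.
  have t2 : 0 <= \tr (X *m f *m X^T) by rewrite -{1}[X]trmxK tr2 sumr_ge0.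
  move/eqP : h; rewrite paddr_eq0// => /andP[+ _]; rewrite tr2 psumr_eq0 => [/allP h|j _]; last exact: pf0.
  apply/matrixP => i j; have := h j (mem_index_enum _) => /=.
  case: (eqVneq (col j X) 0) => [/matrixP/(_ i 0) + _|/pf]; first by rewrite !mxE.
  by rewrite lt_def => /andP[/negbTE ->].
pose Phi := lin_mulmxr f + lin_mulmx f.
have PhiE (X : 'M[R]_r) : mxvec X *m Phi = mxvec (X *m f + f *m X).
  by rewrite mulmxDr !mul_vec_lin linearD.
have uPhi : Phi \in unitmx.
  rewrite -row_free_unit -kermx_eq0; apply/eqP/row_matrixP => i; rewrite row0.
  have : row i (kermx Phi) *m Phi = 0 by rewrite -row_mul mulmx_ker row0.
  rewrite -[row i _]vec_mxK PhiE => /eqP; rewrite mxvec_eq0 => /eqP/inj0 ->.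
  by rewrite linear0.
pose X := vec_mx (mxvec Q *m invmx Phi).
have XE : X *m f + f *m X = Q.
  by apply: (can_inj mxvecK); rewrite -PhiE vec_mxK mulmxKV.
exists X => //; apply/eqP; rewrite -subr_eq0; apply/eqP/inj0.
rewrite mulmxBl mulmxBr addrACA -opprD XE.
have -> : X^T *m f + f *m X^T = (X *m f + f *m X)^T by rewrite trmxD !trmx_mul sf addrC.
by rewrite XE sQ subrr.
Qed.

(** The shift [l] makes [f = F + l] positive definite, and [Pi] is the observability Gramian of the
    stable pair [(- f, K)]. If [m] is its least eigenvalue, with eigenvector [y], then
    [|K y|^2 = 2 m (y^T f y)] gives [m >= 0]. For [m = 0] the kernel of [Pi] would be a nonzero
    [F]-invariant subspace killed by [K], against observability. *)
Lemma observability_lyapunov r p (F : 'M[R]_r) (K : 'M[R]_(p, r)) : F^T = F ->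
  observable F K -> exists (l : R) (Pi : 'M[R]_r), [/\ 0 < l, posdef Pi &
    Pi *m F + F *m Pi = K^T *m K - (2 * l) *: Pi].
Proof.
move=> sF obs.
pose l := r%:R ^+ 2 * `|F| + 1.
have l0 : 0 < l by rewrite /l ltr_wpDl// mulr_ge0// exprn_ge0.
pose f := F + l *: 1%:M.
have sf : f^T = f by rewrite /f trmxD trmxZ trmx1 sF.
have pf x : x != 0 -> 0 < qform f x.
  move=> x0; rewrite /f qformD qformZ.
  have := qform_norm_le F x; rewrite ler_norml => /andP[h _].
  have := qform1_gt0 x0; rewrite /l mulrDl mul1r; lra.
have sKK : (K^T *m K)^T = K^T *m K by rewrite trmx_mul trmxK.
have [Pi sPi PiE] := sylvester_solvable sf pf sKK.
exists l, Pi; split=> //; last first.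
  by rewrite -PiE /f; mxring.
split=> // x x0; rewrite -/(qform Pi x).
case: r => [|r] in F K sF obs l l0 f sf pf sKK Pi sPi PiE x x0 *.
  by move: x0; rewrite [x]flatmx0 eqxx.
have [||||m [y [y0 _ Py hm]]] := @rayleigh_min R r.+1 Pi 1%:M sPi.
- exact: trmx1.
- by rewrite mulmx1.
- by rewrite mulmx1 mul1mx.
- exact: oner_neq0.
have quad z : qform (K^T *m K) z = 2 * (z^T *m f *m (Pi *m z)) 0 0.
  rewrite -PiE qformD.
  have -> : qform (Pi *m f) z = qform (f *m Pi) z by rewrite -qform_tr trmx_mul sPi sf.
  by rewrite /qform !mulmxA; ring.
have KK0 z : 0 <= qform (K^T *m K) z.
  have := qform_congr 1%:M K^T z; rewrite mulmx1 trmxK => ->; exact: qform1_ge0.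
have m0 : 0 <= m.
  have := KK0 y; rewrite quad Py -scalemxAr mxZE -/(qform f y) mulrA pmulr_lge0 ?pf//.
  by rewrite pmulr_rge0.
have mgt : 0 < m.
  rewrite lt_def m0 andbT; apply/eqP => mz; move/eqP : y0; apply.
  have inv (z : 'cV[R]_r.+1) : Pi *m z = 0 -> K *m z = 0 /\ Pi *m (F *m z) = 0.
    move=> Pz.
    have Kz : K *m z = 0.
      apply: qform1_eq0; have := qform_congr 1%:M K^T z; rewrite mulmx1 trmxK => <-.
      by rewrite quad Pz mulmx0 mxE mulr0.
    split=> //.
    have -> : F *m z = f *m z - l *: z by rewrite /f mulmxDl -scalemxAl mul1mx addrK.
    rewrite mulmxBr -scalemxAr Pz scaler0 subr0 mulmxA.
    have -> : Pi *m f = K^T *m K - f *m Pi by rewrite -PiE addrK.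
    by rewrite mulmxBl -!mulmxA Kz Pz !mulmx0 subrr.
  have Pk i : Pi *m (F ^+ i *m y) = 0.
    elim: i => [|i IH]; first by rewrite expr0 mul1mx Py mz scale0r.
    by rewrite exprS -mulmxE -mulmxA; have [_] := inv _ IH.
  apply: (observable_ker obs) => i.
  by rewrite -mulmxA; have [] := inv _ (Pk i).
apply: lt_le_trans (hm x _); last by rewrite mul1mx.
by rewrite mulr_gt0// qform1_gt0.
Qed.

End observability.

Section riccati_convergence.
Context {R : realType}.

(* Completing the square against the constant gain [L = T K^T / 2], where
   [T^-1] solves the Lyapunov equation, makes a large multiple of [T] a
   supersolution of the Riccati equation as soon as [(a, Cm)] is close to its
   limit [(F, K)]. *)
Lemma riccati_bounded r p (a P : R -> 'M[R]_r) (Cm : R -> 'M[R]_(p, r))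
    (F : 'M[R]_r) (K : 'M[R]_(p, r)) (N : 'M[R]_p) (q : R) :
  F^T = F -> observable F K -> posdef N ->
  (forall t : R, 0 <= t -> {for t, continuous a}) ->
  (forall t : R, 0 <= t -> {for t, continuous Cm}) ->
  a t @[t --> +oo] --> F -> Cm t @[t --> +oo] --> K ->
  (forall t : R, 0 <= t -> (P t)^T = P t) ->
  (forall t : R, 0 <= t -> is_derive t 1 P
     (a t *m P t + P t *m (a t)^T + q%:M - P t *m ((Cm t)^T *m N *m Cm t) *m P t)) ->
  exists2 rho, 0 < rho & forall t, 0 <= t -> forall x, qform (P t) x <= rho * qform 1%:M x.
Proof.
move=> sF obs pN ca cC aF CK sP hP.
have [l [Pi [l0 pPi PiE]]] := observability_lyapunov sF obs.
pose T : 'M[R]_r := invmx Pi.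
have uPi := posdef_unitmx pPi.
have pT : posdef T := posdef_inv pPi.
have [sT _] := pT.
have uN := posdef_unitmx pN.
have [sN _] := pN.
have [sNI _] := posdef_inv pN.
have TE : F *m T + T *m F = T *m K^T *m K *m T - (2 * l) *: T.
  have : T *m (Pi *m F + F *m Pi) *m T = T *m (K^T *m K - (2 * l) *: Pi) *m T by rewrite PiE.
  rewrite mulmxDr !mulmxDl !mulmxA mulVmx// mul1mx -[T *m F *m Pi *m T]mulmxA mulmxV// mulmx1 => ->.
  by rewrite mulmxBr mulmxBl -scalemxAr -scalemxAl mulVmx// mul1mx !mulmxA.
pose L := 2^-1 *: (T *m K^T).
pose M t := a t - L *m Cm t.
(* [B] vanishes in the limit: because of the factor 1/2 in [L], its two contributions add up to
   [T K^T K T], which the Lyapunov equation for [T] cancels. *)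
pose B t := M t *m T + T *m (M t)^T + (2 * l) *: T.
have cB : B t @[t --> +oo] --> (0 : 'M[R]_r).
  have -> : (0 : 'M[R]_r) = (F - L *m K) *m T + T *m (F - L *m K)^T + (2 * l) *: T.
    have -> : (F - L *m K) *m T + T *m (F - L *m K)^T = F *m T + T *m F - T *m K^T *m K *m T.
      rewrite /L !(trmxD, trmxN, trmx_mul, trmxZ, trmxK, sT, sF).
      rewrite -scalemxAl -!scalemxAr !mulmxDl !mulmxDr !mulNmx !mulmxN -!scalemxAl -!scalemxAr !mulmxA.
      by apply/matrixP => i j; rewrite !(mxDE, mxNE, mxZE); field.
    by rewrite TE; mxring.
  have cM : M t @[t --> +oo] --> F - L *m K.
    apply: cvgB => //; apply: cvg_mulmx => //; exact: cvg_cst.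
  apply: cvgD; last exact: cvg_cst.
  apply: cvgD; apply: cvg_mulmx => //; try exact: cvg_cst.
  exact: cvg_trmx.
have [tau tau0 htau] := posdef_lower pT.
have [t0 t00 ht0] : exists2 t0, 0 <= t0 & forall t, t0 <= t -> forall x, qform (B t) x <= l * qform T x.
  have e0 : 0 < l * tau / (r%:R ^+ 2 + 1) by rewrite !divr_gt0// ?mulr_gt0// ltr_wpDl// exprn_ge0.
  move/cvgrPdist_le : cB => /(_ _ e0) [t1 [_ h1]].
  exists (Num.max 0 t1 + 1); first by rewrite addr_ge0// le_max lexx.
  move=> t tt x.
  have {}h1 : `|B t| <= l * tau / (r%:R ^+ 2 + 1).
    rewrite -normrN -[- B t]add0r; apply: h1.
    by apply: lt_le_trans tt; rewrite ltr_pwDr// le_max lexx orbT.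
  apply: le_trans (ler_norm _) _; apply: le_trans (qform_norm_le _ _) _.
  apply: (@le_trans _ _ (l * (tau * qform 1%:M x))); last by rewrite ler_wpM2l// ltW.
  rewrite mulrA ler_wpM2r ?qform1_ge0//.
  apply: (@le_trans _ _ (r%:R ^+ 2 * (l * tau / (r%:R ^+ 2 + 1)))).
    by rewrite ler_wpM2l// exprn_ge0.
  rewrite mulrA ler_pdivrMr; last by rewrite ltr_wpDl// exprn_ge0.
  rewrite mulrC ler_wpM2l ?mulr_ge0 ?(ltW l0) ?(ltW tau0)//.
  by rewrite lerDl.
have [kp kp0 hkp] : exists2 kp, 0 <= kp & forall t, 0 <= t <= t0 -> `|P t| <= kp.
  apply: continuous_segment_bounded => // t /andP[t0' _].
  exact: is_derive_continuous (hP t t0').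
pose Q := q%:M + L *m invmx N *m L^T.
(* The first summand lets [kap l T] absorb [Q] after time [t0]; the second makes [kap T] dominate
   [P] at [t0]. *)
pose kap := (r%:R ^+ 2 * `|Q|) / (l * tau) + (r%:R ^+ 2 * kp) / tau.
have r2 : 0 <= (r%:R ^+ 2 : R) by rewrite exprn_ge0.
have kap1 : r%:R ^+ 2 * `|Q| <= kap * l * tau.
  rewrite /kap mulrDl mulrDl -mulrA -[_ * l * tau]mulrA divfK ?gt_eqF ?mulr_gt0//.
  by rewrite lerDl !mulr_ge0// ?invr_ge0 ltW.
have kap2 : r%:R ^+ 2 * kp <= kap * tau.
  rewrite /kap mulrDl divfK ?gt_eqF// lerDr mulr_ge0 ?(ltW tau0)// divr_ge0 ?mulr_ge0//.
  - exact: ltW.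
  - exact: ltW.
have kap0 : 0 <= kap.
  by rewrite /kap addr_ge0// divr_ge0 ?mulr_ge0// ltW.
have E0 t : 0 <= t <= t0 -> forall x, qform (P t) x <= r%:R ^+ 2 * kp * qform 1%:M x.
  move=> tt x; apply: le_trans (ler_norm _) _; apply: le_trans (qform_norm_le _ _) _.
  by rewrite ler_wpM2r ?qform1_ge0// ler_wpM2l// hkp.
have late t : t0 <= t -> psd (kap *: T - P t).
  move=> tt.
  apply: (@lyapunov_psd R r (fun s => kap *: T - P s) M
    (fun s => (P s *m (Cm s)^T - L *m invmx N) *m N *m (P s *m (Cm s)^T - L *m invmx N)^T
              - Q + kap *: ((2 * l) *: T - B s)) t0 t tt).
  - move=> s /andP[ts _]; have s0 : 0 <= s by exact: le_trans ts.
    apply: is_derive_eq.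
      exact: is_deriveB (is_derive_cst (kap *: T) s (1 : R)) (hP s s0).
    rewrite sub0r.
    (* The square trades the quadratic term of the Riccati equation for terms linear in [P], which
       enter the drift [M = a - L Cm], at the price of the constant [L N^-1 L^T] in [Q]. *)
    have sq : (P s *m (Cm s)^T - L *m invmx N) *m N *m (P s *m (Cm s)^T - L *m invmx N)^T =
       P s *m ((Cm s)^T *m N *m Cm s) *m P s - P s *m (Cm s)^T *m L^T - L *m Cm s *m P s + L *m invmx N *m L^T.
      rewrite trmxD trmxN !trmx_mul trmxK sNI (sP s s0).
      have e1 : (P s *m (Cm s)^T - L *m invmx N) *m N = P s *m (Cm s)^T *m N - L.
        by rewrite mulmxDl mulNmx -!mulmxA mulVmx// mulmx1.
      rewrite e1 mulmxDl !mulmxDr !mulNmx !mulmxN.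
      have e2 : P s *m (Cm s)^T *m N *m (invmx N *m L^T) = P s *m (Cm s)^T *m L^T.
        by rewrite mulmxA -[_ *m N *m invmx N]mulmxA mulmxV// mulmx1.
      rewrite e2; mxring.
    rewrite sq /B /Q /M; mxring.
  - move=> s /andP[ts _]; have s0 : 0 <= s by exact: le_trans ts.
    apply: cvgB; first exact: ca.
    by apply: cvg_mulmx; [exact: cvg_cst|exact: cC].
  - move=> s /andP[ts _] x.
    rewrite qformD qformB qform_congr qformZ qformB qformZ.
    have h1 := posdef_psd pN ((P s *m (Cm s)^T - L *m invmx N)^T *m x).
    have h2 := ht0 s ts x.
    have h3 : qform Q x <= kap * (l * qform T x).
      apply: le_trans (ler_norm _) _; apply: le_trans (qform_norm_le _ _) _.
      apply: (@le_trans _ _ (kap * l * tau * qform 1%:M x)).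
        by rewrite ler_wpM2r// qform1_ge0.
      by rewrite -!mulrA ler_wpM2l// ler_wpM2l// ltW.
    have h4 : kap * (l * qform T x) <= kap * (2 * l * qform T x - qform (B s) x).
      by rewrite ler_wpM2l//; lra.
    lra.
  - move=> x; rewrite qformB qformZ subr_ge0.
    apply: le_trans (E0 t0 _ x) _; first by rewrite t00 lexx.
    apply: (@le_trans _ _ (kap * tau * qform 1%:M x)).
      by rewrite ler_wpM2r ?qform1_ge0.
    by rewrite -mulrA ler_wpM2l.
exists (kap * (r%:R ^+ 2 * `|T|) + r%:R ^+ 2 * kp + 1).
  by rewrite ltr_wpDl// addr_ge0 ?mulr_ge0.
move=> t t_ge0 x; rewrite mulrDl mulrDl mul1r.
have q1 := qform1_ge0 x.
have b1 : 0 <= kap * (r%:R ^+ 2 * `|T|) * qform 1%:M x by rewrite !mulr_ge0.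
have b2 : 0 <= r%:R ^+ 2 * kp * qform 1%:M x by rewrite !mulr_ge0.
have [tt|/ltW tt] := leP t t0.
  by have := E0 t _ x; rewrite t_ge0 tt => /(_ isT); lra.
have := late t tt x; rewrite qformB qformZ.
have h := qform_norm_le T x; rewrite ler_norml in h; case/andP: h => _ h.
have : kap * qform T x <= kap * (r%:R ^+ 2 * `|T| * qform 1%:M x) by rewrite ler_wpM2l.
by rewrite mulrA; lra.
Qed.

Lemma riccati_field_sym r (a P S : 'M[R]_r) (q : R) : P^T = P -> S^T = S ->
  (a *m P + P *m a^T + q%:M - P *m S *m P)^T = a *m P + P *m a^T + q%:M - P *m S *m P.
Proof.
by move=> sP sS; rewrite !(trmxD, trmxN, trmx_mul, trmxK, sP, sS, tr_scalar_mx); mxring.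
Qed.

(** The derivative [dP] obeys a Lyapunov equation with drift [M = a - P S] and source [Th] made of
    [a'] and [S']. With the same drift, [lam P] for [lam = k exp(- kap t)] has source
    [lam (q + P S P - kap P)], which is at least [lam q / 2] once [P] is bounded by [rho]. *)
Lemma riccati_converges r p (a da P : R -> 'M[R]_r) (Cm dC : R -> 'M[R]_(p, r))
    (F : 'M[R]_r) (K : 'M[R]_(p, r)) (N : 'M[R]_p) (q c g : R) :
  F^T = F -> observable F K -> posdef N -> 0 < q -> 0 < g -> 0 <= c ->
  (forall t : R, 0 <= t -> is_derive t 1 a (da t)) ->
  (forall t : R, 0 <= t -> is_derive t 1 Cm (dC t)) ->
  (forall t : R, 0 <= t -> `|da t| <= c * expR (- g * t)) ->
  (forall t : R, 0 <= t -> `|dC t| <= c * expR (- g * t)) ->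
  (forall t : R, 0 <= t -> `|Cm t| <= c) ->
  a t @[t --> +oo] --> F -> Cm t @[t --> +oo] --> K ->
  (forall t : R, 0 <= t -> posdef (P t)) ->
  (forall t : R, 0 <= t -> is_derive t 1 P
     (a t *m P t + P t *m (a t)^T + q%:M - P t *m ((Cm t)^T *m N *m Cm t) *m P t)) ->
  exists2 Poo : 'M[R]_r, posdef Poo & P t @[t --> +oo] --> Poo.
Proof.
move=> sF obs pN q0 g0 c0 ha hC hda hdC bC aF CK pP hP.
have sP (t : R) (t0 : 0 <= t) : (P t)^T = P t by have [] := pP t t0.
have [rho rho0 hrho] := riccati_bounded sF obs pN (fun t t0 => is_derive_continuous (ha t t0))
  (fun t t0 => is_derive_continuous (hC t t0)) aF CK sP hP.
have [sN _] := pN.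
have Pb t : 0 <= t -> `|P t| <= 3 * rho.
  move=> t0; apply: qform_bound_norm; [exact: ltW|exact: sP|move=> x].
  by rewrite ger0_norm; [exact: hrho|exact: posdef_psd (pP t t0) x].
pose S t := (Cm t)^T *m N *m Cm t.
pose dS t := (dC t)^T *m N *m Cm t + (Cm t)^T *m N *m dC t.
have hS (t : R) : 0 <= t -> is_derive t 1 S (dS t).
  move=> t0; apply: is_derive_eq.
    exact: is_derive_mulmx (is_derive_mulmx (is_derive_trmx (hC t t0)) (is_derive_cst N t (1 : R))) (hC t t0).
  by rewrite /dS mulmx0 addr0.
have sS t : (S t)^T = S t by rewrite /S !trmx_mul trmxK sN mulmxA.
have pS t : psd (S t).
  by move=> x; have := qform_congr N (Cm t)^T x; rewrite trmxK => ->; exact: posdef_psd.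
pose dP t := a t *m P t + P t *m (a t)^T + q%:M - P t *m S t *m P t.
pose M t := a t - P t *m S t.
pose Th t := da t *m P t + P t *m (da t)^T - P t *m dS t *m P t.
have hdP (t : R) : 0 <= t -> is_derive t 1 dP (M t *m dP t + dP t *m (M t)^T + Th t).
  move=> t0; apply: is_derive_eq.
    exact: is_deriveB (is_deriveD (is_deriveD (is_derive_mulmx (ha t t0) (hP t t0))
      (is_derive_mulmx (hP t t0) (is_derive_trmx (ha t t0)))) (is_derive_cst (q%:M : 'M[R]_r) t (1 : R)))
      (is_derive_mulmx (is_derive_mulmx (hP t t0) (hS t t0)) (hP t t0)).
  rewrite -/(S t) -/(dP t) /M /Th trmxD trmxN trmx_mul (sP t t0) sS.
  move: (S t) (dS t) (dP t) => St dSt D; mxring.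
have sdP t : 0 <= t -> (dP t)^T = dP t.
  by move=> t0; rewrite /dP; apply: riccati_field_sym; [exact: sP|exact: sS].
have [th th0 hth] : exists2 th, 0 <= th & forall t, 0 <= t -> forall x, `|qform (Th t) x| <= th * expR (- g * t) * qform 1%:M x.
  pose ds : R := p%:R * (p%:R * 1 * `|N|) * c + p%:R * (p%:R * c * `|N|) * 1.
  pose b := r%:R * c * (3 * rho) + r%:R * (3 * rho) * c + r%:R * (r%:R * (3 * rho) * (c * ds)) * (3 * rho).
  exists (r%:R ^+ 2 * b) => [|t t0 x].
    by rewrite /b /ds; rewrite ?(mulr_ge0, addr_ge0, exprn_ge0)// ltW.
  set ex := expR _; have ex0 : 0 <= ex by exact: expR_ge0.
  apply: le_trans (qform_norm_le _ _) _; rewrite ler_wpM2r ?qform1_ge0// -(mulrA _ b) ler_wpM2l ?exprn_ge0//.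
  have dab := hda t t0; have dCb := hdC t t0; rewrite -/ex in dab dCb.
  have Pbt := Pb t t0.
  have dSb : `|dS t| <= p%:R * (p%:R * (c * ex) * `|N|) * c + p%:R * (p%:R * c * `|N|) * (c * ex).
    apply: le_trans (ler_normD _ _) _; apply: lerD.
      apply: mx_norm_mul_le; last exact: bC.
      by apply: mx_norm_mul_le => //; rewrite mx_norm_tr.
    apply: mx_norm_mul_le => //; apply: mx_norm_mul_le => //; rewrite mx_norm_tr; exact: bC.
  rewrite /Th; apply: le_trans (ler_normB _ _) _.
  apply: le_trans (lerD (ler_normD _ _) (lexx _)) _.
  have b1 : `|da t *m P t| <= r%:R * (c * ex) * (3 * rho) by apply: mx_norm_mul_le.
  have b2 : `|P t *m (da t)^T| <= r%:R * (3 * rho) * (c * ex) by apply: mx_norm_mul_le => //; rewrite mx_norm_tr.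
  have b3 := mx_norm_mul_le (mx_norm_mul_le Pbt dSb) Pbt.
  apply: le_trans (lerD (lerD b1 b2) b3) _.
  by rewrite le_eqVlt /b /ds; apply/orP; left; apply/eqP; ring.
have [e0 e00 he0] := posdef_lower (pP 0 (lexx _)).
(* [kap <= g] lets [lam] decay no faster than [Th]; [kap rho <= q / 2] leaves half of [q] after
   subtracting [kap P]. *)
pose kap := Num.min g (q / (2 * rho)).
have kap0 : 0 < kap by rewrite /kap lt_min g0 divr_gt0// mulr_gt0.
have kapg : kap <= g by rewrite /kap ge_min lexx.
have kapq : kap * rho <= q / 2.
  have : kap <= q / (2 * rho) by rewrite /kap ge_min lexx orbT.
  rewrite ler_pdivlMr ?mulr_gt0//; lra.
(* The first summand makes [k q / 2] dominate the source bound [th], the second makes [k P(0)]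
   dominate both signs of [dP 0]. *)
pose k := 2 * th / q + (r%:R ^+ 2 * `|dP 0|) / e0.
have k1 : th <= k * (q / 2).
  have -> : k * (q / 2) = th + (r%:R ^+ 2 * `|dP 0|) / e0 * (q / 2) by rewrite /k; field; rewrite !gt_eqF.
  by rewrite lerDl !mulr_ge0// ?exprn_ge0// ?invr_ge0 ltW.
have k2 : r%:R ^+ 2 * `|dP 0| <= k * e0.
  have -> : k * e0 = 2 * th / q * e0 + r%:R ^+ 2 * `|dP 0| by rewrite /k; field; rewrite !gt_eqF.
  by rewrite lerDr !mulr_ge0// ?invr_ge0 ltW.
have k0 : 0 <= k.
  by rewrite /k addr_ge0// ?mulr_ge0// ?invr_ge0 ?exprn_ge0// ltW.
pose lam t := k * expR (- kap * t).
have lam0 t : 0 <= lam t by rewrite mulr_ge0// expR_ge0.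
have hlam (t : R) : is_derive t 1 lam (- kap * lam t).
  have := is_derive_mul (is_derive_cst k t (1 : R)) (is_derive_expZ (- kap) t).
  by rewrite mul0r add0r mulrCA.
have main (sg : R) : `|sg| = 1 -> forall t, 0 <= t -> psd (lam t *: P t + sg *: dP t).
  move=> sg1 t t0.
  apply: (@lyapunov_psd R r (fun s => lam s *: P s + sg *: dP s) M
    (fun s => lam s *: (q%:M + P s *m S s *m P s - kap *: P s) + sg *: Th s) 0 t t0).
  - move=> s /andP[s0 _].
    apply: is_derive_eq.
      exact: is_deriveD (is_derive_scale (hlam s) (hP s s0)) (is_deriveZ sg (hdP s s0)).
    rewrite -/(S s) /M trmxD trmxN trmx_mul (sP s s0) sS.
    move: (S s) (dP s) => Ss D; mxring.
  - move=> s /andP[s0 _]; apply: cvgB; first exact: is_derive_continuous (ha s s0).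
    apply: cvg_mulmx; first exact: is_derive_continuous (hP s s0).
    exact: is_derive_continuous (hS s s0).
  - move=> s /andP[s0 _] x.
    have q1 := qform1_ge0 x.
    rewrite qformD !qformZ qformB qformD qformZ.
    have -> : qform q%:M x = q * qform 1%:M x by rewrite -qformZ scalemx1.
    have h1 : 0 <= qform (P s *m S s *m P s) x.
      by rewrite -{2}(sP s s0) qform_congr; exact: pS.
    have h2 := hrho s s0 x.
    have h3 : - (th * expR (- g * s) * qform 1%:M x) <= sg * qform (Th s) x.
      rewrite lerNl; apply: le_trans (ler_norm _) _.
      by rewrite normrN normrM sg1 mul1r; exact: hth.
    have h4 : th * expR (- g * s) * qform 1%:M x <= lam s * (q / 2) * qform 1%:M x.
      rewrite ler_wpM2r// /lam mulrAC ler_pM ?expR_ge0//.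
      by rewrite ler_expR !mulNr lerN2 ler_wpM2r.
    have h5 : lam s * (q / 2 * qform 1%:M x) <= lam s * (q * qform 1%:M x + qform (P s *m S s *m P s) x - kap * qform (P s) x).
      rewrite ler_wpM2l//.
      have : kap * qform (P s) x <= kap * rho * qform 1%:M x.
        by rewrite -mulrA ler_wpM2l// ltW.
      have : kap * rho * qform 1%:M x <= q / 2 * qform 1%:M x by rewrite ler_wpM2r.
      lra.
    by rewrite mulrA in h5; lra.
  - move=> x; rewrite qformD !qformZ /lam mulr0 expR0 mulr1.
    have : - (sg * qform (dP 0) x) <= k * qform (P 0) x.
      apply: le_trans (ler_norm _) _; rewrite normrN normrM sg1 mul1r.
      apply: le_trans (qform_norm_le _ _) _.
      apply: (@le_trans _ _ (k * e0 * qform 1%:M x)); first by rewrite ler_wpM2r ?qform1_ge0.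
      by rewrite -mulrA ler_wpM2l.
    lra.
have dPlo t x : 0 <= t -> - (lam t * qform (P t) x) <= qform (dP t) x.
  move=> t0; have := main 1 (normr1 _) t t0 x.
  rewrite qformD !qformZ mul1r; lra.
have dPhi t x : 0 <= t -> qform (dP t) x <= lam t * qform (P t) x.
  move=> t0; have := main (-1) _ t t0 x; rewrite normrN1 => /(_ erefl).
  rewrite qformD !qformZ mulN1r; lra.
have dPb t : 0 <= t -> `|dP t| <= (3 * (k * rho)) * expR (- kap * t).
  move=> t0; have -> : 3 * (k * rho) * expR (- kap * t) = 3 * (lam t * rho) by rewrite /lam; ring.
  apply: qform_bound_norm; [by rewrite mulr_ge0// ltW|exact: sdP|move=> x].
  have : lam t * qform (P t) x <= lam t * rho * qform 1%:M x.
    by rewrite -mulrA ler_wpM2l// hrho.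
  have := dPlo t x t0; have := dPhi t x t0; rewrite ler_norml.
  by move=> h1 h2 h3; apply/andP; split; lra.
have [|Poo hPoo] := derive_mx_decay_cvg kap0 _ hP dPb.
  by rewrite !mulr_ge0// ltW.
exists Poo => //; split.
  have h1 : (P t)^T @[t --> +oo] --> Poo^T by exact: cvg_trmx.
  have h2 : (P t)^T @[t --> +oo] --> Poo.
    apply: cvg_trans hPoo; apply: near_eq_cvg; near=> t.
    by apply/esym/sP; near: t; exact: nbhs_pinfty_ge.
  exact: (cvg_unique _ h1 h2).
move=> x x0; rewrite -/(qform Poo x).
(* As [u' = lam], [exp(u)] is an integrating factor for [P' >= - lam P]. From [u 0 = - k / kap] and
   [u <= 0], the form of [P] stays above [exp(- k / kap)] times its initial value, and so does its
   limit. *)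
pose u t := - (k / kap) * expR (- kap * t).
have hu (t : R) : is_derive t 1 (fun t => expR (u t)) (expR (u t) * lam t).
  have h : is_derive t 1 u (lam t).
    have := is_derive_mul (is_derive_cst (- (k / kap)) t (1 : R)) (is_derive_expZ (- kap) t).
    rewrite mul0r add0r mulrA mulrNN divfK ?gt_eqF//.
  exact: (@is_derive1_comp _ expR u _ _ _ (is_derive_expR _) h).
have low t : 0 <= t -> qform (P 0) x * expR (- (k / kap)) <= qform (P t) x.
  move=> t0.
  have : qform (P 0) x * expR (u 0) <= qform (P t) x * expR (u t).
    apply: (@derive_ge0_le R (fun t => qform (P t) x * expR (u t))
      (fun t => qform (dP t) x * expR (u t) + qform (P t) x * (expR (u t) * lam t)) 0 t t0).
      move=> s /andP[s0 _].
      exact: is_derive_mul (is_derive_qform_cst x (hP s s0)) (hu s).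
    move=> s /andP[s0 _].
    have -> : qform (dP s) x * expR (u s) + qform (P s) x * (expR (u s) * lam s) =
      expR (u s) * (qform (dP s) x + lam s * qform (P s) x) by ring.
    rewrite mulr_ge0 ?expR_ge0//; have := dPlo s x s0; lra.
  rewrite {1}/u mulr0 expR0 mulr1 => h; apply: le_trans h _.
  rewrite ler_piMr//; first exact: posdef_psd (pP t t0) x.
  by rewrite -[leRHS]expR0 ler_expR /u mulNr oppr_le0 mulr_ge0 ?expR_ge0// divr_ge0// ltW.
have hq : qform (P t) x @[t --> +oo] --> qform Poo x.
  have : x^T *m P t *m x @[t --> +oo] --> x^T *m Poo *m x.
    by apply: cvg_mulmx; [apply: cvg_mulmx => //|]; exact: cvg_cst.
  by move=> /cvg_mxP; exact.
apply: (@lt_le_trans _ _ (qform (P 0) x * expR (- (k / kap)))).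
  have [_ p0] := pP 0 (lexx _); rewrite mulr_gt0 ?expR_gt0//; exact: p0.
rewrite -(cvg_lim _ hq)//; apply: limr_ge; first by apply: cvgP; exact: hq.
by near=> t; apply: low; near: t; exact: nbhs_pinfty_ge.
Unshelve. all: by end_near. Qed.

End riccati_convergence.

(** * The cascaded system *)

Section cascade.
Context {R : realType}.

(** The limit of [U] is [Ur] only up to a rotation; rotating the pair multiplies the observability
    matrix on the right by the invertible [O]. *)
Lemma observable_rot r p (F : 'M[R]_r) (K : 'M[R]_(p, r)) (O : 'M[R]_r) :
  O^T *m O = 1%:M -> observable F K -> observable (O^T *m F *m O) (K *m O).
Proof.
move=> sO; have sO' : O *m O^T = 1%:M by exact: mulmx1C.
have [uO _] := mulmx1_unit sO'.
rewrite /observable => obs; rewrite -[RHS]obs.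
have E i : (K *m O) *m (O^T *m F *m O) ^+ i = K *m F ^+ i *m O.
  elim: i => [|i IH]; first by rewrite !expr0 !mulmx1.
  rewrite exprSr -mulmxE mulmxA IH -!mulmxA (mulmxA O) sO' mul1mx.
  by rewrite exprSr -mulmxE !mulmxA.
under eq_mxcol do rewrite E.
by rewrite -mxcol_mul mxrankMfree// row_free_unit.
Qed.

Lemma norm_decay_cvg0 m n (f : R -> 'M[R]_(m, n)) (c g : R) : 0 < g ->
  (forall t : R, 0 <= t -> `|f t| <= c * expR (- g * t)) ->
  f t @[t --> +oo] --> (0 : 'M[R]_(m, n)).
Proof.
move=> g0 h.
have ce : (c * expR (- g * t)) @[t --> +oo] --> 0.
  by rewrite -(mulr0 c); apply: cvgM; [exact: cvg_cst|exact: expR_decay_cvg0].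
apply/cvgrPdist_le => e e0; move/cvgrPdist_le : ce => /(_ e e0) ce.
near=> t; rewrite sub0r normrN.
have t0 : 0 <= t by near: t; exact: nbhs_pinfty_ge.
apply: le_trans (h t t0) _; apply: le_trans (ler_norm _) _.
by rewrite -normrN -[- _]sub0r; near: t.
Unshelve. all: by end_near. Qed.

Lemma cascade_converges n r p q (mu : R) (A : 'M[R]_n) (C : 'M[R]_(p, n))
    (H : 'M[R]_(p, q)) (Ur U0 : 'M[R]_(n, r)) (S0 : 'M[R]_r) :
  (1 <= r)%N -> (r < n)%N -> 0 < mu -> H *m H^T \in unitmx -> A^T = A ->
  stiefel Ur -> spans_dominant_subspace A Ur ->
  observable (Ur^T *m A *m Ur) (C *m Ur) ->
  stiefel U0 -> Ur^T *m U0 \in unitmx -> posdef S0 ->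
  exists (U : R -> 'M[R]_(n, r)) (S : R -> 'M[R]_r),
    is_global_solution A C H mu U0 S0 U S /\
    exists (Uoo : 'M[R]_(n, r)) (Soo : 'M[R]_r),
      [/\ U t @[t --> +oo] --> Uoo, S t @[t --> +oo] --> Soo,
          stiefel Uoo, posdef Soo & spans_dominant_subspace A Uoo].
Proof.
move=> r1 rn mu0 uH sA sUr dom obs sU0 uU0 pS0.
have [W [G [W0 G0 hW hG]]] := oja_solution sA sU0.
pose U t := W t *m G t.
have sU t : stiefel (U t) by have [] := hG t.
have hU (t : R) : is_derive t 1 U (oja_field A (U t)) by have [] := hG t.
have U1 t : `|U t| <= 1 := stiefel_norm_le1 (sU t).
have cU : continuous U by move=> t; exact: is_derive_continuous (hU t).
have UU0 : U 0 = U0 by rewrite /U W0 G0 mulmx1.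
have [|c [g [g0 c0 hdU hUP]]] := oja_converges sA r1 rn sUr dom uU0 W0 G0 hW.
  by move=> t; have [] := hG t.
have {}hdU t : 0 <= t -> `|oja_field A (U t)| <= c * expR (- g * t) := hdU t.
have {}hUP t : 0 <= t -> `|U t - Ur *m (Ur^T *m U t)| <= c * expR (- g * t) := hUP t.
clearbody U.
pose N := invmx (H *m H^T).
have pN : posdef N.
  apply: posdef_inv; split; first by rewrite trmx_mul trmxK.
  move=> x x0.
  have -> : x^T *m (H *m H^T) *m x = (H^T *m x)^T *m 1%:M *m (H^T *m x).
    by rewrite mulmx1 trmx_mul trmxK !mulmxA.
  apply: qform1_gt0; apply: contra x0 => /eqP e.
  by rewrite -[x](mulKmx uH) -mulmxA e !mulmx0.
have [sN _] := pN.
pose a t := (U t)^T *m A *m U t.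
pose Cm t := C *m U t.
pose S t := (Cm t)^T *m N *m Cm t.
pose da t := (oja_field A (U t))^T *m A *m U t + (U t)^T *m A *m oja_field A (U t).
pose dC t := C *m oja_field A (U t).
have ha (t : R) : is_derive t 1 a (da t).
  apply: is_derive_eq.
    exact: is_derive_mulmx (is_derive_mulmx (is_derive_trmx (hU t)) (is_derive_cst A t (1 : R))) (hU t).
  by rewrite /da mulmx0 addr0.
have hC (t : R) : is_derive t 1 Cm (dC t).
  apply: is_derive_eq; first exact: is_derive_mulmx (is_derive_cst C t (1 : R)) (hU t).
  by rewrite mul0mx add0r.
have ca : continuous a by move=> t; exact: is_derive_continuous (ha t).
have cC : continuous Cm by move=> t; exact: is_derive_continuous (hC t).
have cS : continuous S.
  move=> t; apply: cvg_mulmx; last exact: cC.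
  by apply: cvg_mulmx; [apply: cvg_trmx; exact: cC|exact: cvg_cst].
have symC (M : 'M[R]_(p, r)) : (M^T *m N *m M)^T = M^T *m N *m M.
  by rewrite !trmx_mul trmxK sN mulmxA.
have sS t : (S t)^T = S t := symC (Cm t).
have pS t : psd (S t).
  by move=> x; have := qform_congr N (Cm t)^T x; rewrite trmxK => ->; exact: posdef_psd.
have q0 : 0 < mu ^+ 2 by rewrite exprn_gt0.
have [P P0 hP] := riccati_solution ca cS sS pS (ltW q0) pS0.
have rfE V Q : riccati_field A C H mu V Q = (V^T *m A *m V) *m Q + Q *m (V^T *m A *m V)^T
    + (mu ^+ 2)%:M - Q *m ((C *m V)^T *m N *m (C *m V)) *m Q.
  by rewrite /riccati_field /N !mulmxA.
exists U, P; split; first split => //.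
- move=> t t0 _; have [pPt dPt] := hP t t0; split=> //.
  by rewrite rfE.
- move=> T V Q hVQ V0 Q0 t t0 tT.
  have hs s : 0 <= s <= t -> 0 <= s /\ (s%:E < T)%E.
    by move=> /andP[s0 st]; split=> //; apply: le_lt_trans tT; rewrite lee_fin.
  (* The competing Riccati solution is driven by [V]; equality of the coefficients on all of
     [[0, t]] has to precede the comparison of the second components. *)
  have VU s : 0 <= s <= t -> V s = U s.
    move=> st; have [s0 sT] := hs s st.
    apply: (@oja_unique R n r A U V s s0).
    - by move=> u _; split.
    - move=> u /andP[u0 us]; have [_ uT] : 0 <= u /\ (u%:E < T)%E.
        by apply: hs; rewrite u0 (le_trans us)//; case/andP: st.
      by have [] := hVQ u u0 uT.
    - by rewrite UU0 V0.
  split; first by apply: VU; rewrite t0 lexx.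
  apply: (@riccati_unique R r a S P Q (mu ^+ 2) t t0).
  - by move=> s _; exact: ca.
  - by move=> s _; exact: cS.
  - by move=> s /andP[s0 _]; have [_] := hP s s0.
  - move=> s st; have [s0 sT] := hs s st; have [_ _ _ +] := hVQ s s0 sT.
    by rewrite rfE (VU s st).
  - by rewrite P0 Q0.
have [Uoo hUoo] := derive_mx_decay_cvg g0 c0 (fun t _ => hU t) hdU.
have sUoo : stiefel Uoo.
  have h1 : (U t)^T *m U t @[t --> +oo] --> Uoo^T *m Uoo.
    by apply: cvg_mulmx => //; exact: cvg_trmx.
  have h2 : (U t)^T *m U t @[t --> +oo] --> (1%:M : 'M[R]_r).
    have -> : (fun t => (U t)^T *m U t) = cst 1%:M by apply/funext => t; exact: sU.
    exact: cvg_cst.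
  exact: (cvg_unique _ h1 h2).
(* [U t] approaches its projection on the dominant subspace, so the limit is [Ur O] with [O]
   orthogonal. *)
pose O := Ur^T *m Uoo.
have UO : Uoo = Ur *m O.
  apply/eqP; rewrite -subr_eq0; apply/eqP.
  have h1 : U t - Ur *m (Ur^T *m U t) @[t --> +oo] --> Uoo - Ur *m O.
    apply: cvgB => //; apply: cvg_mulmx; first exact: cvg_cst.
    by apply: cvg_mulmx => //; exact: cvg_cst.
  have h2 : U t - Ur *m (Ur^T *m U t) @[t --> +oo] --> (0 : 'M[R]_(n, r)).
    exact: norm_decay_cvg0 g0 hUP.
  exact: (cvg_unique _ h1 h2).
clearbody O.
have sUr' : Ur^T *m Ur = 1%:M := sUr.
have sO : O^T *m O = 1%:M.
  have <- : Uoo^T *m Uoo = O^T *m O by rewrite UO trmx_mul mulmxA -(mulmxA O^T) sUr' mulmx1.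
  exact: sUoo.
have [uOT uO] := mulmx1_unit sO.
(* One constant for three bounds: the first two summands control [a'], the third [Cm'], the fourth
   [Cm]. *)
pose b : R := n%:R * (n%:R * c * `|A|) * 1 + n%:R * (n%:R * 1 * `|A|) * c + n%:R * `|C| * c + n%:R * `|C| * 1.
have [b1 b2 b3 b4] : [/\ 0 <= n%:R * (n%:R * c * `|A|) * 1 + n%:R * (n%:R * 1 * `|A|) * c, 0 <= n%:R * `|C| * c, 0 <= n%:R * `|C| * 1 & 0 <= b].
  by split; rewrite ?(addr_ge0, mulr_ge0).
have [Poo pPoo hPoo] : exists2 Poo : 'M[R]_r, posdef Poo & P t @[t --> +oo] --> Poo.
  apply: (@riccati_converges R r p a da P Cm dC (O^T *m (Ur^T *m A *m Ur) *m O) (C *m Ur *m O) N (mu ^+ 2) b g) => //.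
  - by rewrite !trmx_mul !trmxK sA !mulmxA.
  - exact: observable_rot.
  - move=> t t0; set ex := expR _; have ex0 : 0 <= ex := expR_ge0 _.
    have h := hdU t t0; rewrite -/ex in h.
    apply: (@le_trans _ _ ((n%:R * (n%:R * c * `|A|) * 1 + n%:R * (n%:R * 1 * `|A|) * c) * ex)); last first.
      by rewrite ler_wpM2r// /b -addrA lerDl addr_ge0.
    apply: (@le_trans _ _ (n%:R * (n%:R * (c * ex) * `|A|) * 1 + n%:R * (n%:R * 1 * `|A|) * (c * ex))).
      apply: le_trans (ler_normD _ _) _; apply: lerD.
        by apply: mx_norm_mul_le => //; apply: mx_norm_mul_le => //; rewrite mx_norm_tr.
      by apply: mx_norm_mul_le => //; apply: mx_norm_mul_le => //; rewrite mx_norm_tr.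
    by rewrite le_eqVlt; apply/orP; left; apply/eqP; ring.
  - move=> t t0; set ex := expR _; have ex0 : 0 <= ex := expR_ge0 _.
    have h := hdU t t0; rewrite -/ex in h.
    apply: le_trans (mx_norm_mul_le (lexx _) h) _; rewrite mulrA ler_wpM2r//.
    by rewrite /b; lra.
  - move=> t _; apply: le_trans (mx_norm_mul_le (lexx _) (U1 t)) _.
    by rewrite /b; lra.
  - have -> : O^T *m (Ur^T *m A *m Ur) *m O = Uoo^T *m A *m Uoo.
      by rewrite UO trmx_mul !mulmxA.
    apply: cvg_mulmx => //; apply: cvg_mulmx; last exact: cvg_cst.
    exact: cvg_trmx.
  - by rewrite -mulmxA -UO; apply: cvg_mulmx => //; exact: cvg_cst.
  - by move=> t t0; have [] := hP t t0.
  - by move=> t t0; have [_] := hP t t0.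
exists Uoo, Poo; split => //.
by rewrite UO; exact: spans_dominant_rot.
Qed.

End cascade.

(** * Null sets of the Stiefel manifold *)

Section hausdorff_null.
Context {R : realType}.

(* [E] is the image of a bounded part of [R^m] by a Lipschitz map, given as a
   relation. *)
Definition lipschitz_piece (m a b : nat) (E : set 'M[R]_(a, b)) : Prop :=
  exists (D : 'rV[R]_m -> 'M[R]_(a, b) -> Prop) (K L : R),
  [/\ forall U, E U -> exists x, D x U,
      forall x U, D x U -> `|x| <= K &
      forall x U y V, D x U -> D y V -> `|U - V| <= L * `|x - y| ].

(** Countably many pieces are allowed because normalising a vector is Lipschitz only away from 0. *)
Definition thin (m a b : nat) (E : set 'M[R]_(a, b)) : Prop :=
  exists2 F : nat -> set 'M[R]_(a, b),
    forall k, lipschitz_piece m (F k) & E `<=` \bigcup_k F k.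

Lemma diam_ge0 a b (E : set 'M[R]_(a, b)) : (0 <= diam E)%E.
Proof. by rewrite /diam le_max lexx. Qed.

Lemma frobenius_dist_le a b (X Y : 'M[R]_(a, b)) :
  frobenius_dist X Y <= (a * b).+1%:R * `|X - Y|.
Proof.
rewrite /frobenius_dist; set Z := X - Y.
rewrite -(ger0_norm (mulr_ge0 (ler0n _ _) (normr_ge0 Z))) -sqrtr_sqr ler_sqrt ?sqr_ge0//.
apply: (@le_trans _ _ ((a * b)%:R * `|Z| ^+ 2)).
  rewrite /mxtrace.
  apply: (@le_trans _ _ (\sum_(j < b) \sum_(i < a) `|Z| ^+ 2)).
    apply: ler_sum => j _; rewrite mxE; apply: ler_sum => i _.
    rewrite mxE -expr2 -(real_normK (num_real (Z i j))).
    by rewrite lerXn2r ?nnegrE// le_mx_norm.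
  by rewrite !sumr_const !card_ord -mulrnA mulr_natl.
rewrite exprMn ler_wpM2r ?sqr_ge0//.
by rewrite -natrX ler_nat (@leq_trans (a * b).+1)// -[X in (X <= _)%N]expn1 leq_pexp2l.
Qed.

Lemma diam_le a b (E : set 'M[R]_(a, b)) (e : R) : 0 <= e ->
  (forall U V, E U -> E V -> `|U - V| <= e) -> (diam E <= ((a * b).+1%:R * e)%:E)%E.
Proof.
move=> e0 h; rewrite /diam ge_max lee_fin mulr_ge0//=.
apply: ge_ereal_sup => _ [U EU [V EV <-]]; rewrite lee_fin.
by apply: le_trans (frobenius_dist_le _ _) _; rewrite ler_wpM2l// h.
Qed.

Lemma expe_le (x : \bar R) (e : R) d : (0 <= x)%E -> (x <= e%:E)%E ->
  (x ^+ d <= (e ^+ d)%:E)%E.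
Proof.
case: x => [x| |]//=; rewrite !lee_fin => x0 xe.
by rewrite -EFin_expe lee_fin lerXn2r// nnegrE// (le_trans x0).
Qed.

Lemma diam0_le a b : (diam (@set0 'M[R]_(a, b)) <= (0%:E : \bar R))%E.
Proof. by rewrite -(mulr0 (a * b).+1%:R); apply: diam_le. Qed.

Lemma sum_if_lt (c : R) (N T : nat) :
  \sum_(0 <= l < N) (if (l < T)%N then c else 0) = (minn N T)%:R * c.
Proof.
elim: N => [|N IH]; first by rewrite big_geq// min0n mul0r.
rewrite big_nat_recr//= IH; case: ltnP => NT.
  by rewrite (minn_idPl NT) -natr1 mulrDl mul1r.
by rewrite (minn_idPr (leqW NT)) addr0.
Qed.

(** The parameters lie in a cube of side [2 k0]. A mesh [1 / k] cuts it into at most [(3 k0 k)^m]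
    cells, whose images have diameter at most [C / k]; the sum of [d]-th powers is at most
    [M k^(m - d) <= M / k]. *)
Lemma piece_cover m d a b (E : set 'M[R]_(a, b)) (delta eta : R) :
  lipschitz_piece m E -> (m < d)%N -> 0 < delta -> 0 < eta ->
  exists G : nat -> set 'M[R]_(a, b), [/\ E `<=` \bigcup_l G l,
    forall l, (diam (G l) <= delta%:E)%E &
    (\sum_(0 <= l <oo) diam (G l) ^+ d <= eta%:E)%E].
Proof.
move=> [D [K [L [DE DK DL]]]] md dl0 eta0.
pose k0 := (Num.truncn `|K|).+1.
have Kk : K <= k0%:R by rewrite (le_trans (ler_norm _))// ltW// truncnS_gt.
pose C : R := (a * b).+1%:R * `|L|.
have C0 : 0 <= C by rewrite mulr_ge0.
pose M : R := (3 * k0)%:R ^+ m * C ^+ d.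
have M0 : 0 <= M by rewrite mulr_ge0// exprn_ge0.
(* One mesh for two demands: [C / k <= delta] for the diameters and [M / k <= eta] for the sum. *)
pose k := (Num.truncn (C / delta + M / eta)).+1.
have kgt : C / delta + M / eta < k%:R by exact: truncnS_gt.
have kR : (0 : R) < k%:R by rewrite ltr0n.
have Cd : C / k%:R <= delta.
  rewrite ler_pdivrMr// mulrC -ler_pdivrMr//; apply: ltW; apply: le_lt_trans kgt.
  by rewrite lerDl divr_ge0// ltW.
have Me : M / k%:R <= eta.
  rewrite ler_pdivrMr// mulrC -ler_pdivrMr//; apply: ltW; apply: le_lt_trans kgt.
  by rewrite lerDr divr_ge0// ltW.
pose q := (2 * k0 * k)%N.
pose T : finType := {ffun 'I_m -> 'I_q.+1}.
pose idx (x : 'rV[R]_m) i := Num.truncn ((x 0 i + k0%:R) * k%:R).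
pose cell (c : T) := [set U | exists2 x, D x U & forall i, idx x i = c i].
pose c0 : T := [ffun _ => ord0].
pose G l := if (l < #|T|)%N then cell (nth c0 (enum T) l) else set0.
have xk x U : D x U -> forall i, 0 <= (x 0 i + k0%:R) * k%:R.
  move=> /DK xK i; rewrite mulr_ge0//.
  have := le_trans (le_mx_norm x 0 i) (le_trans xK Kk).
  by rewrite ler_norml => /andP[+ _]; rewrite -subr_ge0 opprK.
have cell_diam c : (diam (cell c) <= (C / k%:R)%:E)%E.
  rewrite /C -mulrA; apply: diam_le; first by rewrite divr_ge0.
  move=> U V [x DxU xc] [y DyV yc].
  apply: le_trans (DL _ _ _ _ DxU DyV) _.
  apply: (@le_trans _ _ (`|L| * `|x - y|)); first by rewrite ler_wpM2r// ler_norm.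
  rewrite ler_wpM2l//; apply/mx_normP => [|i j]; first by rewrite invr_ge0.
  rewrite (ord1 i) !mxE.
  have := truncn_itv (xk _ _ DxU j); have := truncn_itv (xk _ _ DyV j).
  rewrite -/(idx x j) -/(idx y j) xc yc => /andP[h1 h2] /andP[h3 h4].
  rewrite -(ler_pM2r kR) mulVf ?gt_eqF//.
  rewrite -[X in _ * X <= _](ger0_norm (ltW kR)) -normrM.
  move: h1 h2 h3 h4; rewrite -natr1 => h1 h2 h3 h4.
  by rewrite ler_norml; apply/andP; split; lra.
have cov : E `<=` \bigcup_l G l.
  move=> U /DE[x DxU].
  have hi i : (idx x i <= q)%N.
    rewrite -(ler_nat R); apply: le_trans (_ : (x 0 i + k0%:R) * k%:R <= _).
      by have /andP[] := truncn_itv (xk _ _ DxU i).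
    rewrite /q natrM ler_wpM2r// natrM mulr_natl mulr2n lerD2r.
    by apply: le_trans Kk; apply: le_trans (DK _ _ DxU); apply: le_trans (ler_norm _) (le_mx_norm _ _ _).
  pose c : T := [ffun i => inord (idx x i)].
  have ct : (index c (enum T) < #|T|)%N by rewrite cardT index_mem mem_enum.
  exists (index c (enum T)) => //; rewrite /G ct nth_index ?mem_enum//.
  by exists x => // i; rewrite ffunE inordK// ltnS hi.
have Gd l : (diam (G l) <= (C / k%:R)%:E)%E.
  rewrite /G; case: ifP => // _; apply: le_trans (diam0_le _ _) _.
  by rewrite lee_fin divr_ge0.
exists G; split => // [l|]; first by apply: le_trans (Gd l) _; rewrite lee_fin.
(* The finite cover is padded with empty sets, each costing [0 ^ d], which is 0 for positive [d]
   only. *)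
have d0 : (0 < d)%N by exact: leq_ltn_trans md.
have Gp l : (diam (G l) ^+ d <= ((if (l < #|T|)%N then (C / k%:R) ^+ d else 0))%:E)%E.
  have [lT|lT] := ltnP l #|T|; first by apply: expe_le; [exact: diam_ge0|exact: Gd].
  rewrite /G ltnNge lT/=; have := expe_le d (diam_ge0 set0) (diam0_le a b).
  by rewrite expr0n gtn_eqF.
have G0 l : (0 <= diam (G l) ^+ d)%E by apply: expe_ge0; exact: diam_ge0.
apply: lime_le; first by apply: is_cvg_nneseries => l _ _; exact: G0.
apply: nearW => N.
apply: (@le_trans _ _ (\sum_(0 <= l < N) (if (l < #|T|)%N then (C / k%:R) ^+ d else 0)%:E)%E).
  by apply: lee_sum => l _; exact: Gp.
rewrite sumEFin lee_fin sum_if_lt.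
apply: (@le_trans _ _ (#|T|%:R * (C / k%:R) ^+ d)).
  by rewrite ler_wpM2r ?exprn_ge0 ?divr_ge0// ler_nat geq_minr.
apply: le_trans Me; rewrite card_ffun !card_ord natrX expr_div_n.
apply: (@le_trans _ _ ((3 * k0 * k)%:R ^+ m * (C ^+ d / k%:R ^+ d))).
  rewrite ler_wpM2r ?divr_ge0 ?exprn_ge0// lerXn2r ?nnegrE// ler_nat /q.
  have : (1 * 1 <= k0 * k)%N by apply: leq_mul.
  by rewrite -!mulnA; lia.
rewrite natrM exprMn /M.
have -> : (3 * k0)%:R ^+ m * k%:R ^+ m * (C ^+ d / k%:R ^+ d) = ((3 * k0)%:R ^+ m * C ^+ d) * (k%:R ^+ m / k%:R ^+ d) by ring.
rewrite ler_wpM2l// ler_pdivrMr ?exprn_gt0// mulrC ler_pdivlMr// -exprSr.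
by rewrite ler_weXn2l// ler1n.
Qed.

(** Piece [k] gets the budget [eta / 2^(k+1)], and the doubly indexed cover is enumerated along a
    bijection between [nat] and pairs. *)
Lemma hausdorff_thin m d a b (E : set 'M[R]_(a, b)) : thin m E -> (m < d)%N ->
  hausdorff_measure d E = 0%E.
Proof.
move=> [F pF EF] md.
have d0 : (0 < d)%N by exact: leq_ltn_trans md.
have sum_ge0 (G : nat -> set 'M[R]_(a, b)) : (0 <= \sum_(0 <= l <oo) diam (G l) ^+ d)%E.
  by apply: nneseries_ge0 => l _ _; apply: expe_ge0; exact: diam_ge0.
have pre0 delta : 0 < delta -> (hausdorff_premeasure d delta E <= 0)%E.
  move=> delta0; apply/lee_addgt0Pr => eta eta0; rewrite add0e.
  have /choice[G hG] : forall k, exists G : nat -> set 'M[R]_(a, b),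
      [/\ F k `<=` \bigcup_l G l, forall l, (diam (G l) <= delta%:E)%E &
      (\sum_(0 <= l <oo) diam (G l) ^+ d <= (eta / (2 ^ k.+1)%:R)%:E)%E].
    move=> k; apply: piece_cover => //.
    by rewrite divr_gt0// ltr0n expn_gt0.
  have /card_esym/ppcard_eqP[f] := card_nat2.
  pose aa (p : nat * nat) := (diam (G p.1 p.2) ^+ d)%E.
  have aa0 p : (0 <= aa p)%E by apply: expe_ge0; exact: diam_ge0.
  apply: (@le_trans _ _ (\sum_(0 <= j <oo) aa (f j))%E).
    apply: ereal_inf_lbound; exists (fun j => G (f j).1 (f j).2) => //; split.
      move=> U /EF[k _ FU]; have [hk _ _] := hG k; have [l _ GU] := hk _ FU.
      by exists (f^-1%FUN (k, l)) => //=; rewrite invK ?inE.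
    by move=> j; have [_ + _] := hG (f j).1; exact.
  rewrite nneseries_esumT// -(@reindex_esum _ _ _ setT setT f aa); last exact: bij.
  rewrite [X in esum X _](_ : _ = [set: nat] `*`` (fun _ => [set: nat])); last first.
    by apply/seteqP; split => // -[].
  rewrite -(@esum_esum R nat nat setT (fun _ => setT) (fun i j => aa (i, j)))//.
  rewrite -nneseries_esumT; last by move=> k; apply: esum_ge0.
  apply: le_trans (epsilon_trick0 xpredT (ltW eta0)).
  apply: lee_nneseries => [k _ _|k _]; first exact: esum_ge0.
  rewrite -nneseries_esumT//.
  by have [_ _] := hG k.
apply/eqP; rewrite eq_le; apply/andP; split.
  by apply: ge_ereal_sup => _ [delta delta0 <-]; exact: pre0.
apply: le_trans (_ : (0 <= hausdorff_premeasure d 1 E)%E) _.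
  by apply: le_ereal_inf_tmp => _ [G _ <-].
by apply: ereal_sup_ubound; exists 1 => //=.
Qed.

End hausdorff_null.

(** * Operations on thin sets and extension by a column *)

Section thin_sets.
Context {R : realType}.

Lemma thin_sub m a b (E E' : set 'M[R]_(a, b)) : E' `<=` E -> thin m E -> thin m E'.
Proof. by move=> EE [F pF EF]; exists F => // U /EE/EF. Qed.

Lemma lipschitz_piece0 m a b : lipschitz_piece m (@set0 'M[R]_(a, b)).
Proof. by exists (fun _ _ => False), 0, 0. Qed.

Lemma thin_bigcup (I : countType) m a b (E : I -> set 'M[R]_(a, b)) :
  (forall i, thin m (E i)) -> thin m (\bigcup_i E i).
Proof.
move=> tE; have /choice[G hG] : forall i, exists G : nat -> set 'M[R]_(a, b),
    (forall k, lipschitz_piece m (G k)) /\ E i `<=` \bigcup_k G k.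
  by move=> i; have [G h1 h2] := tE i; exists G.
pose F j := if unpickle j is Some p then G p.1 p.2 else set0.
exists F => [j|U [i _ /((hG i).2)[k _ GU]]].
  by rewrite /F; case: unpickle => [p|]; [apply: (hG p.1).1|exact: lipschitz_piece0].
by exists (pickle (i, k)) => //; rewrite /F pickleK.
Qed.

Lemma thin_image m a b a' b' (E : set 'M[R]_(a, b)) (f : 'M[R]_(a, b) -> 'M[R]_(a', b')) :
  (forall U V, `|f U - f V| <= `|U - V|) -> thin m E -> thin m (f @` E).
Proof.
move=> fL [F pF EF]; exists (fun k => f @` F k) => [k|_ [U /EF[k _ FU] <-]]; last first.
  by exists k => //; exists U.
have [D [K [L [DE DK DL]]]] := pF k.
exists (fun x V => exists2 U, D x U & V = f U), K, L; split.
- by move=> _ [U /DE[x DxU] <-]; exists x, U.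
- by move=> x V [U xU _]; exact: DK xU.
- by move=> x _ y _ [U xU ->] [V yV ->]; apply: le_trans (fL _ _) (DL _ _ _ _ xU yV).
Qed.

Lemma mx_norm_lsubmx a m1 m2 (z : 'M[R]_(a, m1 + m2)) : `|lsubmx z| <= `|z|.
Proof. by apply/mx_normP => // i j; rewrite mxE le_mx_norm. Qed.

Lemma mx_norm_rsubmx a m1 m2 (z : 'M[R]_(a, m1 + m2)) : `|rsubmx z| <= `|z|.
Proof. by apply/mx_normP => // i j; rewrite mxE le_mx_norm. Qed.

Lemma mx_norm_row_mx_le a m1 m2 (x : 'M[R]_(a, m1)) (y : 'M[R]_(a, m2)) :
  `|row_mx x y| <= `|x| + `|y|.
Proof.
apply/mx_normP => [|i j]; first exact: addr_ge0.
rewrite mxE; case: fintype.split => k; apply: le_trans (le_mx_norm _ _ _) _.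
  by rewrite lerDl.
by rewrite lerDr.
Qed.

(** Dimensions add: the parameters of [Y] and the vector [x] are concatenated into one row, and [K]
    keeps the pieces bounded. *)
Lemma thin_param m1 m2 a b a' b' (E : set 'M[R]_(a, b))
    (Q : 'M[R]_(a, b) -> 'rV[R]_m2 -> 'M[R]_(a', b') -> Prop) (K L : R) :
  thin m1 E -> (forall Y x V, Q Y x V -> E Y /\ `|x| <= K) ->
  (forall Y x V Y' x' V', Q Y x V -> Q Y' x' V' ->
     `|V - V'| <= L * (`|Y - Y'| + `|x - x'|)) ->
  thin (m1 + m2) [set V | exists Y x, Q Y x V].
Proof.
move=> [F pF EF] QK QL.
exists (fun k => [set V | exists Y x, F k Y /\ Q Y x V]) => [k|V [Y [x QV]]]; last first.
  by have [/EF[k _ FY] _] := QK _ _ _ QV; exists k => //; exists Y, x.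
have [D [K1 [L1 [DE DK DL]]]] := pF k.
exists (fun (z : 'rV_(m1 + m2)) V => exists2 Y, D (lsubmx z) Y & Q Y (rsubmx z) V),
  (K1 + K), (`|L| * (`|L1| + 1)).
split.
- move=> V [Y [x [/DE[y Dy] QV]]]; exists (row_mx y x), Y.
    by rewrite row_mxKl.
  by rewrite row_mxKr.
- move=> z V [Y /DK h1 /QK[_ h2]].
  by rewrite -(hsubmxK z); apply: le_trans (mx_norm_row_mx_le _ _) (lerD h1 h2).
- move=> z V z' V' [Y DY QV] [Y' DY' QV'].
  apply: le_trans (QL _ _ _ _ _ _ QV QV') _.
  apply: (@le_trans _ _ (`|L| * (`|Y - Y'| + `|rsubmx z - rsubmx z'|))).
    by rewrite ler_wpM2r ?ler_norm// addr_ge0.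
  rewrite -mulrA ler_wpM2l// mulrDl mul1r lerD//.
    apply: le_trans (DL _ _ _ _ DY DY') _.
    apply: (@le_trans _ _ (`|L1| * `|lsubmx z - lsubmx z'|)).
      by rewrite ler_wpM2r ?ler_norm.
    by rewrite ler_wpM2l// -raddfB mx_norm_lsubmx.
  by rewrite -raddfB mx_norm_rsubmx.
Qed.

Definition enorm n (x : 'cV[R]_n) : R := Num.sqrt (qform 1%:M x).

Lemma mx_norm_le_enorm n (x : 'cV[R]_n) : `|x| <= enorm x.
Proof.
rewrite -(@ler_pXn2r _ 2)// ?nnegrE ?sqrtr_ge0// sqr_sqrtr ?qform1_ge0//.
exact: norm_sqr_le_qform1.
Qed.

(** Multiplied by [enorm x + enorm y], the claim becomes one on a difference of squares, which is
    factored coordinate by coordinate. *)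
Lemma enorm_dist_le n (x y : 'cV[R]_n) : `|enorm x - enorm y| <= n%:R * `|x - y|.
Proof.
have [s0|s0] := eqVneq (enorm x + enorm y) 0.
  have [x0 y0] : enorm x = 0 /\ enorm y = 0.
    have := sqrtr_ge0 (qform 1%:M x); have := sqrtr_ge0 (qform 1%:M y).
    by rewrite -/(enorm x) -/(enorm y) => h1 h2; split; lra.
  by rewrite x0 y0 subrr normr0 mulr_ge0.
have sp : 0 < enorm x + enorm y by rewrite lt_def s0 addr_ge0// sqrtr_ge0.
rewrite -(ler_pM2r sp) -{1}(ger0_norm (ltW sp)) -normrM -subr_sqr.
rewrite !sqr_sqrtr ?qform1_ge0// !qform1 -sumrB.
apply: le_trans (ler_norm_sum _ _ _) _.
apply: (@le_trans _ _ (\sum_(i < n) `|x - y| * (enorm x + enorm y))).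
  apply: ler_sum => i _; rewrite subr_sqr normrM ler_pM//.
    by have := le_mx_norm (x - y) i 0; rewrite !mxE.
  apply: le_trans (ler_normD _ _) _.
  by apply: lerD; apply: le_trans (le_mx_norm _ _ _) (mx_norm_le_enorm _).
by rewrite sumr_const card_ord -mulrA mulr_natl.
Qed.

Lemma normalize_dist_le n (x y : 'cV[R]_n) (e : R) : 0 < e -> e <= enorm x -> e <= enorm y ->
  `|(enorm x)^-1 *: x - (enorm y)^-1 *: y| <= e^-1 * (1 + n%:R) * `|x - y|.
Proof.
move=> e0 ex ey; have x0 := lt_le_trans e0 ex; have y0 := lt_le_trans e0 ey.
have xe : (enorm x)^-1 <= e^-1 by rewrite lef_pV2.
have xi : 0 <= (enorm x)^-1 by rewrite invr_ge0 ltW.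
have yi : 0 <= (enorm y)^-1 by rewrite invr_ge0 ltW.
have -> : (enorm x)^-1 *: x - (enorm y)^-1 *: y =
    (enorm x)^-1 *: (x - y) + ((enorm x)^-1 * (enorm y)^-1 * (enorm y - enorm x)) *: y.
  apply/colP => i; rewrite !mxE; field.
  by rewrite !gt_eqF.
apply: le_trans (ler_normD _ _) _.
rewrite [in leRHS]mulrDr mulr1 mulrDl; apply: lerD; rewrite !normrZ.
  by rewrite (ger0_norm xi) ler_wpM2r.
rewrite (ger0_norm xi) (ger0_norm yi).
rewrite -!mulrA; apply: ler_pM => //; first by rewrite !mulr_ge0.
apply: (@le_trans _ _ ((enorm y)^-1 * (n%:R * `|x - y| * enorm y))); last first.
  by rewrite mulrC mulfK ?gt_eqF.
rewrite ler_wpM2l//; apply: ler_pM => //; last exact: mx_norm_le_enorm.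
by rewrite distrC (le_trans (enorm_dist_le _ _)).
Qed.

Lemma stiefel_projector_dist_le n k (Y Y' : 'M[R]_(n, k)) : stiefel Y -> stiefel Y' ->
  `|Y *m Y^T - Y' *m Y'^T| <= 2 * k%:R * `|Y - Y'|.
Proof.
move=> /stiefel_norm_le1 Y1 /stiefel_norm_le1 Y1'.
have -> : Y *m Y^T - Y' *m Y'^T = Y *m (Y - Y')^T + (Y - Y') *m Y'^T.
  by rewrite linearB/= mulmxBr mulmxBl addrA subrK.
apply: le_trans (ler_normD _ _) _.
have -> : 2 * k%:R * `|Y - Y'| = k%:R * 1 * `|Y - Y'| + k%:R * `|Y - Y'| * 1 by ring.
by apply: lerD; apply: mx_norm_mul_le => //; rewrite mx_norm_tr.
Qed.

(* The line spanned by the new column is parametrised by the affine chart [c + B z]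
   of a projective space of dimension [m2]; the factor [1 - Y Y^T] makes the
   column orthogonal to the columns of [Y]. *)
Lemma thin_ext n k m1 m2 (E : set 'M[R]_(n, k)) (c : 'cV[R]_n) (B : 'M[R]_(n, m2)) :
  E `<=` stiefel (r := k) -> thin m1 E ->
  thin (m1 + m2) [set V : 'M[R]_(n, 1 + k) | exists Y u (z : 'rV[R]_m2) s,
    [/\ E Y, qform 1%:M u = 1, u = s *: ((1%:M - Y *m Y^T) *m (c + B *m z^T)) &
        V = row_mx u Y]].
Proof.
move=> Es tE.
pose h (Y : 'M[R]_(n, k)) (z : 'rV[R]_m2) := (1%:M - Y *m Y^T) *m (c + B *m z^T).
(* The condition [|u| = 1] fixes [s] up to sign. The index consists of this sign and of a level that
   bounds [z] and keeps [h] away from 0; at a fixed level, normalisation is Lipschitz. *)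
pose Q (i : bool * nat) Y z V := [/\ E Y, `|z| <= i.2%:R, (i.2.+1%:R)^-1 <= enorm (h Y z) &
  V = row_mx ((-1) ^+ i.1 *: ((enorm (h Y z))^-1 *: h Y z)) Y].
apply: (@thin_sub _ _ _ (\bigcup_(i : bool * nat) [set V | exists Y z, Q i Y z V])).
  move=> V [Y [u [z [s [EY u1 us ->]]]]].
  rewrite -/(h Y z) in us.
  have e0 : 0 < enorm (h Y z).
    rewrite lt_def sqrtr_ge0 andbT; apply/eqP => e0.
    have := sqr_sqrtr (qform1_ge0 (h Y z)); rewrite -/(enorm _) e0 expr0n => q0.
    by move: u1; rewrite us qformZx -q0/= mulr0 => /esym/eqP; rewrite oner_eq0.
  have sE : `|s| = (enorm (h Y z))^-1.
    have hh : (`|s| * enorm (h Y z)) ^+ 2 = 1.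
      by rewrite exprMn real_normK ?num_real// sqr_sqrtr ?qform1_ge0// -qformZx -us.
    have /eqP := hh; rewrite sqrf_eq1 => /orP[/eqP h1|/eqP h1].
      by rewrite -[LHS]mulr1 -(@divff _ (enorm (h Y z))) ?gt_eqF// mulrA h1 mul1r.
    have : 0 <= `|s| * enorm (h Y z) by rewrite mulr_ge0// ltW.
    by rewrite h1 oppr_ge0 ler10.
  pose M := Num.truncn (`|z| + (enorm (h Y z))^-1).
  have hM : `|z| + (enorm (h Y z))^-1 < M.+1%:R by exact: truncnS_gt.
  have ei : 0 < (enorm (h Y z))^-1 by rewrite invr_gt0.
  exists (s < 0, M.+1) => //; exists Y, z; split => //=.
  - by have := normr_ge0 z; lra.
  - rewrite -[leRHS]invrK lef_pV2 ?posrE ?ltr0n//.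
    by have := normr_ge0 z; rewrite -natr1; lra.
  - by rewrite us {1}[s]numEsign scalerA sE.
apply: thin_bigcup => -[sg M].
pose K := `|c| + m2%:R * `|B| * M%:R.
(* The summands are Lipschitz constants of [h] in [z] and in [Y]; [K] bounds [c + B z^T]. *)
pose L := n%:R * (1 + k%:R) * (m2%:R * `|B|) + n%:R * (2 * k%:R) * K.
pose L2 := (M.+1%:R^-1)^-1 * (1 + n%:R) * L + 1.
have K0 : 0 <= K by rewrite addr_ge0// !mulr_ge0.
have t1 : 0 <= n%:R * (1 + k%:R) * (m2%:R * `|B|) by rewrite !mulr_ge0// addr_ge0.
have t2 : 0 <= n%:R * (2 * k%:R) * K by rewrite !mulr_ge0.
apply: (@thin_param _ _ _ _ _ _ E (Q (sg, M)) M%:R L2) => //.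
  by move=> Y x V [].
move=> Y z V Y' z' V' [EY zM eY ->] [EY' zM' eY' ->].
have hh : `|h Y z - h Y' z'| <= L * (`|Y - Y'| + `|z - z'|).
  have -> : h Y z - h Y' z' = (1%:M - Y *m Y^T) *m (B *m (z - z')^T)
      - (Y *m Y^T - Y' *m Y'^T) *m (c + B *m z'^T).
    have -> : B *m (z - z')^T = (c + B *m z^T) - (c + B *m z'^T).
      by rewrite linearB/= mulmxBr opprD addrACA subrr add0r.
    rewrite /h; move: (c + B *m z^T) (c + B *m z'^T) (Y *m Y^T) (Y' *m Y'^T) => x y P P'.
    by rewrite mulmxBr -addrA -opprD -mulmxDl addrA subrK.
  apply: le_trans (ler_normB _ _) _.
  apply: (@le_trans _ _ (n%:R * (1 + k%:R) * (m2%:R * `|B| * `|z - z'|) +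
     n%:R * (2 * k%:R * `|Y - Y'|) * K)); last first.
    rewrite /L.
    have := mulr_ge0 t1 (normr_ge0 (Y - Y')); have := mulr_ge0 t2 (normr_ge0 (z - z')).
    lra.
  apply: lerD; apply: mx_norm_mul_le.
  - apply: le_trans (ler_normB _ _) _; apply: lerD.
      apply/mx_normP => // i j; rewrite !mxE.
      by case: (i == j); rewrite ?normr1 ?normr0.
    have := stiefel_norm_le1 (Es _ EY) => Y1.
    rewrite -[leRHS]mulr1 -[X in X * _]mulr1.
    by apply: mx_norm_mul_le => //; rewrite mx_norm_tr.
  - by apply: mx_norm_mul_le => //; rewrite mx_norm_tr.
  - by apply: stiefel_projector_dist_le; exact: Es.
  - apply: le_trans (ler_normD _ _) _; rewrite lerD2l.
    by apply: mx_norm_mul_le => //; rewrite mx_norm_tr.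
rewrite opp_row_mx add_row_mx.
apply: le_trans (mx_norm_row_mx_le _ _) _.
rewrite /L2 mulrDl mul1r; apply: lerD; last by rewrite lerDl.
rewrite -scalerBr normrZ normrX normrN1 expr1n mul1r.
apply: le_trans (normalize_dist_le _ eY eY') _; first by rewrite invr_gt0 ltr0n.
rewrite -[leRHS]mulrA; exact: ler_wpM2l.
Qed.

End thin_sets.

(** * Dimension of the Stiefel manifold and of the singular locus *)

Section stiefel_sets.
Context {R : realType}.

Lemma mulmx_col_col' n k (M : 'M[R]_(n, k.+1)) (j : 'I_k.+1) (x : 'cV[R]_k.+1) :
  M *m x = x j 0 *: col j M + col' j M *m row' j x.
Proof.
apply/colP => i; rewrite !mxE (bigD1_ord j)//= mulrC; congr +%R.
by apply: eq_bigr => l _; rewrite !mxE.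
Qed.

(** A scalar factor of [x] is absorbed by the normalisation of [u]. Dividing by a nonzero coordinate
    [i] puts the line of [x] in an affine chart, of dimension one less than the number of columns of
    [B]. *)
Lemma thin_ext_range n k m1 m2 (E : set 'M[R]_(n, k)) (B : 'M[R]_(n, m2.+1)) :
  E `<=` stiefel (r := k) -> thin m1 E ->
  thin (m1 + m2) [set V : 'M[R]_(n, 1 + k) | exists Y u x,
    [/\ E Y, qform 1%:M u = 1, u = (1%:M - Y *m Y^T) *m (B *m x) & V = row_mx u Y]].
Proof.
move=> Es tE.
have tB i := thin_ext (col i B) (col' i B) Es tE.
apply: thin_sub (thin_bigcup tB) => V [Y [u [x [EY u1 ux ->]]]].
have /cV0Pn[i xi] : x != 0.
  apply: contra_eq_neq u1 => x0.
  by rewrite ux x0 !mulmx0 /qform mulmx0 mxE eq_sym oner_eq0.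
exists i => //; exists Y, u, ((x i 0)^-1 *: (row' i x)^T), (x i 0); split => //.
rewrite ux (mulmx_col_col' B i) scalemxAr scalerDr; congr (_ *m (_ + _)).
by rewrite linearZ/= trmxK -scalemxAr scalerA divff// scale1r.
Qed.

Lemma stiefel_col_mx n k (u : 'cV[R]_n) (Y : 'M[R]_(n, k)) :
  stiefel (row_mx u Y) -> [/\ stiefel Y, qform 1%:M u = 1 & Y^T *m u = 0].
Proof.
rewrite /stiefel/= tr_row_mx mul_col_row scalar_mx_block => /eq_block_mx[u1 _ Yu YY].
by split => //; rewrite /qform mulmx1 u1 mxE.
Qed.

Lemma stiefel_rank n k (Y : 'M[R]_(n, k)) : stiefel Y -> \rank Y = k.
Proof.
move=> sY; apply/eqP; rewrite eqn_leq rank_leq_col/= -[X in (X <= _)%N](mxrank1 R k) -sY.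
exact: mxrankM_maxr.
Qed.

Lemma stiefel_coprojector n k (Y : 'M[R]_(n, k)) : stiefel Y ->
  \rank (1%:M - Y *m Y^T) = (n - k)%N.
Proof.
move=> sY; have sY' : Y^T *m Y = 1%:M := sY; have rY := stiefel_rank sY.
apply/eqP; rewrite eqn_leq; apply/andP; split.
  rewrite leq_subRL; last by rewrite -[X in (X <= _)%N]rY rank_leq_row.
  rewrite addnC -[X in (_ + X <= _)%N]rY; apply: mulmx0_rank_max.
  by rewrite mulmxBl mul1mx -mulmxA sY' mulmx1 subrr.
rewrite leq_subLR -[X in (X <= _)%N](mxrank1 R n) -[in X in (X <= _)%N](subrK (Y *m Y^T) 1%:M).
rewrite addnC; apply: leq_trans (mxrank_add _ _) _; rewrite leq_add2l.
by apply: leq_trans (mxrankM_maxl _ _) _; rewrite rY.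
Qed.

(** Columns are added one at a time, the next being a unit vector in the range of [1 - Y Y^T], of
    rank [n - k]. A fixed [B] is required although this range moves with [Y]: some [n - k] of the
    [n] columns of the projector span it, and [f] runs over the finitely many selections. *)
Lemma thin_stiefel n k : (k <= n)%N ->
  thin (\sum_(i < k) (n - i.+1)) (@stiefel R n k).
Proof.
elim: k => [|k IH] kn.
  rewrite big_ord0; exists (fun _ => setT) => [_|U _]; last by exists 0%N.
  exists (fun x _ => x = 0), 0, 0; split => [U _|x U ->|x U y V _ _].
  - by exists 0.
  - by rewrite normr0.
  - by rewrite (thinmx0 U) (thinmx0 V) subrr normr0 mul0r.
have tE := IH (ltnW kn).
pose B (f : {ffun 'I_(n - k.+1).+1 -> 'I_n}) : 'M[R]_(n, (n - k.+1).+1) := (rowsub f 1%:M)^T.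
have tB f := thin_ext_range (B f) (@subset_refl _ _) tE.
rewrite big_ord_recr/=.
apply: thin_sub (thin_bigcup tB) => U.
rewrite -[U](@hsubmxK _ n 1 k); move: (lsubmx _) (rsubmx _) => u Y sUY.
have [sY u1 Yu] := stiefel_col_mx sUY.
set P := 1%:M - Y *m Y^T.
have PT : P^T = P by rewrite linearB/= trmx1 trmx_mul trmxK.
have Pu : P *m u = u by rewrite mulmxBl mul1mx -mulmxA Yu mulmx0 subr0.
have : exists (f : {ffun 'I_(\rank P) -> 'I_n}) (x : 'rV[R]_(\rank P)),
    u = P *m ((rowsub f 1%:M)^T *m x^T).
  exists (maxrankfun P).
  have : (u^T *m P <= rowsub (maxrankfun P) P)%MS by rewrite eq_maxrowsub submxMl.
  move=> /submxP[x ux]; exists x.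
  apply: trmx_inj; rewrite !trmx_mul !trmxK PT -mulmxA mul_rowsub_mx mul1mx -ux.
  by rewrite -[in LHS]Pu trmx_mul PT.
rewrite (stiefel_coprojector sY) -(subnSK kn) => -[f [x ux]].
by exists f => //; exists Y, u, x^T; split.
Qed.

(** Extensions put the new column in front; this moves it back to position [j]. *)
Definition insert_col n k (j : 'I_k.+1) (V : 'M[R]_(n, 1 + k)) : 'M[R]_(n, k.+1) :=
  \matrix_(i, l) V i (if unlift j l is Some l' then rshift 1 l' else lshift k 0).

Lemma insert_col_col' n k (j : 'I_k.+1) (U : 'M[R]_(n, k.+1)) :
  insert_col j (row_mx (col j U) (col' j U)) = U.
Proof.
apply/matrixP => i l; rewrite mxE; case: unliftP => [l' ->|->].
  by rewrite row_mxEr mxE.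
by rewrite row_mxEl mxE.
Qed.

(* If [Ur^T U v = 0] with [v_j != 0], then column [j] of [U] is, up to the other
   columns, in the kernel of [Ur^T], of dimension [n - k.+1]. *)
Lemma thin_singular n k (Ur : 'M[R]_(n, k.+1)) : (k.+1 < n)%N -> stiefel Ur ->
  thin (\sum_(i < k) (n - i.+1) + (n - k.+2))
    [set U : 'M[R]_(n, k.+1) | stiefel U /\ Ur^T *m U \notin unitmx].
Proof.
move=> kn sUr.
(* The kernel of [Ur^T] has dimension [n - k.+1], written as a successor because one dimension is
   lost in projective space; [k.+1 < n] is used here. *)
have [B hB] : exists B : 'M[R]_(n, (n - k.+2).+1),
    forall w : 'cV_n, Ur^T *m w = 0 -> exists x, w = B *m x.
  have : exists B : 'M[R]_(n, \rank (kermx Ur)),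
      forall w : 'cV_n, Ur^T *m w = 0 -> exists x, w = B *m x.
    exists (row_base (kermx Ur))^T => w Uw.
    have : (w^T <= row_base (kermx Ur))%MS.
      rewrite eq_row_base; apply/sub_kermxP; apply: trmx_inj.
      by rewrite trmx_mul trmxK Uw trmx0.
    by move=> /submxP[x wx]; exists x^T; rewrite -trmx_mul -wx trmxK.
  by rewrite mxrank_ker (stiefel_rank sUr) -(subnSK kn).
have tE := thin_ext_range B (@subset_refl _ _) (@thin_stiefel n k (ltnW (ltnW kn))).
have tI (j : 'I_k.+1) := thin_image (f := insert_col j) _ tE.
apply: (@thin_sub _ _ _ _ (\bigcup_(j : 'I_k.+1) (insert_col j @` [set V | exists Y u x,
    [/\ stiefel Y, qform 1%:M u = 1, u = (1%:M - Y *m Y^T) *m (B *m x) &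
        V = row_mx u Y]]))); last first.
  apply: thin_bigcup => j; apply: tI => i U V.
  apply/mx_normP => // a b; rewrite !mxE; set l := (X in U a X).
  by have := le_mx_norm (U - V) a l; rewrite !mxE.
move=> U [sU nU].
have [v [Uv v0]] : exists v : 'cV[R]_k.+1, Ur^T *m U *m v = 0 /\ v != 0.
  apply: contrapT => nv; move/negP: nU; apply; apply: unitmx_inj => v Uv.
  by apply/eqP; apply: contrapT => /negP v0; apply: nv; exists v.
have /cV0Pn[j vj] := v0.
have [x Ux] : exists x, U *m v = B *m x by apply: hB; rewrite mulmxA.
have sU' : U^T *m U = 1%:M := sU.
have sY : stiefel (col' j U).
  apply/matrixP => a b; have /matrixP/(_ (lift j a) (lift j b)) := sU'.
  rewrite !mxE (inj_eq lift_inj) => <-.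
  by apply: eq_bigr => i _; rewrite !mxE.
have u1 : qform 1%:M (col j U) = 1.
  have /matrixP/(_ j j) := sU'; rewrite !mxE eqxx qform1; apply: etrans.
  by apply: eq_bigr => i _; rewrite !mxE expr2.
have Yu : (col' j U)^T *m col j U = 0.
  apply/colP => a; have /matrixP/(_ (lift j a) j) := sU'.
  rewrite !mxE eq_sym (negbTE (neq_lift _ _)); apply: etrans.
  by apply: eq_bigr => i _; rewrite !mxE.
exists j => //; exists (row_mx (col j U) (col' j U)); last exact: insert_col_col'.
(* Applied to [U v / v_j], the projector [1 - Y Y^T] removes the other columns and leaves column
   [j]. *)
exists (col' j U), (col j U), ((v j 0)^-1 *: x); split => //.
rewrite -scalemxAr -Ux (mulmx_col_col' U j); move: sY Yu; move: (col' j U) (col j U) => Y u sY Yu.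
have sY' : Y^T *m Y = 1%:M := sY.
have PY : (1%:M - Y *m Y^T) *m Y = 0 by rewrite mulmxBl mul1mx -mulmxA sY' mulmx1 subrr.
rewrite scalerDr scalerA mulVf// scale1r mulmxDr -scalemxAr mulmxA PY mul0mx scaler0 addr0.
by rewrite mulmxBl mul1mx -mulmxA Yu mulmx0 subr0.
Qed.

End stiefel_sets.

(** The sum runs over the spheres from which successive columns are drawn: after [i] columns, the
    unit sphere of an [n - i] dimensional space. *)
Lemma stiefel_dimE n k : (k <= n)%N -> (\sum_(i < k) (n - i.+1) = stiefel_dim n k)%N.
Proof.
move=> kn; apply/eqP; rewrite /stiefel_dim -(eqn_add2r (k * k.+1)./2).
have -> : ((k * k.+1)./2 = \sum_(i < k) i.+1)%N.
  have := bin2_sum k.+1; rewrite big_nat_recl// add0n bin2 mulnC => <-.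
  by rewrite big_mkord.
rewrite -big_split/= (eq_bigr (fun=> n)); last first.
  by move=> i _; rewrite subnK// (leq_trans (ltn_ord i)).
rewrite sum_nat_const card_ord mulnC subnK// -[X in (_ <= X)%N]mulnC -[X in (_ <= X * _)%N](card_ord k) -sum_nat_const.
by apply: leq_sum => i _; rewrite (leq_trans (ltn_ord i)).
Qed.

Theorem mainTheorem5 (R : realType) (n r p q : nat) (mu : R)
    (A : 'M[R]_n) (C : 'M[R]_(p, n)) (H : 'M[R]_(p, q))
    (Ur : 'M[R]_(n, r)) :
  (1 <= r)%N -> (r < n)%N -> 0 < mu ->
  A \in unitmx -> H *m H^T \in unitmx ->
  A = A^T -> distinct_eigenvalues A ->
  stiefel Ur -> spans_dominant_subspace A Ur ->
  observable (Ur^T *m A *m Ur) (C *m Ur) ->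
  almost_every_stiefel (fun U0 : 'M[R]_(n, r) =>
    forall S0 : 'M[R]_r, posdef S0 ->
    exists (U : R -> 'M[R]_(n, r)) (S : R -> 'M[R]_r),
      is_global_solution A C H mu U0 S0 U S /\
      exists (Uoo : 'M[R]_(n, r)) (Soo : 'M[R]_r),
        [/\ U t @[t --> +oo] --> Uoo, S t @[t --> +oo] --> Soo,
            stiefel Uoo, posdef Soo & spans_dominant_subspace A Uoo]).
Proof.
move=> r1 rn mu0 _ uH /esym sA _ sUr dUr oUr; case: r r1 rn Ur sUr dUr oUr => // k _ kn Ur sUr dUr oUr.
(* The dimension of the manifold with its last summand [n - k.+1] lowered to [n - k.+2]; the
   truncated subtractions differ because [k.+1 < n]. *)
apply: (hausdorff_thin (m := (\sum_(i < k) (n - i.+1) + (n - k.+2))%N)).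
  apply: thin_sub (thin_singular kn sUr) => U0 [sU0 nP]; split => //.
  apply/negP => uU0; apply: nP => S0 pS0.
  exact: cascade_converges uH sA sUr dUr oUr sU0 uU0 pS0.
rewrite -(stiefel_dimE (ltnW kn)) big_ord_recr/= ltn_add2l.
by rewrite ltn_sub2l.
Qed.
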